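(* Assume that $(u_k)_{k \geq 0}$ is a sequence in $\mathrm{BV}(\mathbb R^n)$ that satisfies, for all $k\ge0$, \[\|u_k\|_{L^1} \leq V \sigma^{k(\alpha-1)}, \qquad \mathbf V(u_k) \leq V \sigma^{k\alpha},\] for some $\alpha \in \,]0,1[$, $\sigma > 1$ and $V \geq 0$. Then $u = \sum_{k \geq 0} u_k$ is in $L^p(\mathbb R^n)$ if $1\leq p < \frac{n}{n-1 + \alpha}$. Indeed, $\|u\|_{L^p} \leq C(n,\sigma,p)\, V$ if $p<\frac{n}{n-1+\alpha}$. In particular, $\mathrm{BV}_c^\alpha(\mathbb R^n) \subset L^p_c(\mathbb R^n)$ for $1 \leq p < \frac{n}{n-1 + \alpha}$, and the inclusion is compact if restricted to functions with support in some fixed compact set.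
   Context: $n\ge1$ is an integer. $C(n,\sigma,p)$ denotes a finite constant depending on the indicated quantities. $L^p_c(\mathbb R^n)$ denotes $L^p$ functions with (essentially) compact support. $\mathbf V(u)=\sup\{\int u\operatorname{div}\varphi\,dx:\varphi\in C_c^1(\mathbb R^n,\mathbb R^n),\|\varphi\|_\infty\le1\}$ and $\mathrm{BV}(\mathbb R^n)=\{u\in L^1(\mathbb R^n):\mathbf V(u)<\infty\}$. For $\alpha\in[0,1]$, $\mathrm{Lip}^\alpha(g)=\sup_{x\ne y}|g(x)-g(y)|/|x-y|^\alpha$ and $\mathrm{Lip}=\mathrm{Lip}^1$; $\mathrm{Lip}(\mathbb R^n)$ is the set of real Lipschitz functions. For $u\in L^1_c(\mathbb R^n)$, $\mathbf V^\alpha(u)$ is the smallest $C\in[0,\infty]$ such that $\bigl|\int_{\mathbb R^n} u\det D(f,g^1,\dots,g^{n-1})\,dx\bigr|\le C\,\mathrm{Lip}^\alpha(f)\,\mathrm{Lip}(g^1)\cdots\mathrm{Lip}(g^{n-1})$ for all $f,g^1,\dots,g^{n-1}\in\mathrm{Lip}(\mathbb R^n)$, and $\mathrm{BV}^\alpha_c(\mathbb R^n)=\{u\in L^1_c(\mathbb R^n):\mathbf V^\alpha(u)<\infty\}$. Compactness of the inclusion refers to the norm $\|u\|_{L^1}+\mathbf V^\alpha(u)$: for a compact set $K\subset\mathbb R^n$, every sequence in $\mathrm{BV}^\alpha_c(\mathbb R^n)$ with supports in $K$ that is bounded in this norm has a subsequence converging in $L^p$.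
   Formalization: The constant C(n,σ,p) is allowed to depend on α as well; independent of α the bound fails, e.g. n=p=1, u_k = cσ^{kα} times the indicator of [0,σ^{-k}], whose sum has L^1 norm c/(1-σ^{α-1}), unbounded as α→1. *)

(* Defs.v *)
From HB Require Import structures.
From mathcomp Require Import all_boot all_order all_algebra.
From mathcomp Require Import all_classical all_reals all_analysis.

Set Implicit Arguments.
Unset Strict Implicit.
Unset Printing Implicit Defensive.

Import Order.TTheory GRing.Theory Num.Theory.
Import numFieldNormedType.Exports.

Local Open Scope classical_set_scope.
Local Open Scope ring_scope.

(* The sigma-algebra on row vectors is the product one, generated by the
   coordinates; over a realType it coincides with the Borel sigma-algebra.   *)
Definition measure_rV_display : measure_display -> measure_display.
Proof. exact. Qed.

Section measurable_rV.
Context {d} {T : sigmaRingType d}.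
Variable n : nat.

Let coors : 'I_n -> 'rV[T]_n -> T := fun i x => x ord0 i.

Let rV_set0 : g_sigma_preimage coors set0.
Proof. exact: sigma_algebra0. Qed.

Let rV_setC A : g_sigma_preimage coors A -> g_sigma_preimage coors (~` A).
Proof. exact: sigma_algebraC. Qed.

Let rV_bigcup (F : _^nat) : (forall i, g_sigma_preimage coors (F i)) ->
  g_sigma_preimage coors (\bigcup_i (F i)).
Proof. exact: sigma_algebra_bigcup. Qed.

HB.instance Definition _ := @isMeasurable.Build (measure_rV_display d)
  'rV[T]_n (g_sigma_preimage coors) rV_set0 rV_setC rV_bigcup.

End measurable_rV.

Lemma measurable_coord_rV d (T : sigmaRingType d) n (i : 'I_n) :
  measurable_fun [set: 'rV[T]_n] (fun x => x ord0 i).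
Proof.
move=> _ Y mY; rewrite setTI; apply: sub_sigma_algebra => /=.
rewrite -bigcup_seq/=; exists i => /=; first by rewrite mem_index_enum.
by exists Y => //; rewrite setTI.
Qed.

Lemma measurable_fun_rVP d1 d2 (T1 : measurableType d1)
    (T2 : measurableType d2) n (f : T1 -> 'rV[T2]_n) :
  (forall i, measurable_fun [set: T1] (fun x => f x ord0 i)) ->
  measurable_fun [set: T1] f.
Proof.
move=> mf _ A mA; rewrite setTI.
suff : g_sigma_preimage (fun i (x : 'rV[T2]_n) => x ord0 i) `<=`
    [set B | measurable (f @^-1` B)] by exact.
apply: smallest_sub.
- split => /=; first by rewrite preimage_set0.
    by move=> B mB; rewrite setTD -preimage_setC; exact: measurableC.
  by move=> F mF; rewrite preimage_bigcup; exact: bigcup_measurable.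
- case: n => [|n] in f mf A mA *; first by rewrite big_ord0.
  rewrite -bigcup_mkord_ord; apply: bigcup_sub => i Ii _ [B mB <-] /=.
  by rewrite setTI; have := mf (inord i) measurableT B mB; rewrite setTI.
Qed.

Section lebesgue_rV.
Context {R : realType}.

Definition cons_rV n (z : measurableTypeR R * 'rV[R]_n) : 'rV[R]_n.+1 :=
  \row_(i < n.+1) if unlift ord0 i is Some j then z.2 ord0 j else z.1.

Lemma measurable_cons_rV n : measurable_fun setT (@cons_rV n).
Proof.
apply: measurable_fun_rVP => i.
under eq_fun do rewrite mxE.
case: unliftP => [j _|_]; last exact: measurable_fst.
exact: (measurableT_comp (measurable_coord_rV j)).
Qed.

Definition uncons_rV n (x : 'rV[R]_n.+1) : measurableTypeR R * 'rV[R]_n :=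
  (x ord0 ord0, \row_(i < n) x ord0 (lift ord0 i)).

Lemma measurable_uncons_rV n : measurable_fun setT (@uncons_rV n).
Proof.
apply: measurable_fun_pair; first exact: measurable_coord_rV.
apply: measurable_fun_rVP => i.
under eq_fun do rewrite mxE.
exact: measurable_coord_rV.
Qed.

Lemma cons_rVK n : cancel (@cons_rV n) (@uncons_rV n).
Proof.
move=> [x y]; congr pair; first by rewrite mxE unlift_none.
by apply/rowP => i; rewrite !mxE liftK.
Qed.

Section cons_measure.
Variables (n : nat) (mu : {sigma_finite_measure set 'rV[R]_n -> \bar R}).

Let lebesgue_prod : {measure set (measurableTypeR R * 'rV[R]_n) -> \bar R} :=
  (lebesgue_measure \x mu)%E.

Definition cons_measure : set 'rV[R]_n.+1 -> \bar R :=
  pushforward lebesgue_prod (@cons_rV n).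

Let pm := measure_function_pushforward__canonical__measure_function_Measure
  lebesgue_prod (@measurable_cons_rV n).

HB.instance Definition _ := isMeasure.Build _ _ _ cons_measure
  (measure0 pm) (measure_ge0 pm) (@measure_semi_sigma_additive _ _ _ pm).

Lemma cons_measureE A B : measurable A -> measurable B ->
  cons_measure [set x | A (x ord0 ord0) /\ B (\row_i x ord0 (lift ord0 i))] =
  (lebesgue_measure A * mu B)%E.
Proof.
move=> mA mB; rewrite /cons_measure /pushforward.
rewrite (_ : _ @^-1` _ = A `*` B); first exact: product_measure1E.
apply/seteqP; split => -[x y] /=;
  by have := cons_rVK (x, y); rewrite /uncons_rV => -[-> ->].
Qed.

Let cons_measure_sigma_finite : sigma_finite setT cons_measure.
Proof.
have /sigma_finiteP[F [TF ndF Foo]] := sigma_finiteT (@lebesgue_measure R).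
have /sigma_finiteP[G [TG ndG Goo]] := sigma_finiteT mu.
exists (fun k => [set x : 'rV[R]_n.+1 | F k (x ord0 ord0) /\
                          G k (\row_i x ord0 (lift ord0 i))]) => [|k].
  apply/seteqP; split => // x _.
  have : setT (x ord0 ord0) by [].
  rewrite TF => -[a _ Fa].
  have : setT (\row_i x ord0 (lift ord0 i)) by [].
  rewrite TG => -[b _ Gb].
  exists (maxn a b) => //; split.
    by move: Fa; exact/subsetPset/ndF/leq_maxl.
  by move: Gb; exact/subsetPset/ndG/leq_maxr.
have [? ?] := Foo k; have [? ?] := Goo k; split.
  have /(_ _ (measurableX _ _)) := @measurable_uncons_rV n measurableT.
  by move=> /(_ (F k) (G k)); rewrite setTI; exact.
by rewrite cons_measureE// lte_mul_pinfty// ge0_fin_numE.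
Qed.

HB.instance Definition _ := Measure_isSigmaFinite.Build _ _ _ cons_measure
  cons_measure_sigma_finite.

End cons_measure.

Fixpoint lebesgue_rV n : {sigma_finite_measure set 'rV[R]_n -> \bar R} :=
  if n is m.+1 then cons_measure (lebesgue_rV m) else \d_(0 : 'rV[R]_0).

Lemma lebesgue_rV_box n (A : 'I_n -> set (measurableTypeR R)) :
  (forall i, measurable (A i)) ->
  lebesgue_rV n [set x | forall i, A i (x ord0 i)] =
  (\prod_(i < n) lebesgue_measure (A i))%E.
Proof.
elim: n A => [|n IHn] A mA.
  by rewrite big_ord0 /= diracE mem_set// => -[].
rewrite big_ord_recl -IHn// -cons_measureE//=.
  congr (cons_measure _ _); apply/seteqP; split => [x Ax|x [A0 Ax] i].
    by split => // i; rewrite mxE.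
  by case: (unliftP ord0 i) => [j ->|->//]; have := Ax j; rewrite mxE.
  exact: mA.
suff -> : (fun x : 'rV[R]_n => forall i, A (lift ord0 i) (x ord0 i)) =
    \bigcap_(i in [set: 'I_n]) [set x | A (lift ord0 i) (x ord0 i)].
  apply: fin_bigcap_measurable => // i _.
  have := @measurable_coord_rV _ (measurableTypeR R) n i measurableT _
    (mA (lift ord0 i)).
  by rewrite setTI.
by apply/seteqP; split => [x Ax i _|x Ax i]; exact: Ax.
Qed.

End lebesgue_rV.

Section bv.
Context {R : realType} {n : nat}.
Local Notation E := 'rV[R]_n.
Local Notation mu := (@lebesgue_rV R n).
Implicit Types (u : E -> R) (phi : E -> E) (K : set E) (alpha p : R).

(* The library norm of 'rV[R]_n is the sup norm: this is the Euclidean one.  *)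
Definition enorm (x : E) : R := Num.sqrt (\sum_(i < n) x ord0 i ^+ 2).

Definition Lp_norm p u : \bar R := Lnorm mu p%:E (EFin \o u).

Definition divergence phi (x : E) : R := \tr ('J phi x).

Definition continuously_differentiable phi :=
  (forall x, differentiable phi x) /\ continuous (fun x => 'J phi x).

Definition vanishes_outside K phi := forall x, ~ K x -> phi x = 0.

Definition C1c phi := continuously_differentiable phi /\
  exists2 K, compact K & vanishes_outside K phi.

Definition bv_variation u : \bar R :=
  ereal_sup [set (\int[mu]_x (u x * divergence phi x)%:E)%E | phi in
    [set phi | C1c phi /\ forall x, enorm (phi x) <= 1]].

Definition BV u := u \in Lfun mu 1%E /\ (bv_variation u < +oo)%E.

Definition supported_in K u := {ae mu, forall x, ~ K x -> u x = 0}.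

Definition Lfun_c p u := u \in Lfun mu p%:E /\
  exists2 K, compact K & supported_in K u.

Definition Lip_alpha alpha (g : E -> R) : \bar R :=
  ereal_sup [set (`|g z.1 - g z.2| / enorm (z.1 - z.2) `^ alpha)%:E | z in
    [set z : E * E | z.1 != z.2]].

Definition Lip (g : E -> R) := Lip_alpha 1 g.

Definition is_Lipschitz (g : E -> R) := (Lip g < +oo)%E.

(* Convergence of \sum_(k >= 0) u_k to u, in L^1 and almost everywhere. *)
Definition is_sum (u_ : nat -> E -> R) u := [/\ u \in Lfun mu 1%E,
  Lp_norm 1 (fun x => \sum_(0 <= k < m) u_ k x - u x) @[m --> \oo] --> 0%E &
  {ae mu, forall x, (\sum_(0 <= k < m) u_ k x) @[m --> \oo] --> u x}].

End bv.

Section bv_alpha.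
Context {R : realType} {n : nat}.
Local Notation E := 'rV[R]_n.+1.
Local Notation mu := (@lebesgue_rV R n.+1).
Implicit Types (u f : E -> R) (g : 'I_n -> E -> R) (alpha : R).

Definition tuple_map f g (x : E) : E :=
  \row_(i < n.+1) if unlift ord0 i is Some j then g j x else f x.

(* By Rademacher's theorem the map (f, g) is differentiable almost everywhere;
   'J takes arbitrary values on the remaining negligible set.                *)
Definition detD f g (x : E) : R := \det ('J (tuple_map f g) x).

(* Here 0 * +oo = 0. This matters only for C = 0 and f not alpha-Hoelder, and
   then, u being compactly supported, cutting off f away from the support of u
   shows that the integral is 0 anyway. The infimum below is thus a minimum. *)
Definition bv_variation_alpha_bound alpha u (C : \bar R) := (0 <= C)%E /\
  forall f g, is_Lipschitz f -> (forall i, is_Lipschitz (g i)) ->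
    (`| \int[mu]_x (u x * detD f g x)%:E | <=
     C * (Lip_alpha alpha f * \prod_(i < n) Lip (g i)))%E.

Definition bv_variation_alpha alpha u : \bar R :=
  ereal_inf [set C | bv_variation_alpha_bound alpha u C].

Definition BV_alpha_c alpha u :=
  Lfun_c 1 u /\ (bv_variation_alpha alpha u < +oo)%E.

End bv_alpha.

(* Main.v *)
(* Replace u by the step functions P_j u, constant on the dyadic cubes of side
   2^-j of a large cube, whose values are the integrals of u against
   tensor-product quadratic B-splines of width comparable to 2^-j. The value of
   P_(j+1) u - P_j u on a cube is the integral of u against the difference of
   two B-splines of mass one, and such a difference is the divergence of an
   explicit C^1 field supported near the cube. Summing these fields with signs,
   ||P_(j+1) u - P_j u||_1 becomes the integral of u against div F, where
   |F| <= C 2^-j and F is C-Lipschitz, so that F has alpha-Hoelder constant at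
   most C 2^(-j(1-alpha)). Hence ||P_(j+1) u - P_j u||_1 <= C M 2^(-j(1-alpha)):
   - if V^alpha(u) is finite, by applying its definition to each component of F
     and the remaining coordinate functions;
   - if u is the sum of the u_k, because the integral of u_k against div F is at
     most C min(||u_k||_1, 2^-j V(u_k)).
   On functions constant on cubes of side 2^-j the L^p norm is at most
   2^(jN(1-1/p)) times the L^1 norm, so that P_j u converges geometrically in
   L^p when N(1-1/p) < 1 - alpha, that is when p < N/(N-1+alpha). The limit is u,
   which is checked by integrating over orthants. The rate is uniform on bounded
   sets of BV^alpha_c and P_j u depends on finitely many coefficients, so a
   diagonal extraction gives compactness. *)

Require Import Defs.
From HB Require Import structures.
From mathcomp Require Import all_boot all_order all_algebra.
From mathcomp Require Import all_classical all_reals all_analysis.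
From mathcomp Require Import perm measurable_realfun ring lra.

Set Implicit Arguments.
Unset Strict Implicit.
Unset Printing Implicit Defensive.

Import Order.TTheory GRing.Theory Num.Theory.
Import numFieldNormedType.Exports.

Local Open Scope classical_set_scope.
Local Open Scope ring_scope.

(** * Quadratic and cubic splines *)

Section splines.
Context {R : realType}.
Implicit Types (t s : R) (f g G : R -> R).

(** Smoothness is asked of the test functions only. The output [step] is piecewise constant, so that
    its L^p norms are read off the coefficients; the B-splines must be C^1, because [bv_variation]
    tests with C^1 fields, and this is why their degree is 2. The obstacle is uniformity: the signs
    are arbitrary and the number of cubes grows with j. Sums over multi-indices of products factor
    into one-dimensional sums, and these are bounded independently of the number of translates
    because a spline is a unit difference of a nondecreasing function with values in [0, 1], hence
    telescopes. In several variables, the product of fine splines is changed into the product of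
    coarse ones one coordinate at a time, and integrating the changing factor in its coordinate i
    gives component i of the field. For the limit, no bound on P_j u - u is available beforehand.
    Summed over all indices above a corner, cells and B-splines telescope to products built from
    [heaviside] and from [smoothstep], and under rescaling both tend to the indicator of the same
    orthant, cut off by the cube. *)

Definition bdiff f t : R := f t - f (t - 1).

Definition pospow k t : R := Num.max t 0 ^+ k.

Definition ramp : R -> R := bdiff (pospow 1).
(* The splines of degree 1, 2 and 3: hat and bspline have support [0, 2] and
   [0, 3]; smoothstep and smootherstep are primitives of hat and bspline, equal
   to 0 on the left and to 1 on the right of these supports. *)
Definition hat : R -> R := bdiff ramp.
Definition smoothstep t : R := bdiff (bdiff (pospow 2)) t / 2.
Definition bspline : R -> R := bdiff smoothstep.
Definition smootherstep t : R := bdiff (bdiff (bdiff (pospow 3))) t / 6.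

Lemma sum_bdiff f t M :
  \sum_(q < M) bdiff f (t - q%:R) = f t - f (t - M%:R).
Proof.
elim: M => [|M IH]; first by rewrite big_ord0 subr0 subrr.
rewrite big_ord_recr/= IH /bdiff -natr1 opprD addrA.
by rewrite addrA subrK.
Qed.

(** Meant for [pospow 2], whose formula changes at 0: a remainder of at most h^2 can be checked by
    cases on the signs of t and t + h. *)
Lemma is_derive_quadratic f t d C :
  (forall h, `|f (t + h) - f t - h * d| <= C * h ^+ 2) -> is_derive t 1 f d.
Proof.
move=> fC.
have C0 : 0 <= C by have := fC 1; rewrite expr1n mulr1; exact: le_trans.
suff cvgf : h^-1 *: (f (h *: (1 : R) + t) - f t) @[h --> 0^'] --> d.
  apply: DeriveDef; last exact/cvg_lim.
  by apply/cvg_ex; exists d.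
apply/cvgrPdist_le => e e0; near=> h.
have h0 : h != 0 by near: h; exact: nbhs_dnbhs_neq.
have -> : d - h^-1 *: (f (h *: (1 : R) + t) - f t) =
    - h^-1 * (f (t + h) - f t - h * d).
  have -> : h *: (1 : R) + t = t + h by rewrite [_ *: _]mulr1 addrC.
  have fE (a b : R) : d - h^-1 * (a - b) = - h^-1 * (a - b - h * d) by field.
  exact: fE.
rewrite normrM normrN normfV ler_pdivrMl ?normr_gt0//.
apply: le_trans (fC h) _.
rewrite -real_normK ?num_real// expr2 mulrCA ler_pM2l ?normr_gt0//.
have : `|h| < e / (C + 1).
  near: h; apply: nbhs_dnbhs; apply/nbhs_ballP; exists (e / (C + 1)) => /=.
    by rewrite divr_gt0// ltr_wpDl.
  by move=> h; rewrite /ball/= sub0r normrN.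
rewrite ltr_pdivlMr ?ltr_wpDl// => /ltW; apply: le_trans.
by rewrite mulrC ler_wpM2l// lerDl.
Unshelve. all: by end_near. Qed.

Lemma pospow_le0 k t : t <= 0 -> pospow k.+1 t = 0.
Proof. by move=> t0; rewrite /pospow (max_idPr t0) expr0n. Qed.

Lemma pospow_ge0 k t : 0 <= t -> pospow k t = t ^+ k.
Proof. by move=> t0; rewrite /pospow (max_idPl t0). Qed.

Lemma is_derive_pospow2 t : is_derive t 1 (pospow 2) (2 * pospow 1 t).
Proof.
apply: (@is_derive_quadratic _ _ _ 1) => h; rewrite mul1r ler_norml.
case: (leP t 0) => t0; case: (leP (t + h) 0) => th0;
  rewrite ?(pospow_le0 _ t0) ?(pospow_le0 _ th0)
          ?(pospow_ge0 _ (ltW t0)) ?(pospow_ge0 _ (ltW th0)); apply/andP; split;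
  nra.
Qed.

Lemma pospow3E t : pospow 3 t = t * pospow 2 t.
Proof.
case: (leP t 0) => t0; first by rewrite !pospow_le0// mulr0.
by rewrite !(pospow_ge0 _ (ltW t0)) -exprS.
Qed.

Lemma is_derive_pospow3 t : is_derive t 1 (pospow 3) (3 * pospow 2 t).
Proof.
have -> : pospow 3 = (@id R) * pospow 2 by apply/funext => x; rewrite pospow3E.
have := is_derive_pospow2 t => d2.
apply: is_derive_eq; rewrite /GRing.scale/= mulr1.
case: (leP t 0) => t0; first by rewrite !pospow_le0// !mulr0 addr0.
rewrite !(pospow_ge0 _ (ltW t0)); ring.
Qed.

Lemma is_derive_bdiff f g t : (forall t, is_derive t 1 f (g t)) ->
  is_derive t 1 (bdiff f) (bdiff g t).
Proof.
move=> fg; have d1 : is_derive t 1 (fun s : R => s - 1) 1.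
  by apply: is_derive_eq; rewrite subr0.
have := fg t; have := fg (t - 1) => d2 d3.
have dc := @is_derive1_comp _ f (fun s : R => s - 1) t _ _ d2 d1.
by apply: (is_derive_eq (is_deriveB d3 dc)); rewrite mulr1.
Qed.

Lemma is_derive_smoothstep t : is_derive t 1 smoothstep (hat t).
Proof.
have d : is_derive t 1 (bdiff (bdiff (pospow 2))) (bdiff (bdiff (fun s => 2 * pospow 1 s)) t).
  by apply: is_derive_bdiff => s; apply: is_derive_bdiff => r; exact: is_derive_pospow2.
have -> : smoothstep = 2^-1 \*: bdiff (bdiff (pospow 2)).
  by apply/funext => s; rewrite /smoothstep mulrC.
apply: is_derive_eq; rewrite /GRing.scale/= /hat /ramp /bdiff; by field.
Qed.

Lemma is_derive_smootherstep t : is_derive t 1 smootherstep (bspline t).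
Proof.
have d : is_derive t 1 (bdiff (bdiff (bdiff (pospow 3))))
    (bdiff (bdiff (bdiff (fun s => 3 * pospow 2 s))) t).
  do 3! apply: is_derive_bdiff => ?; exact: is_derive_pospow3.
have -> : smootherstep = 6^-1 \*: bdiff (bdiff (bdiff (pospow 3))).
  by apply/funext => s; rewrite /smootherstep mulrC.
apply: is_derive_eq; rewrite /GRing.scale/= /bspline /smoothstep /bdiff; by field.
Qed.

Lemma is_derive_bspline t : is_derive t 1 bspline (bdiff hat t).
Proof. by apply: is_derive_bdiff; exact: is_derive_smoothstep. Qed.

Lemma continuous_bdiff f : continuous f -> continuous (bdiff f).
Proof.
move=> cf t; apply: cvgB; first exact: cf.
apply: (@continuous_comp _ _ _ (fun s : R => s - 1) f); last exact: cf.
by apply: cvgB; [exact: cvg_id|exact: cvg_cst].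
Qed.

Lemma continuous_hat : continuous hat.
Proof.
do 2! apply: continuous_bdiff; move=> t; rewrite /pospow.
have -> : (fun t : R => Num.max t 0 ^+ 1) = (fun t : R => (t + `|t|) / 2).
  apply/funext => s; rewrite expr1; case: (leP s 0) => s0.
    by rewrite ler0_norm// subrr mul0r.
  by rewrite gtr0_norm//; field.
apply: cvgM; last exact: cvg_cst.
by apply: cvgD; [exact: cvg_id|exact: norm_continuous].
Qed.

Lemma ndecr_derive f g : (forall t, is_derive t 1 f (g t)) ->
  (forall t, 0 <= g t) -> {homo f : s t / s <= t}.
Proof.
move=> fg g0 s t st.
have cf x : {for x, continuous f}.
  apply: differentiable_continuous; rewrite -derivable1_diffP.
  by have := fg x => dx; apply: ex_derive.
have [c _ e] := @MVT_segment R f g s t st (fun x _ => fg x)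
  (continuous_subspaceT cf).
by rewrite -subr_ge0 e mulr_ge0// subr_ge0.
Qed.

Lemma ramp_ndecr : {homo ramp : s t / s <= t}.
Proof.
move=> s t st; rewrite /ramp /bdiff /pospow !expr1.
rewrite /Num.max; do 4!case: ltP => ?; lra.
Qed.

Lemma ramp01 t : 0 <= ramp t <= 1.
Proof.
rewrite /ramp /bdiff /pospow !expr1 /Num.max.
by do 2!case: ltP => ?; apply/andP; split; lra.
Qed.

Lemma hat_ge0 t : 0 <= hat t.
Proof. by rewrite subr_ge0 ramp_ndecr// gerBl. Qed.

Lemma smoothstep_ndecr : {homo smoothstep : s t / s <= t}.
Proof. exact: ndecr_derive is_derive_smoothstep hat_ge0. Qed.

Lemma smoothstep_le0 t : t <= 0 -> smoothstep t = 0.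
Proof.
move=> t0; rewrite /smoothstep /bdiff !pospow_le0 ?subrr ?mul0r//; lra.
Qed.

Lemma smoothstep_ge2 t : 2 <= t -> smoothstep t = 1.
Proof.
move=> t2; rewrite /smoothstep /bdiff !pospow_ge0; [|lra..].
by field.
Qed.

Lemma ndecr01 G (w : R) : {homo G : s t / s <= t} ->
  (forall t, t <= 0 -> G t = 0) -> (forall t, w <= t -> G t = 1) ->
  forall t, 0 <= G t <= 1.
Proof.
move=> Gnd G0 G1 t; apply/andP; split.
  by rewrite -(G0 (Num.min t 0)) ?Gnd// ge_min lexx ?orbT.
by rewrite -(G1 (Num.max t w)) ?Gnd// le_max lexx ?orbT.
Qed.

Lemma smoothstep01 t : 0 <= smoothstep t <= 1.
Proof.
exact: ndecr01 smoothstep_ndecr smoothstep_le0 smoothstep_ge2 t.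
Qed.

Lemma bspline_ge0 t : 0 <= bspline t.
Proof. by rewrite subr_ge0 smoothstep_ndecr// gerBl. Qed.

Lemma bspline_le1 t : bspline t <= 1.
Proof.
have /andP[_ s1] := smoothstep01 t; have /andP[s0 _] := smoothstep01 (t - 1).
rewrite /bspline /bdiff; lra.
Qed.

Lemma bspline_eq0 t : t <= 0 \/ 3 <= t -> bspline t = 0.
Proof.
move=> [t0|t3]; rewrite /bspline /bdiff.
  by rewrite !smoothstep_le0 ?subrr//; lra.
by rewrite !smoothstep_ge2 ?subrr//; lra.
Qed.

Lemma smootherstep_ndecr : {homo smootherstep : s t / s <= t}.
Proof. exact: ndecr_derive is_derive_smootherstep bspline_ge0. Qed.

Lemma smootherstep_le0 t : t <= 0 -> smootherstep t = 0.
Proof.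
move=> t0; rewrite /smootherstep /bdiff !pospow_le0 ?subrr ?mul0r//; lra.
Qed.

Lemma smootherstep_ge3 t : 3 <= t -> smootherstep t = 1.
Proof.
move=> t3; rewrite /smootherstep /bdiff !pospow_ge0; [|lra..].
by field.
Qed.

Lemma smootherstep01 t : 0 <= smootherstep t <= 1.
Proof.
exact: ndecr01 smootherstep_ndecr smootherstep_le0 smootherstep_ge3 t.
Qed.

(** The increment over k is the sum of k unit increments, and each of these telescopes in q to a
    difference of two values in [0, 1]. *)
Lemma sum_shift_le G t M k : (forall t, 0 <= G t <= 1) ->
  \sum_(q < M) (G (t - q%:R) - G (t - q%:R - k%:R)) <= k%:R.
Proof.
move=> G01; elim: k => [|k IH].
  by rewrite big1// => q _; rewrite subr0 subrr.
rewrite -natr1.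
rewrite (eq_bigr (fun q : 'I_M => (G (t - q%:R) - G (t - q%:R - k%:R)) +
   bdiff G (t - k%:R - q%:R))); last first.
  move=> q _; rewrite /bdiff opprD addrA.
  by rewrite [t - k%:R - q%:R]addrAC addrA subrK.
rewrite big_split/= lerD// sum_bdiff.
have /andP[_ s1] := G01 (t - k%:R).
have /andP[s0 _] := G01 (t - k%:R - M%:R).
lra.
Qed.

(** The function r - sum_q G (r - q) is nondecreasing, since the derivatives of the translates
    telescope to g r - g (r - M) <= 1. Adding translates thus costs nothing in the Lipschitz
    constant. *)
Lemma sum_bdiff_lip G g s t M : (forall t, is_derive t 1 G (bdiff g t)) ->
  (forall t, 0 <= g t <= 1) -> s <= t ->
  \sum_(q < M) (G (t - q%:R) - G (s - q%:R)) <= t - s.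
Proof.
move=> Gg g01 st; rewrite sumrB.
pose S r := \sum_(q < M) G (r - q%:R).
have dS (r : R) : is_derive r 1 (fun r : R => r - S r)
    (1 - \sum_(q < M) bdiff g (r - q%:R)).
  apply: is_deriveB.
  have -> : S = \sum_(q < M) (fun r => G (r - q%:R)).
    by apply/funext => x; rewrite fct_sumE.
  apply: is_derive_sum => q.
  have d1 : is_derive r 1 (fun x : R => x - q%:R) 1.
    by apply: is_derive_eq; rewrite subr0.
  have dG := Gg (r - q%:R).
  have := @is_derive1_comp _ G (fun x : R => x - q%:R) r _ _ dG d1.
  by rewrite mulr1.
have /(ndecr_derive dS) : forall r, 0 <= 1 - \sum_(q < M) bdiff g (r - q%:R).
  move=> r; rewrite sum_bdiff.
  have /andP[_ s1] := g01 r.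
  have /andP[s0 _] := g01 (r - M%:R).
  lra.
by move=> /(_ s t st); rewrite /S; lra.
Qed.

Lemma sum_bdiff_lip_norm G g s t M : (forall t, is_derive t 1 G (bdiff g t)) ->
  (forall t, 0 <= g t <= 1) -> {homo G : s t / s <= t} ->
  \sum_(q < M) `|G (t - q%:R) - G (s - q%:R)| <= `|t - s|.
Proof.
move=> Gg g01 Gnd; wlog st : s t / s <= t.
  move=> W; case: (leP s t) => [|/ltW] ts; first exact: W.
  rewrite distrC; under eq_bigr do rewrite distrC.
  exact: W.
rewrite (eq_bigr (fun q : 'I_M => (G (t - q%:R) - G (s - q%:R)))).
  by rewrite [leRHS]ger0_norm ?subr_ge0// (sum_bdiff_lip _ Gg).
by move=> q _; rewrite ger0_norm// subr_ge0 Gnd// lerB.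
Qed.

Lemma sum_bspline_le1 t M : \sum_(q < M) bspline (t - q%:R) <= 1.
Proof.
rewrite sum_bdiff.
have /andP[_ s1] := smoothstep01 t.
have /andP[s0 _] := smoothstep01 (t - M%:R).
lra.
Qed.

Lemma sum_abs_bspline t M : \sum_(q < M) `|bspline (t - q%:R)| <= 1.
Proof.
by under eq_bigr do rewrite ger0_norm ?bspline_ge0//; exact: sum_bspline_le1.
Qed.

Lemma sum_bspline_lip s t M :
  \sum_(q < M) `|bspline (t - q%:R) - bspline (s - q%:R)| <= 2 * `|t - s|.
Proof.
have step_lip s' t' := sum_bdiff_lip_norm s' t' M is_derive_smoothstep
  ramp01 smoothstep_ndecr.
apply: (@le_trans _ _ (\sum_(q < M)
    (`|smoothstep (t - q%:R) - smoothstep (s - q%:R)| +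
     `|smoothstep (t - 1 - q%:R) - smoothstep (s - 1 - q%:R)|))).
  apply: ler_sum => q _; rewrite /bspline /bdiff.
  have subrACA (a b c d : R) : a - b - (c - d) = a - c - (b - d) by ring.
  by rewrite /bspline /bdiff !(addrAC _ (- q%:R)) subrACA ler_normB.
rewrite big_split/= mulrDl mul1r lerD//.
have -> : t - s = (t - 1) - (s - 1) by ring.
exact: step_lip.
Qed.

Lemma sum_smootherstep_lip s t M :
  \sum_(q < M) `|smootherstep (t - q%:R) - smootherstep (s - q%:R)| <= `|t - s|.
Proof.
exact: sum_bdiff_lip_norm is_derive_smootherstep smoothstep01 smootherstep_ndecr.
Qed.

End splines.

(** * Telescoping and summing products *)

Section products.
Context {R : realType}.

(* Factor l of the i-th term of the telescoping of \prod a - \prod b: b before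
   i, a after i, and c at i. *)
Definition mixed_factor (i l : nat) (a b c : R) : R :=
  if (l < i)%N then b else if l == i then c else a.

Lemma prodB_telescope n (a b : 'I_n -> R) :
  \prod_l a l - \prod_l b l =
  \sum_(i < n) \prod_(l < n) mixed_factor i l (a l) (b l) (a l - b l).
Proof.
elim: n a b => [|n IH] a b; first by rewrite !big_ord0 subrr.
pose w := widen_ord (leqnSn n).
have last_term : \prod_(l < n.+1) mixed_factor n l (a l) (b l) (a l - b l) =
    \prod_(l < n) b (w l) * (a ord_max - b ord_max).
  rewrite big_ord_recr/= {2}/mixed_factor ltnn eqxx; congr (_ * _).
  by apply: eq_bigr => l _; rewrite /mixed_factor/= ltn_ord.
have other_terms (i : 'I_n) :
    \prod_(l < n.+1) mixed_factor i l (a l) (b l) (a l - b l) =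
    \prod_(l < n) mixed_factor i l (a (w l)) (b (w l)) (a (w l) - b (w l)) *
    a ord_max.
  rewrite big_ord_recr/= {2}/mixed_factor ltnNge (ltnW (ltn_ord i))/=.
  by rewrite eq_sym (ltn_eqF (ltn_ord i)).
rewrite [in RHS]big_ord_recr/= last_term (eq_bigr _ (fun i _ => other_terms i)).
rewrite -mulr_suml -(IH (a \o w) (b \o w))/= !big_ord_recr/=; ring.
Qed.

(** By distributivity the sum over multi-indices is a product of n one-dimensional sums; this is
    what makes later bounds independent of the number of cubes. *)
Lemma sum_prod_norm_le n (J : finType) (g : 'I_n -> J -> R) (C : R) :
  (forall l, \sum_k `|g l k| <= C) ->
  \sum_(q : {ffun 'I_n -> J}) `|\prod_l g l (q l)| <= C ^+ n.
Proof.
move=> gC; under eq_bigr do rewrite normr_prod.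
rewrite -(bigA_distr_bigA (fun l k => `|g l k|)).
rewrite -[n in leRHS]card_ord -prodr_const ler_prod// => l _.
by rewrite gC sumr_ge0.
Qed.

(** Term i of the telescoping factors as well: the sum in coordinate i is at most C * d i and the n
    - 1 others at most C. *)
Lemma sum_prodB_norm_le n (J : finType) (g h : 'I_n -> J -> R) (C : R)
    (d : 'I_n -> R) :
  (forall l, \sum_k `|g l k| <= C) -> (forall l, \sum_k `|h l k| <= C) ->
  (forall l, \sum_k `|g l k - h l k| <= C * d l) ->
  \sum_(q : {ffun 'I_n -> J}) `|\prod_l g l (q l) - \prod_l h l (q l)|
    <= C ^+ n * \sum_l d l.
Proof.
move=> gC hC ghd.
apply: (@le_trans _ _ (\sum_(i < n) \sum_(q : {ffun 'I_n -> J})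
    \prod_(l < n) mixed_factor i l `|g l (q l)| `|h l (q l)|
                     `|g l (q l) - h l (q l)|)).
  rewrite exchange_big/= ler_sum// => q _.
  rewrite prodB_telescope (le_trans (ler_norm_sum _ _ _))// ler_sum// => i _.
  rewrite normr_prod ler_prod// => l _; rewrite normr_ge0/= /mixed_factor.
  by case: ltnP => // _; case: eqP.
rewrite mulr_sumr ler_sum// => i _.
pose f (l : 'I_n) k := mixed_factor i l `|g l k| `|h l k| `|g l k - h l k|.
rewrite -(bigA_distr_bigA f) (bigD1 i)//=.
have C0 : 0 <= C by apply: le_trans (gC i); rewrite sumr_ge0.
have -> : C ^+ n = C * \prod_(l < n | l != i) C.
  by rewrite -(bigD1 i (P := xpredT) (F := fun=> C))//= prodr_const card_ord.
rewrite mulrAC ler_pM//.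
- by apply: sumr_ge0 => k _; rewrite /f /mixed_factor ltnn eqxx.
- apply: prodr_ge0 => l _; apply: sumr_ge0 => k _.
  by rewrite /f /mixed_factor; case: ltnP => // _; case: eqP.
- rewrite (eq_bigr (fun k => `|g i k - h i k|))// => k _.
  by rewrite /f /mixed_factor ltnn eqxx.
- apply: ler_prod => l li; apply/andP; split.
    apply: sumr_ge0 => k _.
    by rewrite /f /mixed_factor; case: ltnP => // _; case: eqP.
  rewrite /f /mixed_factor; case: ltnP => // _.
  by rewrite (_ : (l == i :> nat) = false)//; apply/negbTE.
Qed.

End products.

(** * Differences of splines of two consecutive scales *)

Section refinement.
Context {R : realType}.
Implicit Types (y z : R) (q L : nat).

Definition fine_bspline q y : R := bspline (2 * y - q%:R).
(** The division by 2 gives it the same integral 1/2 as [fine_bspline q], so that [bspline_flux q],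
    a primitive of the difference, has compact support. *)
Definition coarse_bspline q y : R := bspline (y - (q./2)%:R) / 2.
Definition bspline_flux q y : R :=
  (smootherstep (2 * y - q%:R) - smootherstep (y - (q./2)%:R)) / 2.

Lemma sum_half (f : nat -> R) L :
  \sum_(q < L.*2) f q./2 = 2 * \sum_(k < L) f k.
Proof.
elim: L => [|L IH]; first by rewrite !big_ord0 mulr0.
rewrite doubleS !big_ord_recr/= IH !uphalf_half odd_double doubleK/=.
rewrite add0n; ring.
Qed.

Lemma sum_fine_bspline y L : \sum_(q < L.*2) `|fine_bspline q y| <= 1.
Proof.
under eq_bigr do rewrite ger0_norm ?bspline_ge0//.
exact: sum_bspline_le1.
Qed.

Lemma sum_coarse_bspline y L : \sum_(q < L.*2) `|coarse_bspline q y| <= 1.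
Proof.
under eq_bigr do rewrite ger0_norm ?mulr_ge0 ?bspline_ge0//.
rewrite (sum_half (fun k => bspline (y - k%:R) / 2)) -mulr_suml mulrCA divff//.
by rewrite mulr1 sum_bspline_le1.
Qed.

Lemma sum_bspline_flux y L : \sum_(q < L.*2) `|bspline_flux q y| <= 4.
Proof.
(* Both terms of bspline_flux q y lie between G (2 y - q - 3) and
   G (2 y - q + 3), and the differences of these values telescope in q. *)
pose G (t : R) := smootherstep t.
have G01 t : 0 <= G t <= 1 := smootherstep01 t.
apply: (@le_trans _ _ (\sum_(q < L.*2)
   (G (2 * y + 3 - q%:R) - G (2 * y + 3 - q%:R - 6%:R)) / 2)).
  apply: ler_sum => q _; rewrite /bspline_flux normrM [`|2^-1|]ger0_norm//.
  rewrite ler_pM2r ?invr_gt0//.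
  have hq : (q%:R - 1 : R) <= 2 * (q./2)%:R <= (q%:R : R).
    have /(congr1 (fun k => k%:R : R)) := odd_double_half q.
    by rewrite -[(_./2).*2]mul2n natrD natrM; case: (odd q) => /= ?; apply/andP; split; lra.
  have nd : {homo G : x y / x <= y} := smootherstep_ndecr.
  suff : G (2 * y + 3 - q%:R - 6%:R) <= G (y - (q./2)%:R) <= G (2 * y + 3 - q%:R).
    have : G (2 * y + 3 - q%:R - 6%:R) <= G (2 * y - q%:R) by apply: nd; lra.
    have : G (2 * y - q%:R) <= G (2 * y + 3 - q%:R) by apply: nd; lra.
    rewrite /G ler_norml => ? ? /andP[? ?]; apply/andP; split; lra.
  (* Put t = y - q./2. Then 2 y - q is 2 t or 2 t - 1, which is within 3 of t as long as 0 <= t <=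
     3; elsewhere [G t] is 0 or 1. *)
  apply/andP; split.
    case: (leP (y - (q./2)%:R) 3) => h; first by apply: nd; lra.
    rewrite {2}/G smootherstep_ge3; last exact: ltW.
    by case/andP: (G01 (2 * y + 3 - q%:R - 6%:R)).
  case: (leP (y - (q./2)%:R) 0) => h.
    rewrite {1}/G smootherstep_le0//.
    by case/andP: (G01 (2 * y + 3 - q%:R)).
  by apply: nd; lra.
(* The shift by 6 gives 6 / 2 = 3 <= 4. *)
rewrite -mulr_suml ler_pdivrMr// (le_trans (sum_shift_le _ _ _ G01))//; lra.
Qed.

Lemma sum_fine_bspline_lip y z L :
  \sum_(q < L.*2) `|fine_bspline q y - fine_bspline q z| <= 4 * `|y - z|.
Proof.
apply: le_trans (sum_bspline_lip _ _ _) _.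
by rewrite -mulrBr normrM ger0_norm// mulrA -natrM.
Qed.

Lemma sum_coarse_bspline_lip y z L :
  \sum_(q < L.*2) `|coarse_bspline q y - coarse_bspline q z| <= 4 * `|y - z|.
Proof.
under eq_bigr do rewrite -mulrBl normrM [`|2^-1|]ger0_norm//.
rewrite (sum_half (fun k => `|bspline (y - k%:R) - bspline (z - k%:R)| / 2)).
rewrite -mulr_suml mulrCA divff// mulr1.
apply: le_trans (sum_bspline_lip _ _ _) _.
by rewrite ler_wpM2r// ler_nat.
Qed.

Lemma sum_bspline_flux_lip y z L :
  \sum_(q < L.*2) `|bspline_flux q y - bspline_flux q z| <= 4 * `|y - z|.
Proof.
pose G (t : R) := smootherstep t.
apply: (@le_trans _ _ (\sum_(q < L.*2)
  (`|G (2 * y - q%:R) - G (2 * z - q%:R)| + `|G (y - (q./2)%:R) - G (z - (q./2)%:R)|))).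
  apply: ler_sum => q _.
  rewrite /bspline_flux -mulrBl normrM [`|2^-1|]ger0_norm// ler_pdivrMr//.
  have subrACA (a b c d : R) : a - b - (c - d) = a - c - (b - d) by ring.
  rewrite subrACA (le_trans (ler_normB _ _))//.
  by rewrite ler_peMr ?addr_ge0// ler1n.
rewrite big_split/=.
rewrite (sum_half (fun k => `|G (y - k%:R) - G (z - k%:R)|)).
have h1 := sum_smootherstep_lip (2 * z) (2 * y) L.*2.
have h2 := sum_smootherstep_lip z y L.
have e : `|2 * y - 2 * z| = 2 * `|y - z|.
  by rewrite -mulrBr normrM ger0_norm.
rewrite e in h1; rewrite /G; lra.
Qed.

Lemma is_derive_bspline_flux q y :
  is_derive y 1 (bspline_flux q) (fine_bspline q y - coarse_bspline q y).
Proof.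
have d1 : is_derive y 1 (fun x : R => x - (q./2)%:R) 1.
  by apply: is_derive_eq; rewrite subr0.
have d2 : is_derive y 1 (fun x : R => 2 * x - q%:R) 2.
  by apply: is_derive_eq; rewrite subr0 [_ *: _]mulr1.
have e1 := @is_derive1_comp _ _ _ y _ _ (is_derive_smootherstep _) d1.
have e2 := @is_derive1_comp _ _ _ y _ _ (is_derive_smootherstep _) d2.
have -> : bspline_flux q = 2^-1 \*: ((smootherstep \o (fun x : R => 2 * x - q%:R)) -
  (smootherstep \o (fun x : R => x - (q./2)%:R))).
  by apply/funext => x; rewrite /bspline_flux mulrC.
apply: is_derive_eq; rewrite /GRing.scale/= /fine_bspline /coarse_bspline; by field.
Qed.

End refinement.

(** * Products of functions of one coordinate *)

Section partials.
Context {R : realType} {n : nat}.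
Local Notation E := 'rV[R]_n.
Implicit Types (x : E) (f : E -> R) (h dh : 'I_n -> R -> R) (F : E -> E).

Definition partial f i x : R := 'D_(delta_mx ord0 i : E) f x.

Definition C1 f := (forall x, differentiable f x) /\
  forall i, continuous (partial f i).

(** In direction i only factor i varies, so the difference quotient is that of [h i] times the fixed
    product of the other factors. *)
Lemma is_derive_prod_coord h dh x i :
  is_derive (x ord0 i : R) 1 (h i) (dh i (x ord0 i)) ->
  is_derive x (delta_mx ord0 i : E) (fun x : E => \prod_l h l (x ord0 l))
    (dh i (x ord0 i) * \prod_(l | l != i) h l (x ord0 l)).
Proof.
move=> [dhi Dhi].
have quot (t : R) : t^-1 *: (\prod_l h l ((t *: (delta_mx ord0 i : E) + x) ord0 l) -
      \prod_l h l (x ord0 l)) =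
    t^-1 *: (h i (t *: (1 : R) + x ord0 i) - h i (x ord0 i)) *
    \prod_(l | l != i) h l (x ord0 l).
  rewrite -scalerAl mulrBl; congr (_ *: (_ - _)); last by rewrite (bigD1 i).
  rewrite (bigD1 i)//= !mxE !eqxx; congr (_ * _).
  by apply: eq_bigr => l /negbTE li; rewrite !mxE li andbF mulr0 add0r.
have cvgP : t^-1 *: (\prod_l h l ((t *: (delta_mx ord0 i : E) + x) ord0 l) -
      \prod_l h l (x ord0 l)) @[t --> 0^'] -->
    dh i (x ord0 i) * \prod_(l | l != i) h l (x ord0 l).
  under eq_fun do rewrite quot.
  by apply: cvgM; [rewrite -Dhi; exact: dhi|exact: cvg_cst].
by apply: DeriveDef; [apply/cvg_ex; eexists; exact: cvgP|exact/cvg_lim].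
Qed.

Lemma differentiable_prod_coord h x : (forall l t, derivable (h l) t 1) ->
  differentiable (fun x : E => \prod_l h l (x ord0 l)) x.
Proof.
move=> dh; elim: (index_enum _) => [|l s IH].
  under eq_fun do rewrite big_nil.
  exact: differentiable_cst.
under eq_fun do rewrite big_cons.
apply: (@differentiableM _ _ (fun x : E => h l (x ord0 l))) => //.
apply: (@differentiable_comp _ _ _ _ (fun x : E => x ord0 l : R) (h l)).
  exact: differentiable_coord.
exact/derivable1_diffP.
Qed.

Lemma C1_prod_coord h dh :
  (forall l (t : R), is_derive t 1 (h l) (dh l t)) -> (forall l, continuous (dh l)) ->
  C1 (fun x : E => \prod_l h l (x ord0 l)).
Proof.
move=> hdh cdh.
have dh1 l (t : R) : derivable (h l) t 1 by have := hdh l t => ?; exact: ex_derive.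
split=> [x|i]; first exact: differentiable_prod_coord.
have -> : partial (fun x : E => \prod_l h l (x ord0 l)) i =
    (fun x : E => dh i (x ord0 i) * \prod_(l | l != i) h l (x ord0 l)).
  apply/funext => x; rewrite /partial.
  by have [] := is_derive_prod_coord (hdh i (x ord0 i)).
have cc l (g : R -> R) : continuous g -> continuous (fun x : E => g (x ord0 l)).
  move=> cg x; apply: (@continuous_comp _ _ _ (fun x : E => x ord0 l : R) g).
    exact: coord_continuous.
  exact: cg.
suff cP : continuous (fun x : E => \prod_(l | l != i) h l (x ord0 l)).
  by move=> x; apply: continuousM; [exact: (cc i (dh i) (cdh i) x)|exact: cP].
elim: (index_enum _) => [|l s IH].
  under eq_fun do rewrite big_nil.
  by move=> x; exact: cst_continuous.
under eq_fun do rewrite big_cons.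
case: (l != i) => //= x; apply: continuousM; last exact: IH.
apply: (cc l (h l) _ x) => t.
exact/differentiable_continuous/derivable1_diffP.
Qed.

Lemma C1_scale f k : C1 f -> C1 (fun x => k * f x).
Proof.
move=> [df cf]; split=> [x|i]; first exact: (@differentiableZ _ _ _ f k).
have -> : partial (fun x => k * f x) i = (fun x => k * partial f i x).
  by apply/funext => x; rewrite /partial -[LHS]/('D__ (k \*: f) x) deriveZ//;
    exact: diff_derivable.
by move=> x; apply: continuousM; [exact: cst_continuous|exact: cf].
Qed.

Lemma partialZ f k i x : C1 f -> partial (fun x => k * f x) i x = k * partial f i x.
Proof.
move=> [df cf]; rewrite /partial -[LHS]/('D__ (k \*: f) x) deriveZ//.
exact: diff_derivable.
Qed.

Lemma C1_sum (I : finType) (f : I -> E -> R) : (forall q, C1 (f q)) ->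
  C1 (fun x => \sum_q f q x) /\
  forall i x, partial (fun x => \sum_q f q x) i x = \sum_q partial (f q) i x.
Proof.
move=> cf; elim: (index_enum _) => [|q s [[dS cS] pS]].
  have -> : (fun x => \sum_(q <- [::]) f q x) = (cst 0 : E -> R).
    by apply/funext => x; rewrite big_nil.
  have p0 i : partial (cst 0) i = (cst 0 : E -> R).
    by apply/funext => x; exact: derive_cst.
  split; last by move=> i x; rewrite p0 big_nil.
  split=> [x|i]; first exact: differentiable_cst.
  by rewrite p0; exact: cst_continuous.
have -> : (fun x => \sum_(q <- q :: s) f q x) =
    f q \+ (fun x => \sum_(q <- s) f q x).
  by apply/funext => x; rewrite big_cons.
have [dq cq] := cf q.
have pD i : partial (f q \+ (fun x => \sum_(q <- s) f q x)) i =
    partial (f q) i \+ partial (fun x => \sum_(q <- s) f q x) i.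
  by apply/funext => x; rewrite /partial deriveD//; exact: diff_derivable.
split; last by move=> i x; rewrite pD /= pS big_cons.
split=> [x|i]; first exact: differentiableD.
by rewrite pD => x; apply: continuousD; [exact: cq|exact: cS].
Qed.

Lemma differentiable_row F : (forall i, C1 (fun x => F x ord0 i)) ->
  forall x, differentiable F x.
Proof.
move=> cF x.
have -> : F = \sum_(i < n) (fun x => F x ord0 i *: (delta_mx ord0 i : E)).
  by apply/funext => y; rewrite fct_sumE [LHS]row_sum_delta.
by apply: differentiable_sum => i; apply: differentiableZl; case: (cF i).
Qed.

Lemma jacobianE F x i k : (forall i, C1 (fun x => F x ord0 i)) ->
  'J F x i k = partial (fun x => F x ord0 k) i x.
Proof.
move=> cF; have dF := differentiable_row cF x.
have : 'D_(delta_mx ord0 i : E) F x = row i ('J F x) by rewrite rowE deriveEjacobian.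
rewrite derive_mx; last exact: diff_derivable.
by move/matrixP/(_ ord0 k); rewrite !mxE.
Qed.

Lemma continuous_mx m (M : E -> 'M[R]_(m, m)) :
  (forall i k, continuous (fun x => M x i k)) -> continuous M.
Proof.
move=> cM x; apply/(@cvg_mx_entourageP _ _ _ (M @ nbhs (x : E)) _) => A entA.
have : \forall y \near x, forall ik : 'I_m * 'I_m, (M x ik.1 ik.2, M y ik.1 ik.2) \in A.
  apply: (@filter_forall _ _ _ (nbhs (x : E))) => -[i k].
  have /(@cvg_entourageP _ ((fun y => M y i k) @ nbhs (x : E)) _)/(_ A entA) := cM i k x.
  by apply: (@filterS _ (nbhs (x : E))) => y; rewrite inE.
by apply: (@filterS _ (nbhs (x : E))) => y My i k; exact: (My (i, k)).
Qed.

Lemma C1_continuously_differentiable F : (forall i, C1 (fun x => F x ord0 i)) ->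
  continuously_differentiable F.
Proof.
move=> cF; split; first exact: differentiable_row.
apply: (@continuous_mx _ (fun x => 'J F x)) => i k.
have -> : (fun x => 'J F x i k) = partial (fun x => F x ord0 k) i.
  by apply/funext => x; rewrite jacobianE.
by case: (cF k).
Qed.

Lemma divergenceE F x : (forall i, C1 (fun x => F x ord0 i)) ->
  divergence F x = \sum_i partial (fun x => F x ord0 i) i x.
Proof. by move=> cF; apply: eq_bigr => i _; rewrite jacobianE. Qed.

End partials.

(** * Fields whose divergence is a sum of refinement kernels *)

Section flux.
Context {R : realType} {n : nat}.
Local Notation E := 'rV[R]_n.
Variable m : nat.
Implicit Types (x y : E) (j : nat) (i l : 'I_n).

(* Coordinate in which the interval ]- m, m], divided at level j into pieces of
   length 2 ^- j, becomes ]0, side j] divided at the integers. *)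
Definition scaled j (t : R) : R := 2 ^+ j * (t + m%:R).

Definition side j : nat := iter j double m.*2.

Local Notation idx j := {ffun 'I_n -> 'I_(side j)}.

Definition tensor_bspline j (q : idx j) x : R :=
  \prod_l bspline (scaled j (x ord0 l) - (q l)%:R).

Lemma half_ord_subproof L (k : 'I_L.*2) : (k./2 < L)%N.
Proof. by rewrite ltn_half_double. Qed.

Definition parent j (q : idx j.+1) : idx j :=
  [ffun l => Ordinal (half_ord_subproof (q l))].

Definition refine_kernel j (q : idx j.+1) x : R :=
  \prod_l fine_bspline (q l) (scaled j (x ord0 l)) -
  \prod_l coarse_bspline (q l) (scaled j (x ord0 l)).

(** The definition has the form that telescopes; this form matches the coefficients of u, the factor
    2^-n being the ratio of the volumes of cells of levels j + 1 and j. *)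
Lemma refine_kernelE j (q : idx j.+1) x : refine_kernel q x =
  tensor_bspline q x - (2 ^+ n)^-1 * tensor_bspline (parent q) x.
Proof.
rewrite /refine_kernel /tensor_bspline; congr (_ - _).
  by apply: eq_bigr => l _; rewrite /scaled exprS -mulrA.
rewrite (eq_bigr _ (fun l _ => mulrC _ _)) big_split/= prodr_const card_ord.
by rewrite exprVn; congr (_ * _); apply: eq_bigr => l _; rewrite ffunE.
Qed.

Definition flux_factor j (i l : nat) (q : nat) (t : R) : R :=
  mixed_factor i l (fine_bspline q (scaled j t)) (coarse_bspline q (scaled j t))
                   (bspline_flux q (scaled j t)).

(** Component i of the field F. The factor 2^-j compensates the slope 2^j of [scaled j] when
    differentiating in coordinate i. *)
Definition refine_flux j (s : idx j.+1 -> R) i x : R :=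
  (2 ^+ j)^-1 * \sum_q s q * \prod_(l < n) flux_factor j i l (q l) (x ord0 l).

Definition dflux_factor j (i l : nat) (q : nat) (t : R) : R :=
  2 ^+ j * mixed_factor i l (2 * bdiff hat (2 * scaled j t - q%:R))
                   (bdiff hat (scaled j t - (q./2)%:R) / 2)
      (fine_bspline q (scaled j t) - coarse_bspline q (scaled j t)).

Lemma is_derive_affine (a b t : R) : is_derive t 1 (fun s : R => a * s + b) a.
Proof. by apply: is_derive_eq; rewrite addr0 [_ *: _]mulr1. Qed.

Lemma is_derive_comp_affine (f df : R -> R) (a b : R) :
  (forall t : R, is_derive t 1 f (df t)) ->
  forall t : R, is_derive t 1 (fun s => f (a * s + b)) (a * df (a * t + b)).
Proof.
move=> fdf t; rewrite mulrC; apply: is_derive1_comp.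
exact: is_derive_affine.
Qed.

Lemma is_derive_flux_factor j (i l q : nat) (t : R) :
  is_derive t 1 (flux_factor j i l q) (dflux_factor j i l q t).
Proof.
have scaledE : scaled j = fun t => 2 ^+ j * t + 2 ^+ j * m%:R.
  by apply/funext => r; rewrite /scaled mulrDr.
have dscaled (f df : R -> R) : (forall t : R, is_derive t 1 f (df t)) ->
    is_derive t 1 (fun s => f (scaled j s)) (2 ^+ j * df (scaled j t)).
  by move=> fdf; rewrite scaledE; exact: is_derive_comp_affine.
rewrite /flux_factor /dflux_factor /mixed_factor.
case: ltnP => _; last case: eqP => _.
- apply: (dscaled (coarse_bspline q) (fun z : R => bdiff hat (z - (q./2)%:R) / 2)) => r.
  have -> : coarse_bspline q = 2^-1 \*: (fun z : R => bspline (1 * z + - (q./2)%:R)).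
    by apply/funext => z; rewrite /coarse_bspline /= mul1r mulrC.
  rewrite mulrC -{2}[r]mul1r -[X in _ * X]mul1r; apply: is_deriveZ.
  exact: (is_derive_comp_affine 1 (- (q./2)%:R) is_derive_bspline).
- apply: (dscaled (bspline_flux q)
    (fun z : R => fine_bspline q z - coarse_bspline q z)) => r.
  exact: is_derive_bspline_flux.
- apply: (dscaled (fine_bspline q) (fun z : R => 2 * bdiff hat (2 * z - q%:R))) => r.
  exact: (is_derive_comp_affine 2 (- q%:R) is_derive_bspline).
Qed.

Lemma continuous_scaled j (f : R -> R) (a b : R) : continuous f ->
  continuous (fun t => f (a * scaled j t + b)).
Proof.
move=> cf t.
apply: (@continuous_comp _ _ _ (fun s : R => a * scaled j s + b) f _ _ (cf _)).
rewrite /scaled; apply: cvgD; last exact: cvg_cst.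
apply: cvgM; first exact: cvg_cst.
apply: cvgM; first exact: cvg_cst.
by apply: cvgD; [exact: cvg_id|exact: cvg_cst].
Qed.

Lemma continuous_dflux_factor j (i l q : nat) :
  continuous (dflux_factor j i l q).
Proof.
have cbspline : continuous (@bspline R).
  move=> r; apply: differentiable_continuous; rewrite -derivable1_diffP.
  by have := is_derive_bspline r => ?; exact: ex_derive.
have chat := continuous_bdiff (@continuous_hat R).
have cfine (f : R -> R) : continuous f ->
    continuous (fun t => f (2 * scaled j t - q%:R)).
  by move=> cf; exact: (@continuous_scaled j f 2 (- q%:R) cf).
have ccoarse (f : R -> R) : continuous f ->
    continuous (fun t => f (scaled j t - (q./2)%:R)).
  move=> cf; under eq_fun do rewrite -[scaled _ _]mul1r.
  exact: (@continuous_scaled j f 1 (- (q./2)%:R) cf).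
move=> t; apply: cvgM; first exact: cvg_cst.
rewrite /mixed_factor; case: ltnP => _; last case: eqP => _.
- by apply: cvgM; [exact: (ccoarse _ chat t)|exact: cvg_cst].
- apply: cvgB; first exact: (cfine _ cbspline t).
  by apply: cvgM; [exact: (ccoarse _ cbspline t)|exact: cvg_cst].
- by apply: cvgM; [exact: cvg_cst|exact: (cfine _ chat t)].
Qed.

Lemma C1_refine_flux j (s : idx j.+1 -> R) i : C1 (refine_flux s i).
Proof.
apply: C1_scale; apply: (proj1 (C1_sum _)) => q; apply: C1_scale.
apply: (@C1_prod_coord _ _ (fun l : 'I_n => flux_factor j i l (q l))
                           (fun l : 'I_n => dflux_factor j i l (q l))) => l.
- exact: is_derive_flux_factor.
- exact: continuous_dflux_factor.
Qed.

(** Differentiation turns [bspline_flux] at place i into [fine_bspline - coarse_bspline], which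
    produces the i-th term of [prodB_telescope]. *)
Lemma partial_refine_flux j (s : idx j.+1 -> R) i x :
  partial (refine_flux s i) i x = \sum_q s q * \prod_(l < n) mixed_factor i l
    (fine_bspline (q l) (scaled j (x ord0 l)))
    (coarse_bspline (q l) (scaled j (x ord0 l)))
    (fine_bspline (q l) (scaled j (x ord0 l)) -
     coarse_bspline (q l) (scaled j (x ord0 l))).
Proof.
have C1prod (q : idx j.+1) :
    C1 (fun x : E => \prod_(l < n) flux_factor j i l (q l) (x ord0 l)).
  apply: (@C1_prod_coord _ _ (fun l : 'I_n => flux_factor j i l (q l))
                           (fun l : 'I_n => dflux_factor j i l (q l))) => l.
  - exact: is_derive_flux_factor.
  - exact: continuous_dflux_factor.
have C1s (q : idx j.+1) : C1 (fun x : E =>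
    s q * \prod_(l < n) flux_factor j i l (q l) (x ord0 l)) by exact: C1_scale.
have [cS pS] := C1_sum C1s.
rewrite [LHS]partialZ// pS mulr_sumr; apply: eq_bigr => q _.
rewrite partialZ// mulrCA; congr (_ * _).
rewrite {1}/partial.
have [_ ->] := @is_derive_prod_coord _ _ (fun l : 'I_n => flux_factor j i l (q l))
  (fun l : 'I_n => dflux_factor j i l (q l)) x i (is_derive_flux_factor _ _ _ _ _).
rewrite [in RHS](bigD1 i)//= {1}/dflux_factor !mulrA mulVf ?mul1r; last first.
  by rewrite expf_neq0.
congr (_ * _); first by rewrite /mixed_factor ltnn eqxx.
apply: eq_bigr => l li; rewrite /flux_factor /mixed_factor.
by case: ltnP => // _; rewrite (_ : (l == i :> nat) = false)//; exact/negbTE.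
Qed.

Lemma sum_partial_refine_flux j (s : idx j.+1 -> R) x :
  \sum_i partial (refine_flux s i) i x = \sum_q s q * refine_kernel q x.
Proof.
rewrite (eq_bigr _ (fun i _ => partial_refine_flux s i x)) exchange_big/=.
by apply: eq_bigr => q _; rewrite -mulr_sumr /refine_kernel prodB_telescope.
Qed.

(** The value 4 comes from the Lipschitz estimates of the fine splines and of the fluxes. It is used
    for all three kinds of factors because [sum_prodB_norm_le] takes a single constant. *)
Lemma sum_flux_factor j (i l : nat) (t : R) :
  \sum_(k < side j.+1) `|flux_factor j i l k t| <= 4.
Proof.
rewrite /flux_factor /mixed_factor; case: ltnP => _; last case: eqP => _.
- by apply: le_trans (sum_coarse_bspline _ _) _; rewrite ler1n.
- exact: sum_bspline_flux.
- by apply: le_trans (sum_fine_bspline _ _) _; rewrite ler1n.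
Qed.

Lemma sum_flux_factor_lip j (i l : nat) (t r : R) :
  \sum_(k < side j.+1) `|flux_factor j i l k t - flux_factor j i l k r| <=
    4 * (2 ^+ j * `|t - r|).
Proof.
have -> : 2 ^+ j * `|t - r| = `|scaled j t - scaled j r|.
  rewrite /scaled -mulrBr normrM ger0_norm ?exprn_ge0//.
  by congr (_ * `|_|); ring.
rewrite /flux_factor /mixed_factor; case: ltnP => _; last case: eqP => _.
- exact: sum_coarse_bspline_lip.
- exact: sum_bspline_flux_lip.
- exact: sum_fine_bspline_lip.
Qed.

Lemma refine_flux_le j (s : idx j.+1 -> R) i x : (forall q, `|s q| <= 1) ->
  `|refine_flux s i x| <= (2 ^+ j)^-1 * 4 ^+ n.
Proof.
move=> s1; rewrite normrM ger0_norm ?invr_ge0 ?exprn_ge0//.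
rewrite ler_pM2l ?invr_gt0 ?exprn_gt0//.
apply: le_trans (sum_prod_norm_le (fun l : 'I_n => sum_flux_factor j i l (x ord0 l))).
rewrite (le_trans (ler_norm_sum _ _ _))// ler_sum// => q _.
by rewrite normrM ler_piMl.
Qed.

(** The factor 2^-j in [refine_flux] cancels the slope 2^j of [scaled j], so the Lipschitz constant
    does not depend on j. *)
Lemma refine_flux_lip j (s : idx j.+1 -> R) i x y : (forall q, `|s q| <= 1) ->
  `|refine_flux s i x - refine_flux s i y| <=
    4 ^+ n * \sum_l `|x ord0 l - y ord0 l|.
Proof.
move=> s1; rewrite -mulrBr -sumrB normrM ger0_norm ?invr_ge0 ?exprn_ge0//.
rewrite ler_pdivrMl ?exprn_gt0// mulrCA mulr_sumr.
apply: le_trans (sum_prodB_norm_le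
  (fun l : 'I_n => sum_flux_factor j i l (x ord0 l))
  (fun l : 'I_n => sum_flux_factor j i l (y ord0 l))
  (fun l : 'I_n => sum_flux_factor_lip j i l (x ord0 l) (y ord0 l))).
rewrite (le_trans (ler_norm_sum _ _ _))// ler_sum// => q _.
by rewrite -mulrBr normrM ler_piMl.
Qed.

Lemma sideE j : side j = (2 ^ j * m.*2)%N.
Proof.
elim: j => [|j IH]; first by rewrite mul1n.
by rewrite /side iterS -/(side j) IH expnS -mul2n mulnA.
Qed.

(** All splines start inside the cube and have width at most 3, because 2^-j <= 1. To the right of
    them [bspline_flux] vanishes because both of its terms are 1. *)
Lemma refine_flux_support j (s : idx j.+1 -> R) i x :
  ~ (forall l, x ord0 l \in `[- m%:R, m%:R + 3]) -> refine_flux s i x = 0.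
Proof.
move/existsNP => [l xl]; rewrite /refine_flux big1 ?mulr0// => q _.
rewrite (bigD1 l)//= [X in _ * (X * _)](_ : _ = 0) ?mul0r ?mulr0//.
have pow_ge1 : 1 <= 2 ^+ j :> R by rewrite exprn_ege1// ler1n.
have q_lt : (q l)%:R + 1 <= 2 * (side j)%:R :> R.
  by rewrite natr1 -natrM ler_nat mul2n (ltn_ord (q l)).
have half_lt : ((q l)./2)%:R + 1 <= (side j)%:R :> R.
  by rewrite natr1 ler_nat half_ord_subproof.
have side_eq : (side j)%:R = 2 ^+ j * (2 * m%:R) :> R.
  by rewrite sideE natrM natrX -mul2n natrM.
have q_ge0 : 0 <= (q l)%:R :> R by [].
have half_ge0 : 0 <= ((q l)./2)%:R :> R by [].
rewrite /flux_factor /mixed_factor /fine_bspline /coarse_bspline /bspline_flux.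
have [xlm|xlm] := ltP (x ord0 l) (- m%:R).
  have y0 : scaled j (x ord0 l) <= 0 by rewrite /scaled; nra.
  rewrite !smootherstep_le0 ?bspline_eq0 ?subrr ?mul0r//; [|by [lra|left; lra]..].
  by case: ltnP => // _; case: eqP.
have {}xlm : m%:R + 3 < x ord0 l.
  by rewrite ltNge; apply/negP => xlm3; apply: xl; rewrite in_itv/= xlm.
have y3 : (side j)%:R + 3 <= scaled j (x ord0 l) by rewrite /scaled side_eq; nra.
rewrite !smootherstep_ge3 ?bspline_eq0 ?subrr ?mul0r//; [|by [lra|right; lra]..].
by case: ltnP => // _; case: eqP.
Qed.

End flux.

(** * Lebesgue norms and step functions on dyadic cubes *)

Section Lnorm_tools.
Context d (T : measurableType d) (R : realType).
Variable mu : {measure set T -> \bar R}.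
Implicit Types (f g h : T -> R) (p : R) (A : set T).
Local Notation "'N_ p f" := (Lnorm mu p%:E (EFin \o f%R))
  (at level 10, p at level 2, f at level 9, format "''N_' p  f").

Lemma measurable_fun_EFin f : measurable_fun setT f ->
  measurable_fun setT (fun x => (f x)%:E).
Proof. by move=> mf; exact/measurable_EFinP. Qed.

Lemma Lnorm_scaled_indic p c A : 0 < p -> measurable A ->
  ('N_p (fun x => c * \1_A x) = `|c|%:E * mu A `^ p^-1)%E.
Proof.
move=> p0 mA; rewrite unlock.
rewrite [X in (X `^ _)%E](_ : _ = ((`|c| `^ p)%:E * mu A)%E).
  rewrite poweRM ?lee_fin ?powR_ge0// poweR_EFin -powRrM mulfV ?gt_eqF//.
  by rewrite powRr1.
under eq_integral => x _.
  rewrite /= normrM powRM// (_ : `|\1_A x| `^ p = \1_A x).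
    rewrite EFinM; over.
  rewrite indicE; case: (x \in A); first by rewrite normr1 powR1.
  by rewrite normr0 powR0// gt_eqF.
rewrite ge0_integralZl//=; last first.
  by apply: measurable_fun_EFin; exact: measurable_indic.
by rewrite integral_indic// setIT.
Qed.

Lemma Lnorm_sum_le (I : finType) p (f : I -> T -> R) : 1 <= p ->
  (forall i, measurable_fun setT (f i)) ->
  ('N_p (fun x => (\sum_i f i x)%R) <= \sum_i 'N_p (f i))%E.
Proof.
move=> p1 mf; have p0 : 0 < p by rewrite (lt_le_trans ltr01).
elim: (index_enum _) => [|i s IH].
  rewrite big_nil (_ : _ \o _ = cst 0%E) ?Lnorm0//; first by rewrite eqe gt_eqF.
  by apply/funext => x; rewrite /= big_nil.
rewrite big_cons (_ : _ \o _ = EFin \o (f i \+ (fun x => \sum_(i <- s) f i x))).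
  apply: le_trans (minkowski_EFin _ _ _ p1) _ => //; last by rewrite leeD2l.
  exact: measurable_sum.
by apply/funext => x; rewrite /= big_cons.
Qed.

Lemma Lnorm_step_le (I : finType) p (c : I -> R) (A : I -> set T) : 1 <= p ->
  (forall i, measurable (A i)) ->
  ('N_p (fun x => (\sum_i c i * \1_(A i) x)%R) <=
   \sum_i `|c i|%:E * mu (A i) `^ p^-1)%E.
Proof.
move=> p1 mA; have p0 : 0 < p by rewrite (lt_le_trans ltr01).
apply: le_trans (Lnorm_sum_le p1 _) _ => [i|].
  by apply: measurable_funM => //; exact: measurable_indic.
by rewrite lee_sum// => i _; rewrite Lnorm_scaled_indic.
Qed.

Lemma Lnorm_distC p f g : 'N_p (fun x => f x - g x) = 'N_p (fun x => g x - f x).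
Proof.
rewrite -[RHS]oppe_Lnorm; apply: eq_Lnorm => x /=.
by rewrite opprB.
Qed.

Lemma Lnorm_triangle p f g h : 1 <= p -> measurable_fun setT f ->
  measurable_fun setT g -> measurable_fun setT h ->
  ('N_p (fun x => f x - h x)%R <=
   'N_p (fun x => f x - g x)%R + 'N_p (fun x => g x - h x)%R)%E.
Proof.
move=> p1 mf mg mh.
rewrite (_ : EFin \o _ = EFin \o ((fun x => f x - g x) \+ (fun x => g x - h x))).
  by apply: minkowski_EFin => //; exact: measurable_funB.
by apply/funext => x /=; rewrite addrA subrK.
Qed.

Lemma Lnorm_le_distD p f g : 1 <= p -> measurable_fun setT f ->
  measurable_fun setT g -> ('N_p f <= 'N_p (fun x => f x - g x)%R + 'N_p g)%E.
Proof.
move=> p1 mf mg.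
rewrite (_ : f = (fun x => f x - g x) \+ g); last by apply/funext => x/=; rewrite subrK.
apply: le_trans (minkowski_EFin _ _ _ p1) _ => //.
  by apply: measurable_funB => //; apply: measurable_funD => //; exact: measurable_funB.
by rewrite leeD2r// [X in (_ <= Lnorm _ _ (_ \o X))%E](_ : _ = fun x => f x - g x)//;
  apply/funext => x/=; rewrite addrK.
Qed.

Lemma Lnorm_telescope_le p (f : nat -> T -> R) J k : 1 <= p -> (J <= k)%N ->
  (forall j, measurable_fun setT (f j)) ->
  ('N_p (fun x => f k x - f J x)%R <=
   \sum_(J <= j < k) 'N_p (fun x => f j.+1 x - f j x)%R)%E.
Proof.
move=> p1 Jk mf; elim: k Jk => [|k IH].
  rewrite leqn0 => /eqP ->; rewrite big_geq// (_ : _ \o _ = cst 0%E) ?Lnorm0//.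
    by rewrite eqe gt_eqF// (lt_le_trans ltr01).
  by apply/funext => x /=; rewrite subrr.
rewrite leq_eqVlt => /predU1P[->|].
  rewrite big_geq// (_ : _ \o _ = cst 0%E) ?Lnorm0//.
    by rewrite eqe gt_eqF// (lt_le_trans ltr01).
  by apply/funext => x /=; rewrite subrr.
rewrite ltnS => Jk; rewrite big_nat_recr//= addeC.
apply: le_trans (Lnorm_triangle p1 (mf k.+1) (mf k) (mf J)) _.
by rewrite leeD2l// IH.
Qed.

(** Fatou's lemma for the functions |f_k|^p. With a constant sequence it also transfers a bound
    along an equality almost everywhere. *)
Lemma ae_cvg_Lnorm_le p (f_ : nat -> T -> R) f (B : \bar R) : 1 <= p ->
  (forall k, measurable_fun setT (f_ k)) -> measurable_fun setT f ->
  {ae mu, forall x, f_ k x @[k --> \oo] --> f x} ->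
  (forall k, 'N_p (f_ k) <= B)%E -> ('N_p f <= B)%E.
Proof.
move=> p1 mf_ mf cvgf fB; have p0 : 0 < p by rewrite (lt_le_trans ltr01).
have B0 : (0 <= B)%E by apply: le_trans (fB 0%N); exact: Lnorm_ge0.
pose pw (g : T -> R) x : \bar R := (`|g x| `^ p)%:E.
have mpw g : measurable_fun setT g -> measurable_fun setT (pw g).
  move=> mg; apply/measurable_fun_EFin/(measurableT_comp (measurable_powR _)) => //.
  exact: measurableT_comp.
have NE g : ('N_p g `^ p = \int[mu]_x pw g x)%E.
  rewrite poweR_Lnorm ?gt_eqF//.
have in0y (x : \bar R) : (0 <= x)%E -> x \in `[0%E, +oo%E].
  by move=> x0; rewrite in_itv/= x0 leey.
suff : ('N_p f `^ p <= B `^ p)%E.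
  have pV0 : 0 <= p^-1 by rewrite invr_ge0 ltW.
  move=> /(gt0_ler_poweR pV0 (in0y _ (poweR_ge0 _ _)) (in0y _ (poweR_ge0 _ _))).
  by rewrite -!poweRrM mulfV ?gt_eqF// !poweRe1// Lnorm_ge0.
rewrite NE.
have liminf_ge0 x : (0 <= limn_einf (fun k => pw (f_ k) x))%E.
  rewrite limn_einf_lim; apply: lime_ge; first exact: is_cvg_einfs.
  by near=> k; apply: le_ereal_inf_tmp => _ [j /= _ <-]; rewrite lee_fin powR_ge0.
apply: (@le_trans _ _ (\int[mu]_x limn_einf (fun k => pw (f_ k) x))%E).
  apply: ae_ge0_le_integral => //.
  - by move=> x _; rewrite lee_fin powR_ge0.
  - exact: mpw.
  - apply: (measurableT_comp (@oppe_measurable R setT)) => //.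
    apply: (measurable_fun_limn_esup (f := fun k x => (- pw (f_ k) x)%E)) => k.
    by apply: (measurableT_comp (@oppe_measurable R setT)) => //; exact: mpw.
  apply: filterS cvgf => x fx _.
  (* Continuity of [powR] is obtained at positive bases; where f x = 0, the lower limit only has to
     be nonnegative. *)
  have [fx0|fx0] := eqVneq (f x) 0.
    by rewrite {1}/pw fx0 normr0 powR0 ?gt_eqF.
  have fx_gt0 : 0 < `|f x| by rewrite normr_gt0.
  have /cvg_limn_einf_sup[-> //] : pw (f_ k) x @[k --> \oo] --> pw f x.
  apply: cvg_EFin; first by near=> k.
  have cpow : {for `|f x|, continuous (@powR R ^~ p)}.
    apply: differentiable_continuous; rewrite -derivable1_diffP.
    by apply: derivable_powR; rewrite in_itv/= fx_gt0.
  exact: (cvg_comp _ _ (cvg_norm fx) cpow).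
apply: le_trans (fatou mu measurableT _ _) _.
- by move=> k; exact: mpw.
- by move=> k x _; rewrite lee_fin powR_ge0.
rewrite limn_einf_lim; apply: lime_le; first exact: is_cvg_einfs.
near=> k; apply: ge_ereal_inf; exists (\int[mu]_x pw (f_ k) x)%E.
  by exists k => //=.
rewrite -NE; apply: gt0_ler_poweR => //; first exact: ltW.
- exact/in0y/Lnorm_ge0.
- exact: in0y.
Unshelve. all: by end_near. Qed.

(** The sum of the |f_(j+1) - f_j| is integrable, hence finite almost everywhere, and there the
    sequence converges as an absolutely convergent telescoping series. *)
Lemma summable_Lnorm1_ae_cvg (f_ : nat -> T -> R) :
  (forall k, measurable_fun setT (f_ k)) ->
  (\sum_(0 <= j <oo) 'N_1 (fun x => f_ j.+1 x - f_ j x)%R < +oo)%E ->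
  exists2 f : T -> R, measurable_fun setT f &
    {ae mu, forall x, f_ k x @[k --> \oo] --> f x}.
Proof.
move=> mf sum_lty; pose e j x := `|f_ j.+1 x - f_ j x|.
have me j : measurable_fun setT (EFin \o e j).
  by apply: measurable_fun_EFin; apply: measurableT_comp => //; exact: measurable_funB.
pose s x : \bar R := (\sum_(0 <= j <oo) (e j x)%:E)%E.
have e0 j x : (0 <= (e j x)%:E)%E by rewrite lee_fin normr_ge0.
have sint : mu.-integrable setT s.
  apply/integrableP; split.
    apply: (@ge0_emeasurable_sum _ _ _ _ (fun j x => (e j x)%:E) xpredT).
      by move=> j x _ _; exact: e0.
    by move=> j _; exact: me.
  rewrite (eq_integral s); last first.
    by move=> x _; rewrite gee0_abs// nneseries_ge0.
  rewrite integral_nneseries//.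
  apply: le_lt_trans sum_lty; apply: lee_nneseries => [j _ _|j _].
    by apply: integral_ge0 => x _; exact: e0.
  by rewrite Lnorm1.
(* The upper limit is measurable on the whole space, and it is the limit wherever there is one. *)
exists (fun x => fine (limn_esup (fun k => (f_ k x)%:E))).
  apply: (measurableT_comp (fine_measurable _)) => //.
  by apply: measurable_fun_limn_esup => k; exact: measurable_fun_EFin.
apply: filterS (integrable_ae measurableT sint) => x /(_ I) sx.
have cvgf : cvgn (f_ ^~ x).
  have : cvgn (series (fun j => e j x)).
    apply: nnseries_is_cvg => [j|]; first exact: normr_ge0.
    by rewrite -ge0_fin_numE// nneseries_ge0.
  move=> /(@normed_cvg _ R^o (fun j => f_ j.+1 x - f_ j x)) cvgs.
  have -> : (fun k => f_ k x) =
      (fun k => f_ 0%N x + series (fun j => f_ j.+1 x - f_ j x) k).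
    apply/funext => k; rewrite /series/= (telescope_sumr (fun j => f_ j x))//.
    by rewrite subrKC.
  by apply: is_cvgD => //; exact: is_cvg_cst.
have cvgE : (f_ k x)%:E @[k --> \oo] --> (limn (f_ ^~ x))%:E.
  by apply: cvg_EFin => //; near=> k.
by rewrite (cvg_limn_einf_sup cvgE).2.
Unshelve. all: by end_near. Qed.

End Lnorm_tools.

(** * Dyadic cells, step functions and orthants *)

Section cells.
Context {R : realType} {n : nat}.
Local Notation E := 'rV[R]_n.
Local Notation mu := (@lebesgue_rV R n).
Variable m : nat.
Implicit Types (x y : E) (j : nat) (i l : 'I_n) (t : R).
Local Notation idx j := {ffun 'I_n -> 'I_(side m j)}.

(** The analogue of [smoothstep] in degree 0. The strict inequality makes its unit differences the
    indicators of ]0, 1], so that the cells are half-open and partition the cube. *)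
Definition heaviside t : R := (0 < t)%R%:R.

Lemma bdiff_heavisideE t : bdiff heaviside t = (0 < t <= 1)%R%:R.
Proof.
rewrite /bdiff /heaviside subr_gt0.
case: (ltP 0 t) => t0; case: (ltP 1 t) => t1; rewrite ?subrr ?subr0 //=.
by have := lt_le_trans t1 t0; rewrite ltr10.
Qed.

Lemma bdiff_heaviside_double t :
  bdiff heaviside (2 * t) + bdiff heaviside (2 * t - 1) = bdiff heaviside t.
Proof.
have h2 s : heaviside (2 * s) = heaviside s by rewrite /heaviside pmulr_rgt0.
rewrite /bdiff addrA subrK h2 -(h2 (t - 1)); congr (_ - heaviside _); ring.
Qed.

Definition cell j (q : idx j) : set E :=
  [set x | forall l, 0 < scaled m j (x ord0 l) - (q l)%:R <= 1].

Lemma indic_cell j (q : idx j) x :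
  \1_(cell q) x = \prod_l bdiff heaviside (scaled m j (x ord0 l) - (q l)%:R) :> R.
Proof.
rewrite indicE; case: (boolP (x \in cell q)) => [|xq].
  by rewrite inE => xq; rewrite big1// => l _; rewrite bdiff_heavisideE xq.
have /existsNP[l /negP xl] : ~ forall l, 0 < scaled m j (x ord0 l) - (q l)%:R <= 1.
  by move=> xl; move/negP: xq; apply; rewrite inE.
by rewrite (bigD1 l)//= bdiff_heavisideE (negbTE xl) mul0r.
Qed.

Lemma cell_box j (q : idx j) : cell q = [set x | forall l,
  `](q l)%:R / 2 ^+ j - m%:R, ((q l)%:R + 1) / 2 ^+ j - m%:R]%classic (x ord0 l)].
Proof.
have p0 : 0 < 2 ^+ j :> R by rewrite exprn_gt0.
have cE l x : (0 < scaled m j (x ord0 l) - (q l)%:R <= 1) =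
    (x ord0 l \in `](q l)%:R / 2 ^+ j - m%:R, ((q l)%:R + 1) / 2 ^+ j - m%:R]).
  rewrite in_itv/= ltrBlDr lerBrDr ltr_pdivrMr// ler_pdivlMr// subr_gt0.
  by rewrite lerBlDr [1 + _]addrC /scaled mulrC.
by apply/seteqP; split => x + l => /(_ l) /=; rewrite cE.
Qed.

Lemma measurable_box_rV (A : 'I_n -> set (measurableTypeR R)) :
  (forall l, measurable (A l)) -> measurable [set x : E | forall l, A l (x ord0 l)].
Proof.
move=> mA; suff -> : [set x : E | forall l, A l (x ord0 l)] =
    \bigcap_(l in [set: 'I_n]) [set x : E | A l (x ord0 l)].
  apply: fin_bigcap_measurable => // l _.
  have := @measurable_coord_rV _ (measurableTypeR R) n l measurableT _ (mA l).
  by rewrite setTI.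
by apply/seteqP; split => [x Ax l _|x Ax l]; exact: Ax.
Qed.

Lemma measurable_cell j (q : idx j) : measurable (cell q).
Proof.
by rewrite cell_box; exact: (measurable_box_rV (fun l => measurable_itv _)).
Qed.

Lemma lebesgue_cell j (q : idx j) : mu (cell q) = ((2 ^+ (j * n))^-1)%:E.
Proof.
rewrite cell_box (lebesgue_rV_box (fun l => measurable_itv _)).
have p0 : 0 < 2 ^+ j :> R by rewrite exprn_gt0.
rewrite (eq_bigr (fun=> ((2 ^+ j)^-1)%:E)) => [|l _].
  by rewrite prodEFin prodr_const card_ord exprM exprVn.
rewrite lebesgue_measure_itv/= lte_fin ltrD2r ltr_pM2r ?invr_gt0// ltrDl ltr01.
by rewrite -EFinD; congr EFin; ring.
Qed.

Definition step j (c : idx j -> R) x : R := \sum_q c q * \1_(cell q) x.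

Lemma measurable_step j (c : idx j -> R) : measurable_fun setT (step c).
Proof.
apply: measurable_sum => q; apply: measurable_funM => //.
by apply: measurable_indic; exact: measurable_cell.
Qed.

Lemma sum_half_eq L (F : nat -> R) (k : 'I_L) :
  \sum_(q < L.*2 | Ordinal (half_ord_subproof q) == k) F q =
  F k.*2 + F k.*2.+1.
Proof.
pose G (q : nat) := if q./2 == k then F q else 0.
transitivity (\sum_(q < L.*2) G q).
  by rewrite big_mkcond.
have dbl M : \sum_(q < M.*2) G q = \sum_(i < M) (G i.*2 + G i.*2.+1).
  elim: M => [|M IH]; first by rewrite !big_ord0.
  by rewrite doubleS !big_ord_recr/= IH addrA.
rewrite dbl (bigD1 k)//= /G doubleK -uphalfE uphalf_double eqxx big1 ?addr0//.
move=> i /negbTE ik; rewrite doubleK -uphalfE uphalf_double.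
by rewrite (_ : (i == k :> nat) = false)// addr0.
Qed.

(** A cell is the disjoint union of its 2^n children: halve each side by [bdiff_heaviside_double]
    and expand the product over the coordinates. *)
Lemma step_refine j (c : idx j -> R) x :
  step c x = step (fun q : idx j.+1 => c (parent q)) x.
Proof.
rewrite /step (partition_big (@parent n m j) xpredT)//=; apply: eq_bigr => k _.
rewrite (eq_bigr (fun q : idx j.+1 => c k * \1_(cell q) x)); last first.
  by move=> q /eqP ->.
rewrite -mulr_sumr; congr (_ * _); rewrite indic_cell.
transitivity (\prod_l \sum_(q < side m j.+1 | Ordinal (half_ord_subproof q) == k l)
    bdiff heaviside (scaled m j.+1 (x ord0 l) - q%:R)).
  apply: eq_bigr => l _.
  rewrite (sum_half_eq (fun q => bdiff heaviside (scaled m j.+1 (x ord0 l) - q%:R))).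
  rewrite -[LHS]bdiff_heaviside_double /scaled exprS -natr1 -mul2n natrM.
  by congr (bdiff _ _ + bdiff _ _); ring.
(* The expansion runs over the q whose components halve to those of k, that is, over the q with
   [parent q] equal to k. *)
rewrite bigA_distr_big_dep/=; apply: eq_big => [q|q _]; last by rewrite indic_cell.
apply/familyP/eqP => [qk|<- l]; last by rewrite unfold_in/= ffunE.
by apply/ffunP => l; rewrite ffunE; have := qk l; rewrite unfold_in/= => /eqP.
Qed.

(** Triangle inequality over the cells: each contributes the power 1 / p of its volume 2^(- j n). *)
Lemma Lnorm_step p j (c : idx j -> R) : 1 <= p ->
  (Lp_norm p (step c) <=
    (2 `^ (- (j * n)%:R / p) * \sum_q `|c q|)%:E)%E.
Proof.
move=> p1; apply: le_trans (Lnorm_step_le _ _ p1 _) _.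
  exact: measurable_cell.
rewrite (eq_bigr (fun q => (`|c q| * 2 `^ (- (j * n)%:R / p))%:E)) => [|q _].
  by rewrite sumEFin lee_fin -mulr_suml mulrC.
rewrite [X in (_ * X `^ _)%E](lebesgue_cell q) poweR_EFin -EFinM.
by rewrite -powR_mulrn// -powRN -powRrM.
Qed.

Lemma sum_bdiff_ge (f : R -> R) t L a : (a <= L)%N ->
  \sum_(k < L | (a <= k)%N) bdiff f (t - k%:R) = f (t - a%:R) - f (t - L%:R).
Proof.
move=> aL; rewrite big_mkcond/=.
rewrite -(big_mkord xpredT (fun k => if (a <= k)%N then bdiff f (t - k%:R) else 0)).
elim: L aL => [|L IH].
  by rewrite leqn0 => /eqP ->; rewrite big_geq// subrr.
rewrite leq_eqVlt => /predU1P[->|].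
  rewrite subrr big_nat big1// => k /=.
  by move=> kL; rewrite leqNgt kL.
rewrite ltnS => aL; rewrite big_nat_recr//= IH// aL /bdiff -natr1 opprD addrA.
by rewrite addrA subrK.
Qed.

(* By telescoping, this is the sum of the indicators of the cells (f = heaviside)
   or of the B-splines (f = smoothstep) whose index is at least a. *)
Definition orthant (f : R -> R) j (a : 'I_n -> nat) x : R :=
  \prod_l (f (scaled m j (x ord0 l) - (a l)%:R) -
           f (scaled m j (x ord0 l) - (side m j)%:R)).

Lemma orthantE f j a x : (forall l, (a l <= side m j)%N) ->
  orthant f j a x = \sum_(q : idx j | q \in family (fun l k => (a l <= val k)%N))
    \prod_l bdiff f (scaled m j (x ord0 l) - (q l)%:R).
Proof.
move=> aL; transitivity (\prod_l \sum_(k < side m j | (a l <= k)%N)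
    bdiff f (scaled m j (x ord0 l) - k%:R)).
  by apply: eq_bigr => l _; rewrite sum_bdiff_ge.
by rewrite bigA_distr_big_dep.
Qed.

(** On the cell of q, factor l of the orthant is 1 if a l <= q l and 0 otherwise. *)
Lemma orthant_step j a (c : idx j -> R) x : (forall l, (a l <= side m j)%N) ->
  orthant heaviside j a x * step c x =
  \sum_(q : idx j | q \in family (fun l k => (a l <= val k)%N)) c q * \1_(cell q) x.
Proof.
move=> aL; rewrite /step mulr_sumr [in RHS]big_mkcond/=.
apply: eq_bigr => q _; rewrite mulrCA.
have [xq|xq] := boolP (x \in cell q); last first.
  by rewrite indicE (negbTE xq) !mulr0 if_same.
rewrite indicE xq mulr1; move: xq; rewrite inE => xq.
suff -> : orthant heaviside j a x =
    (q \in family (fun l (k : 'I_(side m j)) => (a l <= val k)%N))%:R.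
  by case: ifP; rewrite ?mulr1 ?mulr0.
have factorE l : heaviside (scaled m j (x ord0 l) - (a l)%:R) -
    heaviside (scaled m j (x ord0 l) - (side m j)%:R) = (a l <= q l)%:R.
  have /andP[x0 x1] := xq l.
  have -> : heaviside (scaled m j (x ord0 l) - (side m j)%:R) = 0.
    rewrite /heaviside subr_gt0 ltNge (_ : _ <= _)// (le_trans (_ : _ <= (q l).+1%:R))//.
      by rewrite -natr1; lra.
    by rewrite ler_nat.
  rewrite subr0 /heaviside subr_gt0; congr (_%:R : R); congr nat_of_bool.
  apply/idP/idP => [ax|aq].
    by rewrite -ltnS -(ltr_nat R) -natr1; lra.
  by rewrite (le_lt_trans (_ : _ <= (q l)%:R))// ?ler_nat//; lra.
rewrite /orthant (eq_bigr _ (fun l _ => factorE l)).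
have [/familyP qf|] := boolP (q \in family _).
  by rewrite big1// => l _; rewrite [(_ <= _)%N]qf.
move=> /familyP/existsNP[l /negP ql].
by rewrite (bigD1 l)//= [(_ <= _)%N](negbTE ql) mul0r.
Qed.

End cells.

Section bounded_multiplier.
Context d (T : measurableType d) (R : realType).
Variable mu : {measure set T -> \bar R}.
Implicit Types (u g : T -> R).

Lemma integrable_mul_bounded u g (B : R) : mu.-integrable setT (EFin \o u) ->
  measurable_fun setT g -> (forall x, `|g x| <= B) ->
  mu.-integrable setT (fun x => (u x * g x)%:E).
Proof.
move=> iu mg gB.
have mu' : measurable_fun setT u by apply/measurable_EFinP; exact: measurable_int iu.
apply: (@le_integrable _ _ _ mu _ measurableT _ (fun x => B%:E * (EFin \o u) x)%E).
- by apply: measurable_fun_EFin; exact: measurable_funM.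
- move=> x _ /=; rewrite lee_fin !normrM mulrC ler_wpM2r// (le_trans (gB x))//.
  exact: ler_norm.
- exact: integrableZl.
Qed.

Lemma Rintegral_sum (I : finType) (P : pred I) (f : I -> T -> R) :
  (forall i, mu.-integrable setT (fun x => (f i x)%:E)) ->
  (\int[mu]_x (\sum_(i | P i) f i x) = \sum_(i | P i) \int[mu]_x f i x)%R.
Proof.
move=> fi; rewrite /Rintegral.
under eq_integral do rewrite -sumEFin.
rewrite -big_filter.
under eq_integral do rewrite -big_filter.
rewrite integral_sum// -EFin_sum_fine// => i _.
exact: integrable_fin_num.
Qed.

Lemma normr_Rintegral_le_Lnorm u : mu.-integrable setT (EFin \o u) ->
  (`| \int[mu]_x u x |%R%:E <= Lnorm mu 1 (EFin \o u))%E.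
Proof.
move=> iu; rewrite Lnorm1 -(fineK (integrable_fin_num measurableT (integrable_abse iu))).
by rewrite lee_fin; exact: le_normr_Rintegral.
Qed.

End bounded_multiplier.

(** * Pointwise limits of orthants *)

Section grid_limit.
Context {R : realType} {n : nat}.
Local Notation E := 'rV[R]_n.
Variable m : nat.
Implicit Types (x : E) (j : nat) (l : 'I_n) (t : R) (a : 'I_n -> R).

(* Level j index of the grid point just above t, clamped to the cube. *)
Definition grid_index j (t : R) : nat :=
  minn (side m j) (Num.truncn (Num.max 0 (scaled m j t))).+1.

Lemma grid_index_le j t : (grid_index j t <= side m j)%N.
Proof. exact: geq_minl. Qed.

Lemma near_pow2_ge (d C : R) : 0 < d -> \forall j \near \oo, C <= 2 ^+ j * d.
Proof.
move=> d0; near=> j.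
rewrite -ler_pdivrMr//; apply: (@le_trans _ _ j%:R).
  near: j; exact: nbhs_infty_ger.
by rewrite -natrX ler_nat ltnW// ltn_expl.
Unshelve. all: by end_near. Qed.

Lemma side_scaled j : (side m j)%:R = scaled m j m%:R :> R.
Proof. by rewrite sideE natrM natrX -addnn natrD. Qed.

(** For b in [-m, m] the first argument is 2^j * (t - b) up to a bounded rounding error, so for t !=
    b it eventually leaves [0, 2], the range where [f] is not prescribed, and the factor becomes
    equal to its limit. Rounding upwards puts t = b on the side where [f] is 0. *)
Lemma near_grid_factor (f : R -> R) (b t : R) :
  (forall t, t <= 0 -> f t = 0) -> (forall t, 2 <= t -> f t = 1) ->
  \forall j \near \oo, f (scaled m j t - (grid_index j b)%:R) -
    f (scaled m j t - (side m j)%:R) = (b < t)%R%:R * (- m%:R < t <= m%:R)%R%:R.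
Proof.
move=> f0 f2.
have sc j (s r : R) : scaled m j s - scaled m j r = 2 ^+ j * (s - r).
  by rewrite /scaled -mulrBr; congr (_ * _); ring.
have trunc j : 0 <= Num.max 0 (scaled m j b) by rewrite le_max lexx.
have gi_lt j : (grid_index j b)%:R <= Num.max 0 (scaled m j b) + 1.
  apply: (@le_trans _ _ (Num.truncn (Num.max 0 (scaled m j b))).+1%:R).
    by rewrite ler_nat geq_minr.
  by rewrite -natr1 lerD2r; case/andP: (truncn_itv (trunc j)).
have p2 j : 0 < 2 ^+ j :> R by rewrite exprn_gt0.
have [tm|tm] := ltP m%:R t.
  rewrite andbF mulr0; near=> j.
  have y2 : 2 <= scaled m j t - (side m j)%:R.
    by rewrite side_scaled sc; near: j; apply: near_pow2_ge; rewrite subr_gt0.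
  rewrite !f2 ?subrr// (le_trans y2)// lerD2l lerN2 ler_nat.
  exact: grid_index_le.
have fs j : f (scaled m j t - (side m j)%:R) = 0.
  by apply: f0; rewrite side_scaled sc pmulr_rle0// subr_le0.
have [tNm|tNm] := leP t (- m%:R).
  rewrite /= mulr0; near=> j; rewrite fs subr0 f0// subr_le0.
  apply: (@le_trans _ _ 0) => //.
  by rewrite /scaled pmulr_rle0//; lra.
rewrite /= mulr1; have [bt|tb] := ltP b t; last first.
  near=> j; rewrite fs subr0 f0// subr_le0 /grid_index.
  rewrite /minn; case: ifP => _.
    by rewrite -subr_le0 side_scaled sc pmulr_rle0// subr_le0.
  have /andP[_ /ltW h] := truncn_itv (trunc j).
  apply: le_trans h; rewrite le_max; apply/orP; right.
  by rewrite -subr_le0 sc pmulr_rle0// subr_le0.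
have d0 : 0 < Num.min (t - b) (t + m%:R) by rewrite lt_min !subr_gt0 bt; lra.
near=> j; rewrite fs subr0 f2//.
(* Here 3 = 2 + 1: from 2 on [f] is 1, and 1 bounds the rounding in [grid_index]. The two terms of
   the minimum answer the two cases of the maximum in [gi_lt]. *)
have : 3 <= 2 ^+ j * Num.min (t - b) (t + m%:R) by near: j; exact: near_pow2_ge.
rewrite (minr_pMr _ _ (ltW (p2 j))) le_min => /andP[h1 h2].
rewrite lerBrDr; apply: le_trans (_ : _ <= 2 + (Num.max 0 (scaled m j b) + 1)) _.
  by rewrite lerD2l.
rewrite -lerBrDl -lerBrDr ge_max; apply/andP; split.
  by rewrite /scaled; lra.
by have := sc j t b; lra.
Unshelve. all: by end_near. Qed.

Definition ray a : set E := [set x | forall l, a l < x ord0 l].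

Definition cube : set E := [set x | forall l, - m%:R < x ord0 l <= m%:R].

Lemma near_orthant (f : R -> R) a x :
  (forall t, t <= 0 -> f t = 0) -> (forall t, 2 <= t -> f t = 1) ->
  \forall j \near \oo,
    orthant m f j (fun l => grid_index j (a l)) x = \1_(ray a) x * \1_cube x.
Proof.
move=> f0 f2.
have -> : \1_(ray a) x * \1_cube x =
    \prod_l ((a l < x ord0 l)%R%:R * (- m%:R < x ord0 l <= m%:R)%R%:R) :> R.
  rewrite big_split/=.
  have allE (P : 'I_n -> bool) (A : set E) : (A x <-> forall l, P l) ->
      \1_A x = \prod_l (P l)%:R :> R.
    move=> AP; rewrite indicE; have [|xA] := boolP (x \in A).
      by rewrite inE => /AP Pl; rewrite big1// => l _; rewrite Pl.
    have /existsNP[l /negP Pl] : ~ forall l, P l.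
      by move=> /AP Ax; move/negP: xA; apply; rewrite inE.
    by rewrite (bigD1 l)//= (negbTE Pl) mul0r.
  by congr (_ * _); exact: allE.
have : \forall j \near \oo, forall l : 'I_n,
    f (scaled m j (x ord0 l) - (grid_index j (a l))%:R) -
    f (scaled m j (x ord0 l) - (side m j)%:R) =
    (a l < x ord0 l)%R%:R * (- m%:R < x ord0 l <= m%:R)%R%:R.
  by apply: filter_forall => l; exact: near_grid_factor.
by apply: filterS => j h; apply: eq_bigr => l _; exact: h.
Qed.

Lemma measurable_ray a : measurable (ray a).
Proof.
have -> : ray a = [set x | forall l, `]a l, +oo[%classic (x ord0 l)].
  by apply/seteqP; split => x + l => /(_ l) /=; rewrite in_itv/= andbT.
exact: (measurable_box_rV (fun l => measurable_itv _)).
Qed.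

Lemma measurable_cube : measurable cube.
Proof.
have -> : cube = [set x | forall l, `]- m%:R, m%:R]%classic (x ord0 l)].
  by apply/seteqP; split => x + l => /(_ l) /=; rewrite in_itv/=.
exact: (measurable_box_rV (fun l => measurable_itv _)).
Qed.

End grid_limit.

(** * Identification of the limit *)

Section integral_measure.
Context d (T : measurableType d) (R : realType).
Variable mu : {measure set T -> \bar R}.
Variables (f : T -> \bar R).
Hypothesis mf : measurable_fun setT f.
Hypothesis f0 : forall x, (0 <= f x)%E.

(** The hypotheses are arguments so that the measure structure can be attached to the term
    itself. *)
Definition integral_on & measurable_fun setT f & (forall x, 0 <= f x)%E :=
  fun A : set T => (\int[mu]_(x in A) f x)%E.

Local Notation nu := (integral_on mf f0).

Let nu0 : nu set0 = 0%E. Proof. exact: integral_set0. Qed.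

Let nu_ge0 A : (0 <= nu A)%E. Proof. exact: integral_ge0. Qed.

Let nu_sigma_additive : semi_sigma_additive nu.
Proof.
move=> F mF tF mUF; rewrite /integral_on ge0_integral_bigcup//; last first.
  exact: measurable_funS mf.
by apply: is_cvg_nneseries => k _ _; exact: integral_ge0.
Qed.

HB.instance Definition _ := isMeasure.Build _ _ _ (integral_on mf f0)
  nu0 nu_ge0 nu_sigma_additive.

End integral_measure.

Section identification.
Context {R : realType} {n : nat}.
Local Notation E := 'rV[R]_n.
Local Notation mu := (@lebesgue_rV R n).
Implicit Types (x : E) (u v w : E -> R) (a : 'I_n -> R).

Lemma measurable_prod_coord (h : 'I_n -> R -> R) :
  (forall l, measurable_fun setT (h l)) ->
  measurable_fun [set: E] (fun x => \prod_l h l (x ord0 l)).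
Proof.
move=> mh; apply: measurable_prod => l _.
exact: (measurableT_comp (mh l) (measurable_coord_rV l)).
Qed.

(** The preimage of an open half-line under a coordinate is the union over k of the rays whose other
    bounds are -k, so the coordinates are measurable for the sigma-algebra of the rays. *)
Lemma rays_generate : @measurable _ E = <<s range (@ray R n) >>.
Proof.
apply/seteqP; split; last first.
  apply: smallest_sub; first exact: sigma_algebra_measurable.
  by move=> _ [a _ <-]; exact: measurable_ray.
pose S := g_sigma_algebraType (range (@ray R n)).
have mcoord l : measurable_fun [set: S] (fun x : S => (x : E) ord0 l : measurableTypeR R).
  apply: (measurability _ (RGenOInfty.measurableE R)) => // _ [_ [b ->] <-].
  rewrite setTI (_ : _ @^-1` _ =
      \bigcup_k ray (fun i => if i == l then b else - k%:R)).
    by apply: bigcup_measurable => k _; apply: sub_sigma_algebra; eexists.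
  apply/seteqP; split => [x /=|x [k _ xk]/=]; rewrite in_itv/= andbT; last first.
    by have := xk l; rewrite eqxx.
  move=> bx; exists (Num.truncn (\sum_l `|x ord0 l|)).+1 => // i.
  case: eqP => [->//|_]; rewrite ltrNl (le_lt_trans (ler_norm _))// normrN.
  have s0 : 0 <= \sum_l `|x ord0 l| by exact: sumr_ge0.
  have /andP[_] := truncn_itv s0.
  by apply: le_lt_trans; rewrite (bigD1 i)//= lerDl sumr_ge0.
move=> A mA; have := measurable_fun_rVP (f := fun x : S => x : E) mcoord.
by move=> /(_ measurableT A mA); rewrite setTI.
Qed.

(** The positive and negative parts of w are densities of two measures that are finite and equal on
    rays. Rays are stable under intersection and exhaust the space, so the two measures coincide. *)
Lemma ray_integral_ae0 w : mu.-integrable setT (EFin \o w) ->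
  (forall a, (\int[mu]_(x in ray a) (w x)%:E = 0)%E) -> {ae mu, forall x, w x = 0}.
Proof.
move=> iw w0.
have mw : measurable_fun setT (EFin \o w) := measurable_int _ iw.
have mp := measurable_funepos mw; have mn := measurable_funeneg mw.
pose m1 : {measure set E -> \bar R} :=
  integral_on mu mp (fun x => funepos_ge0 (EFin \o w) x).
pose m2 : {measure set E -> \bar R} :=
  integral_on mu mn (fun x => funeneg_ge0 (EFin \o w) x).
have ip A : measurable A -> mu.-integrable A ((EFin \o w)^\+)%E.
  by move=> mA; apply: integrable_funepos => //; exact: integrableS iw.
have in_ A : measurable A -> mu.-integrable A ((EFin \o w)^\-)%E.
  by move=> mA; apply: integrable_funeneg => //; exact: integrableS iw.
have m12 A : measurable A -> m1 A = m2 A.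
  apply: (@measure_unique _ _ _ (range (@ray R n)) (fun k => ray (fun=> - k%:R))).
  - exact: rays_generate.
  - move=> _ _ [a _ <-] [b _ <-]; exists (fun l => Num.max (a l) (b l)) => //.
    apply/seteqP; split => x.
      by move=> xab; split => l; have := xab l; rewrite gt_max => /andP[].
    by move=> [xa xb] l; rewrite gt_max; apply/andP; split; [exact: xa|exact: xb].
  - by move=> k; exists (fun=> - k%:R).
  - apply/seteqP; split => // x _.
    exists (Num.truncn (\sum_l `|x ord0 l|)).+1 => // l.
    rewrite ltrNl (le_lt_trans (ler_norm _))// normrN.
    have s0 : 0 <= \sum_l `|x ord0 l| by exact: sumr_ge0.
  have /andP[_] := truncn_itv s0.
    by apply: le_lt_trans; rewrite (bigD1 l)//= lerDl sumr_ge0.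
  - move=> _ [a _ <-]; rewrite /m1 /m2 /= /integral_on.
    have mr := @measurable_ray R n a.
    have fp := integrable_fin_num mr (ip _ mr).
    have fn := integrable_fin_num mr (in_ _ mr).
    have : (\int[mu]_(x in ray a) ((EFin \o w)^\+ x) -
            \int[mu]_(x in ray a) ((EFin \o w)^\- x) = 0)%E.
      by rewrite -(w0 a) [RHS]integralE.
    rewrite -(fineK fp) -(fineK fn) -EFinB => -[/eqP].
    by rewrite subr_eq0 => /eqP ->.
  - move=> k; rewrite /m1 /= /integral_on.
    have mr := @measurable_ray R n (fun=> - k%:R).
    by have := integrable_fin_num mr (ip _ mr); rewrite ge0_fin_numE// integral_ge0.
have := @integral_ae_eq _ _ _ mu setT measurableT (cst 0%E) (EFin \o w) iw _ _.
move=> /(_ (measurable_cst _)) H.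
have : ae_eq mu setT (EFin \o w) (cst 0%E).
  apply: H => A _ mA; rewrite integral0 integralE.
  have := m12 A mA; rewrite /m1 /m2 /= /integral_on => ->.
  by rewrite subee// integrable_fin_num//; exact: in_.
by apply: filterS => x /(_ I) [].
Qed.

End identification.

(** * Spline coefficients and the limit of their step functions *)

Section quasi_projection.
Context {R : realType} {n : nat}.
Local Notation E := 'rV[R]_n.
Local Notation mu := (@lebesgue_rV R n).
Variable m : nat.
Implicit Types (x : E) (u v w : E -> R) (a : 'I_n -> R) (j : nat).
Local Notation idx j := {ffun 'I_n -> 'I_(side m j)}.

(** Since [tensor_bspline q] has integral 2^(- j n), the volume of a cell, this is a weighted mean
    of u. *)
Definition coef j u (q : idx j) : R :=
  2 ^+ (j * n) * (\int[mu]_x (u x * tensor_bspline q x))%R.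

Lemma measurable_fun_scaled_shift j (f : R -> R) (b : R) :
  measurable_fun setT f -> measurable_fun setT (fun t => f (scaled m j t - b)).
Proof.
move=> mf; apply: (measurableT_comp mf).
apply: measurable_funB => //; apply: measurable_funM => //.
exact: measurable_funD.
Qed.

Lemma continuous_bspline : continuous (@bspline R).
Proof.
move=> t; apply: differentiable_continuous; rewrite -derivable1_diffP.
by have := is_derive_bspline t => ?; exact: ex_derive.
Qed.

Lemma measurable_smoothstep : measurable_fun setT (@smoothstep R).
Proof.
apply: continuous_measurable_fun => t; apply: differentiable_continuous.
rewrite -derivable1_diffP.
by have := is_derive_smoothstep t => ?; exact: ex_derive.
Qed.

Lemma measurable_heaviside : measurable_fun setT (@heaviside R).
Proof.
have -> : @heaviside R = \1_(`]0, +oo[%classic).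
  apply/funext => t; rewrite indicE /heaviside; congr (_%:R : R).
  congr nat_of_bool; apply/idP/idP => [t0|].
    by rewrite inE/= in_itv/= t0.
  by rewrite inE/= in_itv/= andbT.
by apply: measurable_indic; exact: measurable_itv.
Qed.

Lemma measurable_tensor_bspline j (q : idx j) :
  measurable_fun setT (tensor_bspline q : E -> R).
Proof.
apply: (measurable_prod_coord
  (h := fun l t => bspline (scaled m j t - (q l)%:R))) => l.
apply: measurable_fun_scaled_shift.
by apply: continuous_measurable_fun; exact: continuous_bspline.
Qed.

Lemma tensor_bspline_le1 j (q : idx j) x : `|tensor_bspline q x| <= 1.
Proof.
rewrite normr_prod prodr_ile1// => l _; rewrite normr_ge0/=.
by rewrite ger0_norm ?bspline_ge0// bspline_le1.
Qed.

Lemma measurable_orthant (f : R -> R) j (k : 'I_n -> nat) :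
  measurable_fun setT f -> measurable_fun setT (orthant m f j k : E -> R).
Proof.
move=> mf; apply: (measurable_prod_coord
  (h := fun l t => f (scaled m j t - (k l)%:R) - f (scaled m j t - (side m j)%:R))).
by move=> l; apply: measurable_funB; exact: measurable_fun_scaled_shift.
Qed.

Lemma orthant_le1 (f : R -> R) j (k : 'I_n -> nat) x :
  {homo f : s t / s <= t} -> (forall t, 0 <= f t <= 1) ->
  (forall l, (k l <= side m j)%N) -> `|orthant m f j k x| <= 1.
Proof.
move=> fnd f01 kL; rewrite normr_prod prodr_ile1// => l _; rewrite normr_ge0/=.
have : f (scaled m j (x ord0 l) - (side m j)%:R) <= f (scaled m j (x ord0 l) - (k l)%:R).
  by apply: fnd; rewrite lerD2l lerN2 ler_nat.
have /andP[_ ?] := f01 (scaled m j (x ord0 l) - (k l)%:R).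
have /andP[? _] := f01 (scaled m j (x ord0 l) - (side m j)%:R).
by move=> ?; rewrite ger0_norm; lra.
Qed.

Lemma heaviside01 (t : R) : 0 <= heaviside t <= 1.
Proof. by rewrite /heaviside; case: (0 < t); rewrite lexx ler01. Qed.

Lemma heaviside_ndecr : {homo @heaviside R : s t / s <= t}.
Proof.
move=> s t st; rewrite /heaviside; case: ltP => s0; last by case: (0 < t).
by rewrite (lt_le_trans s0 st).
Qed.

Lemma integrable_step j (c : idx j -> R) : mu.-integrable setT (EFin \o step c).
Proof.
rewrite (_ : _ \o _ = fun x => (\sum_q (c q * \1_(cell q) x)%:E)%E); last first.
  by apply/funext => x /=; rewrite sumEFin.
apply: integrable_sum => // q _.
rewrite (_ : (fun x => _) = (fun x => (c q)%:E * (\1_(cell q) x)%:E)%E) //.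
apply: integrableZl => //.
apply/integrableP; split.
  by apply: measurable_fun_EFin; apply: measurable_indic; exact: measurable_cell.
rewrite (eq_integral (fun x => (\1_(cell q) x)%:E)) => [|x _].
  by rewrite integral_indic ?setIT; [rewrite [ltLHS](lebesgue_cell q) ltry|
    by []|exact: measurable_cell].
by rewrite gee0_abs// lee_fin.
Qed.

(** Both sides are the sum over q >= k of the integrals of u against [tensor_bspline q]. On the left
    the orthant selects cells, whose volume cancels the normalization of [coef]; on the right it
    expands into splines. *)
Lemma orthant_pairing j u (k : 'I_n -> nat) : mu.-integrable setT (EFin \o u) ->
  (forall l, (k l <= side m j)%N) ->
  (\int[mu]_x (orthant m heaviside j k x * step (coef (j := j) u) x) =
   \int[mu]_x (u x * orthant m smoothstep j k x))%R.
Proof.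
move=> iu kL.
under eq_Rintegral do rewrite orthant_step//.
under [RHS]eq_Rintegral do rewrite orthantE// mulr_sumr.
have icell (q : idx j) : mu.-integrable setT (fun x => (coef u q * \1_(cell q) x)%:E).
  have := integrable_step (fun q' => (q' == q)%:R * coef u q).
  apply: eq_integrable => // x _ /=; rewrite /step (bigD1 q)//= eqxx mul1r.
  by rewrite big1 ?addr0// => i /negbTE ->; rewrite !mul0r.
have iu_spline (q : idx j) : mu.-integrable setT (fun x => (u x * tensor_bspline q x)%:E).
  exact: (integrable_mul_bounded iu (measurable_tensor_bspline q) (tensor_bspline_le1 q)).
rewrite Rintegral_sum// Rintegral_sum//; apply: eq_bigr => q _.
have -> : (\int[mu]_x (coef u q * \1_(cell q) x))%R = coef u q * (2 ^+ (j * n))^-1.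
  have ind : mu.-integrable setT (fun x => (\1_(cell q) x)%:E).
    have := integrable_step (fun q' => (q' == q)%:R).
    apply: eq_integrable => // x _ /=; rewrite /step (bigD1 q)//= eqxx mul1r.
    by rewrite big1 ?addr0// => i /negbTE ->; rewrite !mul0r.
  rewrite RintegralZl//; congr (_ * _).
  rewrite /Rintegral integral_indic ?setIT//; last exact: measurable_cell.
  by rewrite [X in fine X](lebesgue_cell q).
by rewrite /coef mulrAC mulfV ?mul1r// expf_neq0.
Qed.

Lemma step_outside j (c : idx j -> R) x : ~ cube m x -> step c x = 0.
Proof.
move=> xD; rewrite /step big1// => q _; rewrite indicE.
case: (boolP (x \in cell q)) => [|_]; last by rewrite mulr0.
rewrite inE => xq; exfalso; apply: xD => l.
have /andP[x0 x1] := xq l.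
have p0 : 0 < 2 ^+ j :> R by rewrite exprn_gt0.
have qL : (q l)%:R + 1 <= 2 ^+ j * (m%:R + m%:R) :> R.
  rewrite -[X in _ <= _ * X]natrD addnn -natrX -natrM -sideE natr1 ler_nat.
  exact: ltn_ord.
have q0 : 0 <= (q l)%:R :> R by [].
rewrite /scaled in x0 x1; apply/andP; split.
  by rewrite -subr_gt0 opprK -(pmulr_rgt0 _ p0); lra.
by rewrite -subr_ge0 -(pmulr_rge0 _ p0); lra.
Qed.

(** By [orthant_pairing], the step functions and u have equal pairings with the two kinds of
    orthants. The former tend to the integral of v over a ray in the cube, by L^1 convergence and
    |orthant| <= 1, and the latter to that of u. *)
Lemma step_coef_limit u v : mu.-integrable setT (EFin \o u) ->
  measurable_fun setT v -> mu.-integrable setT (EFin \o v) ->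
  (Lp_norm 1 (fun x => step (coef (j := j) u) x - v x)%R @[j --> \oo] --> 0)%E ->
  {ae mu, forall x, v x * \1_(cube m) x = u x * \1_(cube m) x}.
Proof.
move=> iu mv iv lim0.
have mu_ : measurable_fun setT u by apply/measurable_EFinP; exact: measurable_int iu.
have mcube : measurable (@cube R n m) by exact: measurable_cube.
have mulI w : mu.-integrable setT (EFin \o w) ->
    mu.-integrable setT (fun x => (w x * \1_(cube m) x)%:E).
  move=> iw; apply: (integrable_mul_bounded iw (B := 1)).
    exact: measurable_indic.
  by move=> x; rewrite indicE; case: (_ \in _); rewrite ?normr1 ?normr0.
have iw : mu.-integrable setT
    (EFin \o (fun x => v x * \1_(cube m) x - u x * \1_(cube m) x)).
  by apply: (integrableB _ (mulI _ iv) (mulI _ iu)).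
suff : {ae mu, forall x, v x * \1_(cube m) x - u x * \1_(cube m) x = 0}.
  by apply: filterS => x /eqP; rewrite subr_eq0 => /eqP.
apply: ray_integral_ae0 => // a.
have mray := @measurable_ray R n a.
pose k j l := grid_index m j (a l).
have kL j l : (k j l <= side m j)%N by exact: grid_index_le.
(* Applied to v with [heaviside] and to u with [smoothstep]: the limit orthant is the same for
   both. *)
have limit w (f : R -> R) : mu.-integrable setT (EFin \o w) ->
    measurable_fun setT f -> {homo f : s t / s <= t} -> (forall t, 0 <= f t <= 1) ->
    (forall t, t <= 0 -> f t = 0) -> (forall t, 2 <= t -> f t = 1) ->
    ((\int[mu]_x (w x * orthant m f j (k j) x))%R @[j --> \oo] -->
     (\int[mu]_x (w x * (\1_(ray a) x * \1_(cube m) x)))%R).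
  move=> iw' mf fnd f01 f0 f2.
  have mw : measurable_fun setT w by apply/measurable_EFinP; exact: measurable_int iw'.
  have fin : mu.-integrable setT
      (fun x => (w x * (\1_(ray a) x * \1_(cube m) x))%:E).
    apply: (integrable_mul_bounded iw' (B := 1)).
      by apply: measurable_funM; exact: measurable_indic.
    move=> x; rewrite !indicE.
    by do 2 case: (_ \in _); rewrite ?mulr0 ?mul0r ?mulr1 ?normr1 ?normr0.
  apply: fine_cvg; rewrite fineK; last exact: integrable_fin_num.
  have [] := @dominated_convergence _ _ _ mu setT measurableT
    (fun j x => (w x * orthant m f j (k j) x)%:E)
    (fun x => (w x * (\1_(ray a) x * \1_(cube m) x))%:E)
    (fun x => `|(w x)%:E|%E) _ _ _ _ _ => //.
  - move=> j; apply: measurable_fun_EFin; apply: measurable_funM => //.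
    exact: measurable_orthant.
  - exact: (measurable_int _ fin).
  - apply: aeW => x _; apply: cvg_EFin; first exact: nearW.
    apply: cvg_near_cst.
    have := near_orthant m a x f0 f2; apply: filterS => j /= ->.
    by [].
  - exact: integrable_abse.
  - apply: aeW => x j _; rewrite /= lee_fin normrM ler_piMr//.
    exact: orthant_le1.
have lim_v := limit v heaviside iv measurable_heaviside heaviside_ndecr heaviside01.
have lim_u := limit u smoothstep iu measurable_smoothstep (@smoothstep_ndecr R)
  (@smoothstep01 R) (@smoothstep_le0 R) (@smoothstep_ge2 R).
have h0 (t : R) : t <= 0 -> heaviside t = 0 by move=> t0; rewrite /heaviside ltNge t0.
have h2 (t : R) : 2 <= t -> heaviside t = 1.
  by move=> t2; rewrite /heaviside (lt_le_trans _ t2)// ltr0n.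
have {h0 h2}lim_v := lim_v h0 h2.
have diff0 : ((\int[mu]_x (u x * orthant m smoothstep j (k j) x))%R -
    (\int[mu]_x (v x * orthant m heaviside j (k j) x))%R) @[j --> \oo] --> (0 : R).
  have /fine_cvgP[fin_lim lim0'] := lim0.
  apply/cvgrPdist_le => e e0; near=> j; rewrite sub0r normrN.
  have finj : Lp_norm 1 (fun x => step (coef (j := j) u) x - v x) \is a fin_num.
    by near: j.
  pose h x : R := orthant m heaviside j (k j) x.
  have mh : measurable_fun setT h.
    by apply: measurable_orthant; exact: measurable_heaviside.
  have h1 x : `|h x| <= 1 by exact: (orthant_le1 x heaviside_ndecr heaviside01).
  have ivh := integrable_mul_bounded iv mh h1.
  have ish := integrable_mul_bounded (integrable_step (coef (j := j) u)) mh h1.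
  have ihs : mu.-integrable setT (fun x => (h x * step (coef (j := j) u) x)%:E).
    by apply: eq_integrable ish => // x _; rewrite mulrC.
  apply: (@le_trans _ _ (fine (Lp_norm 1 (fun x => step (coef (j := j) u) x - v x)))).
    rewrite -lee_fin fineK// -orthant_pairing// -RintegralB//.
    have idiff : mu.-integrable setT
        (EFin \o (fun x => h x * step (coef (j := j) u) x - v x * h x)).
      exact: (integrableB _ ihs ivh).
    apply: le_trans (normr_Rintegral_le_Lnorm idiff) _; rewrite /Lp_norm !Lnorm1.
    have mst := @measurable_step R n m j (coef (j := j) u).
    apply: ge0_le_integral => //.
    - apply: (measurableT_comp (@abse_measurable R setT)) => //.
      exact: measurable_int idiff.
    - apply: (measurableT_comp (@abse_measurable R setT)) => //.
      by apply: measurable_fun_EFin; exact: measurable_funB.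
    - move=> x _ /=; rewrite lee_fin [v x * _]mulrC -mulrBr normrM.
      by rewrite ler_piMl.
  have : `|0 - fine (Lp_norm 1 (fun x => step (coef (j := j) u) x - v x))| <= e.
    by near: j; move/cvgrPdist_le: lim0' => /(_ e e0).
  by rewrite sub0r normrN; apply: le_trans; exact: ler_norm.
have eq_lim : (\int[mu]_x (u x * (\1_(ray a) x * \1_(cube m) x)) -
    \int[mu]_x (v x * (\1_(ray a) x * \1_(cube m) x)))%R = 0 :> R.
  rewrite -(cvg_lim (@Rhausdorff R) diff0).
  by apply/esym/(cvg_lim (@Rhausdorff R)); exact: cvgB.
rewrite integral_mkcond.
have iray w : mu.-integrable setT (EFin \o w) -> mu.-integrable setT
    (fun x => (w x * (\1_(ray a) x * \1_(cube m) x))%:E).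
  move=> iw'; apply: (integrable_mul_bounded iw' (B := 1)).
    by apply: measurable_funM; exact: measurable_indic.
  move=> x; rewrite !indicE.
  by do 2 case: (_ \in _); rewrite ?mulr0 ?mul0r ?mulr1 ?normr1 ?normr0.
rewrite (eq_integral (fun x => (v x * (\1_(ray a) x * \1_(cube m) x))%:E -
    (u x * (\1_(ray a) x * \1_(cube m) x))%:E)%E); last first.
  move=> x _; rewrite patchE -EFinB [\1_(ray a) x]indicE; case: (x \in ray a) => /=.
    by rewrite !mul1r.
  by rewrite !mul0r !mulr0 subrr.
rewrite integralB_EFin//; [|exact: iray..].
rewrite -(fineK (integrable_fin_num measurableT (iray _ iv))).
rewrite -(fineK (integrable_fin_num measurableT (iray _ iu))) -EFinB.
by congr EFin; apply/eqP; rewrite -oppr_eq0 opprB; apply/eqP.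
Unshelve. all: by end_near. Qed.

End quasi_projection.

(** * Geometric convergence of step functions *)

Lemma sum_expr_le (R : realType) (y : R) J m : 0 <= y < 1 ->
  \sum_(J <= k < m) y ^+ k <= y ^+ J / (1 - y).
Proof.
move=> /andP[y0 y1]; have [mJ|Jm] := leqP m J.
  by rewrite big_geq// divr_ge0 ?exprn_ge0 ?subr_ge0// ltW.
rewrite ler_pdivlMr ?subr_gt0// mulr_suml.
rewrite (eq_bigr (fun k => - (y ^+ k.+1 - y ^+ k))); last first.
  by move=> k _; rewrite exprS; ring.
by rewrite sumrN telescope_sumr ?(ltnW Jm)// opprB gerBl exprn_ge0.
Qed.

Section rates.
Context {R : realType}.
Variables (n : nat) (alpha : R).
Implicit Types p : R.

(** The exponent per level that the L^1 decay 1 - alpha leaves after the loss in passing to L^p. *)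
Definition gap p : R := 1 - alpha - n%:R * (1 - p^-1).

Definition decay_rate p : R := 2 `^ (- gap p).

(** The numerator appears because the difference of levels j and j + 1 lives on the cells of level j
    + 1; the denominator sums the geometric series. *)
Definition step_const p : R := 2 `^ (n%:R * (1 - p^-1)) / (1 - decay_rate p).

Lemma decay_rate_lt1 p : 0 < gap p -> decay_rate p < 1.
Proof.
move=> g0; rewrite /decay_rate powRN invf_lt1 ?powR_gt0//.
apply: (@le_lt_trans _ _ (1 `^ gap p)); first by rewrite powR1.
by apply: gt0_ltr_powR; rewrite ?nnegrE// ltr1n.
Qed.

End rates.

Section geometric.
Context {R : realType} {n : nat}.
Local Notation E := 'rV[R]_n.
Local Notation mu := (@lebesgue_rV R n).
Variables (m : nat) (alpha : R).
Implicit Types (x : E) (u v w : E -> R) (j : nat) (p M : R).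
Local Notation idx j := {ffun 'I_n -> 'I_(side m j)}.

(** Up to the volume of the cells, the left side is the L^1 norm of the difference of consecutive
    step functions. The coefficients are arbitrary because those in [compact_embedding] arise as
    limits and not from a given function. *)
Definition coef_decay (c : forall j, idx j -> R) M := forall j,
  \sum_q `|c j.+1 q - c j (parent q)| <=
    2 ^+ (j.+1 * n) * (M * 2 `^ (- j%:R * (1 - alpha))).

Lemma Lnorm_step_succ p (c : forall j, idx j -> R) M j : 1 <= p -> coef_decay c M ->
  (Lp_norm p (fun x => step (c j.+1) x - step (c j) x)%R <=
    (2 `^ (n%:R * (1 - p^-1)) * M * decay_rate n alpha p ^+ j)%:E)%E.
Proof.
move=> p1 cM; have p0 : 0 < p by rewrite (lt_le_trans ltr01).
rewrite (_ : (fun x => _) = step (fun q => c j.+1 q - c j (parent q))); last first.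
  apply/funext => x; rewrite (step_refine (c j)) /step -sumrB.
  by apply: eq_bigr => q _; rewrite mulrBl.
apply: le_trans (Lnorm_step _ p1) _; rewrite lee_fin.
apply: (@le_trans _ _ (2 `^ (- (j.+1 * n)%:R / p) *
    (2 ^+ (j.+1 * n) * (M * 2 `^ (- j%:R * (1 - alpha)))))).
  by rewrite ler_wpM2l// powR_ge0.
rewrite le_eqVlt; apply/orP; left; apply/eqP.
have p2 : 2 != 0 :> R by [].
rewrite /decay_rate -!powR_mulrn ?powR_ge0// -powRrM.
transitivity (M * (2 `^ (- (j.+1 * n)%:R / p) * 2 `^ (j.+1 * n)%:R *
  2 `^ (- j%:R * (1 - alpha)))); first by ring.
rewrite -!powRD ?p2 ?implybT//.
transitivity (M * (2 `^ (n%:R * (1 - p^-1)) * 2 `^ (- gap n alpha p * j%:R))); last by ring.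
rewrite -powRD ?p2 ?implybT//; congr (_ * _ `^ _).
by rewrite /gap natrM -natr1; field; rewrite gt_eqF.
Qed.

Lemma Lnorm_step_tail p (c : forall j, idx j -> R) M J k : 1 <= p -> 0 < gap n alpha p ->
  0 <= M -> coef_decay c M -> (J <= k)%N ->
  (Lp_norm p (fun x => step (c k) x - step (c J) x)%R <=
    (step_const n alpha p * M * decay_rate n alpha p ^+ J)%:E)%E.
Proof.
move=> p1 g0 M0 cM Jk.
apply: le_trans (Lnorm_telescope_le _ p1 Jk (fun j => measurable_step (c j))) _.
apply: (@le_trans _ _ (\sum_(J <= j < k)
    (2 `^ (n%:R * (1 - p^-1)) * M * decay_rate n alpha p ^+ j)%:E)%E).
  by apply: lee_sum => j _; exact: Lnorm_step_succ.
rewrite sumEFin lee_fin -mulr_sumr /step_const.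
set r := decay_rate n alpha p; set A := 2 `^ _.
have -> : A / (1 - r) * M * r ^+ J = A * M * (r ^+ J / (1 - r)) by ring.
rewrite ler_wpM2l ?mulr_ge0 ?powR_ge0// sum_expr_le// decay_rate_lt1//.
by rewrite powR_ge0.
Qed.

(** The limit is built once, with exponent 1, where the increments are summable because alpha < 1;
    the bounds for every admissible p follow by Fatou's lemma. *)
Lemma step_limit (c : forall j, idx j -> R) M : alpha < 1 -> 0 <= M -> coef_decay c M ->
  exists v, [/\ measurable_fun setT v, mu.-integrable setT (EFin \o v),
    {ae mu, forall x, step (c j) x @[j --> \oo] --> v x} &
    forall p J, 1 <= p -> 0 < gap n alpha p ->
      (Lp_norm p (fun x => v x - step (c J) x)%R <=
        (step_const n alpha p * M * decay_rate n alpha p ^+ J)%:E)%E].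
Proof.
move=> alpha1 M0 cM.
have g1 : 0 < gap n alpha 1 by rewrite /gap invr1 subrr mulr0 subr0 subr_gt0.
have r1 := decay_rate_lt1 g1; have r0 : 0 <= decay_rate n alpha 1 := powR_ge0 _ _.
have [|v mv cvg_v] :=
    @summable_Lnorm1_ae_cvg _ _ _ mu (fun j => step (c j)) (fun j => measurable_step (c j)).
  apply: (@le_lt_trans _ _ (step_const n alpha 1 * M)%:E); last exact: ltry.
  apply: lime_le; first by apply: is_cvg_nneseries => j _ _; exact: Lnorm_ge0.
  apply: nearW => k.
  apply: (@le_trans _ _ (\sum_(0 <= j < k)
    (2 `^ (n%:R * (1 - 1^-1)) * M * decay_rate n alpha 1 ^+ j)%:E)%E).
    by apply: lee_sum => j _; exact: Lnorm_step_succ.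
  rewrite sumEFin lee_fin -mulr_sumr.
  rewrite (_ : step_const n alpha 1 * M =
    2 `^ (n%:R * (1 - 1^-1)) * M * (1 - decay_rate n alpha 1)^-1); last first.
    by rewrite /step_const mulrAC.
  rewrite ler_wpM2l//.
    by rewrite mulr_ge0 ?powR_ge0.
  by rewrite -[leRHS]mul1r -[X in X * _](expr0 (decay_rate n alpha 1)) sum_expr_le ?r0.
have tail p J : 1 <= p -> 0 < gap n alpha p ->
    (Lp_norm p (fun x => v x - step (c J) x)%R <=
        (step_const n alpha p * M * decay_rate n alpha p ^+ J)%:E)%E.
  move=> p1 g0.
  apply: (@ae_cvg_Lnorm_le _ _ _ mu p
    (fun k x => step (c (J + k)%N) x - step (c J) x)) => //.
  - by move=> k; apply: measurable_funB; exact: measurable_step.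
  - by apply: measurable_funB => //; exact: measurable_step.
  - apply: filterS cvg_v => x cx; apply: cvgB; last exact: cvg_cst.
    have := cx; rewrite -(cvg_shiftn J (fun k => step (c k) x)) /=.
    by under eq_fun do rewrite addnC.
  - by move=> k; apply: Lnorm_step_tail => //; exact: leq_addr.
exists v; split => //.
have -> : EFin \o v = (fun x => (v x - step (c 0%N) x)%:E + (step (c 0%N) x)%:E)%E.
  by apply/funext => x /=; rewrite -EFinD subrK.
apply: integrableD => //; last exact: integrable_step.
apply/integrableP; split.
  by apply: measurable_fun_EFin; apply: measurable_funB => //;
    exact: measurable_step.
have := tail 1 0%N (lexx _) g1; rewrite /Lp_norm Lnorm1 => /le_lt_trans; apply.
exact: ltry.
Qed.

End geometric.

(** * The embedding on a cube *)

Section embedding.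
Context {R : realType} {n : nat}.
Local Notation E := 'rV[R]_n.
Local Notation mu := (@lebesgue_rV R n).
Variables (m : nat) (alpha : R).
Implicit Types (x : E) (u v w g : E -> R) (j : nat) (p M B : R).
Local Notation idx j := {ffun 'I_n -> 'I_(side m j)}.

Lemma Rintegral_mul_le u g B : mu.-integrable setT (EFin \o u) ->
  measurable_fun setT g -> (forall x, `|g x| <= B) ->
  (`|\int[mu]_x (u x * g x)|%R%:E <= B%:E * Lp_norm 1 u)%E.
Proof.
move=> iu mg gB; have B0 : 0 <= B := le_trans (normr_ge0 _) (gB 0).
have mu_ : measurable_fun setT u by apply/measurable_EFinP; exact: measurable_int iu.
apply: le_trans (normr_Rintegral_le_Lnorm (integrable_mul_bounded iu mg gB)) _.
rewrite /Lp_norm !Lnorm1 -ge0_integralZl//; last first.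
  by apply: (measurableT_comp (@abse_measurable R setT)) => //; exact: measurable_int iu.
apply: ge0_le_integral => //.
- apply: (measurableT_comp (@abse_measurable R setT)) => //.
  by apply: measurable_fun_EFin; exact: measurable_funM.
- apply: (measurable_funeM B%:E).
  by apply: (measurableT_comp (@abse_measurable R setT)) => //; exact: measurable_int iu.
- by move=> x _ /=; rewrite lee_fin normrM mulrC ler_wpM2r.
Qed.

Lemma measurable_refine_kernel j (q : idx j.+1) :
  measurable_fun setT (refine_kernel q : E -> R).
Proof.
rewrite (_ : refine_kernel q = fun x : E =>
    tensor_bspline q x - (2 ^+ n)^-1 * tensor_bspline (parent q) x); last first.
  by apply/funext => x; rewrite refine_kernelE.
apply: measurable_funB; first exact: measurable_tensor_bspline.
by apply: measurable_funM => //; exact: measurable_tensor_bspline.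
Qed.

Lemma sum_refine_kernel_le j (s : idx j.+1 -> R) x : (forall q, `|s q| <= 1) ->
  `|\sum_q s q * refine_kernel q x| <= 2.
Proof.
move=> s1.
have h1 := sum_prod_norm_le
  (fun l : 'I_n => sum_fine_bspline (scaled m j (x ord0 l)) (side m j)).
have h2 := sum_prod_norm_le
  (fun l : 'I_n => sum_coarse_bspline (scaled m j (x ord0 l)) (side m j)).
apply: le_trans (ler_norm_sum _ _ _) _.
apply: (@le_trans _ _ (\sum_(q : idx j.+1)
   (`|\prod_l fine_bspline (q l) (scaled m j (x ord0 l))| +
    `|\prod_l coarse_bspline (q l) (scaled m j (x ord0 l))|))).
  apply: ler_sum => q _; rewrite normrM.
  apply: le_trans (ler_normB _ _).
  by rewrite ler_piMl.
by rewrite big_split/=; rewrite !expr1n in h1 h2; exact: lerD.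
Qed.

Lemma coef_refine j u (q : idx j.+1) : mu.-integrable setT (EFin \o u) ->
  coef u q - coef u (parent q) =
  2 ^+ (j.+1 * n) * (\int[mu]_x (u x * refine_kernel q x))%R.
Proof.
move=> iu; have iq k (q' : idx k) : mu.-integrable setT
    (fun x => (u x * tensor_bspline q' x)%:E).
  exact: integrable_mul_bounded iu (measurable_tensor_bspline q') (tensor_bspline_le1 q').
under eq_Rintegral do rewrite refine_kernelE mulrBr mulrCA.
rewrite RintegralB//; last 2 first.
- exact: iq.
- exact: eq_integrable (integrableZl measurableT ((2 ^+ n)^-1) (iq _ (parent q))).
rewrite RintegralZl//; last exact: iq.
rewrite mulrBr /coef; congr (_ - _).
by rewrite mulrA mulSn exprD [2 ^+ n * _]mulrC mulfK// expf_neq0.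
Qed.

(* The test functions are the divergences of the fields refine_flux s. *)
Definition dual_bound u M := forall j (s : idx j.+1 -> R), (forall q, `|s q| <= 1) ->
  (\int[mu]_x (u x * \sum_q s q * refine_kernel q x))%R <=
    M * 2 `^ (- j%:R * (1 - alpha)).

Lemma dual_bound_coef_decay u M : mu.-integrable setT (EFin \o u) ->
  dual_bound u M -> coef_decay alpha (fun j => @coef _ n m j u) M.
Proof.
move=> iu uM j.
pose d (q : idx j.+1) := coef u q - coef u (parent q).
have s1 q : `|Num.sg (d q)| <= 1 by rewrite normr_sg; case: (_ != 0).
apply: le_trans (_ : 2 ^+ (j.+1 * n) * (\int[mu]_x (u x *
    \sum_q Num.sg (d q) * refine_kernel q x))%R <= _); last first.
  by rewrite ler_wpM2l ?exprn_ge0//; exact: uM.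
under eq_Rintegral do rewrite mulr_sumr.
have ik (q : idx j.+1) : mu.-integrable setT
    (fun x => (u x * (Num.sg (d q) * refine_kernel q x))%:E).
  apply: (integrable_mul_bounded iu (B := 2)).
    by apply: measurable_funM => //; exact: measurable_refine_kernel.
  (* A single term is the sum for a family of weights that vanishes except at q, so it inherits the
     bound 2. *)
  move=> x; have /sum_refine_kernel_le : forall q', `|(q' == q)%:R * Num.sg (d q)| <= 1.
    by move=> q'; case: (q' == q); rewrite ?mul1r// mul0r normr0.
  move=> /(_ x); rewrite (bigD1 q)//= eqxx mul1r big1 ?addr0//.
  by move=> q' /negbTE ->; rewrite !mul0r.
rewrite Rintegral_sum// mulr_sumr ler_sum// => q _.
under eq_Rintegral do rewrite mulrCA.
rewrite RintegralZl//; last first.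
  apply: (integrable_mul_bounded iu (measurable_refine_kernel q) (B := 2)) => x.
  have /sum_refine_kernel_le : forall q', `|(q' == q)%:R : R| <= 1.
    by move=> q'; case: (q' == q); rewrite ?normr1 ?normr0.
  move=> /(_ x); rewrite (bigD1 q)//= eqxx mul1r big1 ?addr0//.
  by move=> q' /negbTE ->; rewrite !mul0r.
by rewrite mulrCA -(coef_refine q iu) -/(d q) -normrEsg.
Qed.

(** Cells of level 0 have volume 1, so the bound of [Lnorm_step] is the same for every p. The sum of
    the absolute values of the coefficients is the integral of u against a signed sum of splines,
    which is at most 1 in absolute value. *)
Lemma Lnorm_step0_coef p u : 1 <= p -> mu.-integrable setT (EFin \o u) ->
  (Lp_norm p (step (@coef _ n m 0 u)) <= Lp_norm 1 u)%E.
Proof.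
move=> p1 iu; apply: le_trans (Lnorm_step _ p1) _.
rewrite mul0n oppr0 mul0r powRr0 mul1r.
pose c := @coef _ n m 0 u.
have mS : measurable_fun setT (fun x => \sum_q Num.sg (c q) * tensor_bspline q x).
  apply: measurable_sum => q; apply: measurable_funM => //.
  exact: measurable_tensor_bspline.
have S1 x : `|\sum_q Num.sg (c q) * tensor_bspline q x| <= 1.
  have h := sum_prod_norm_le
    (fun l : 'I_n => sum_abs_bspline (scaled m 0 (x ord0 l)) (side m 0)).
  rewrite expr1n in h; apply: le_trans h.
  apply: le_trans (ler_norm_sum _ _ _) _; apply: ler_sum => q _.
  by rewrite normrM ler_piMl// normr_sg; case: (_ != 0).
have := Rintegral_mul_le iu mS S1; rewrite mul1e; apply: le_trans.
rewrite lee_fin.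
under eq_Rintegral do rewrite mulr_sumr.
have iq (q : idx 0) : mu.-integrable setT (fun x => (u x * tensor_bspline q x)%:E).
  exact: integrable_mul_bounded iu (measurable_tensor_bspline q) (tensor_bspline_le1 q).
rewrite Rintegral_sum; last first.
  move=> q; apply: eq_integrable (integrableZl measurableT (Num.sg (c q)) (iq q)) => //.
  by move=> x _; rewrite -EFinM mulrCA.
apply: le_trans (ler_norm _); apply: ler_sum => q _.
under eq_Rintegral do rewrite mulrCA.
rewrite RintegralZl//; last exact: iq.
have -> : (\int[mu]_x (u x * tensor_bspline q x))%R = c q.
  by rewrite /c /coef mul0n expr0 mul1r.
by rewrite -normrEsg.
Qed.

(** The limit given by [step_limit] agrees with u in the cube by [step_coef_limit] and vanishes
    outside, as all the step functions do; its tail bounds are therefore bounds for u. *)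
Lemma embedding u M J p : alpha < 1 -> 0 <= M -> mu.-integrable setT (EFin \o u) ->
  dual_bound u M -> 1 <= p -> 0 < gap n alpha p ->
  (Lp_norm p (fun x => u x * \1_(cube m) x - step (@coef _ n m J u) x)%R <=
    (step_const n alpha p * M * decay_rate n alpha p ^+ J)%:E)%E.
Proof.
move=> alpha1 M0 iu uM p1 g0; have cM := dual_bound_coef_decay iu uM.
have [v [mv iv cvg_v tail]] := step_limit alpha1 M0 cM.
have g1 : 0 < gap n alpha 1 by rewrite /gap invr1 subrr mulr0 subr0 subr_gt0.
have v_u : {ae mu, forall x, v x * \1_(cube m) x = u x * \1_(cube m) x}.
  apply: step_coef_limit => //.
  apply: (@squeeze_cvge _ _ _ _ (cst 0%E) _ (fun j =>
    (step_const n alpha 1 * M * decay_rate n alpha 1 ^+ j)%:E)).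
  - near=> j; rewrite Lnorm_ge0/= /Lp_norm Lnorm_distC.
    exact: tail.
  - exact: cvg_cst.
  - apply: cvg_EFin; first exact: nearW.
    rewrite -[X in _ --> X](mulr0 (step_const n alpha 1 * M)).
    apply: cvgM; first exact: cvg_cst.
    by apply: cvg_expr; rewrite ger0_norm ?powR_ge0// decay_rate_lt1.
have v_cube : {ae mu, forall x, v x = v x * \1_(cube m) x}.
  apply: filterS cvg_v => x vx; rewrite indicE.
  have [xD|xD] := boolP (x \in cube m); first by rewrite mulr1.
  rewrite mulr0; apply/esym; rewrite -(cvg_lim (@Rhausdorff R) vx).
  rewrite (_ : (fun j => _) = cst 0) ?lim_cst//.
  apply/funext => j; rewrite step_outside// => xD'; move/negP: xD; apply.
  by rewrite inE.
have mu_ : measurable_fun setT u by apply/measurable_EFinP; exact: measurable_int iu.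
have mstep := @measurable_step R n m J (@coef _ n m J u).
apply: (@ae_cvg_Lnorm_le _ _ _ mu p (fun _ x => v x - step (@coef _ n m J u) x)) => //.
- by move=> _; exact: measurable_funB.
- apply: measurable_funB => //; apply: measurable_funM => //.
  by apply: measurable_indic; exact: measurable_cube.
- apply: filterS2 v_u v_cube => x e1 e2.
  by rewrite {1}e2 e1; exact: cvg_cst.
- by move=> _; exact: tail.
Unshelve. all: by end_near. Qed.

Lemma embedding_norm u M p : alpha < 1 -> 0 <= M -> mu.-integrable setT (EFin \o u) ->
  dual_bound u M -> 1 <= p -> 0 < gap n alpha p ->
  (Lp_norm p (fun x => u x * \1_(cube m) x)%R <=
    (step_const n alpha p * M)%:E + Lp_norm 1 u)%E.
Proof.
move=> alpha1 M0 iu uM p1 g0.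
have mu_ : measurable_fun setT u by apply/measurable_EFinP; exact: measurable_int iu.
have mst := @measurable_step R n m 0 (@coef _ n m 0 u).
apply: le_trans (Lnorm_le_distD (g := step (@coef _ n m 0 u)) _ p1 _ mst) _.
  apply: measurable_funM => //; apply: measurable_indic; exact: measurable_cube.
apply: leeD; last exact: Lnorm_step0_coef.
by have := embedding 0 alpha1 M0 iu uM p1 g0; rewrite expr0 mulr1.
Qed.

End embedding.

(** * Estimates from the variations *)

Section euclidean_norm.
Context {R : realType} {n : nat}.
Implicit Types x : 'rV[R]_n.

Lemma enorm_coord x l : `|x ord0 l| <= enorm x.
Proof.
rewrite -sqrtr_sqr ler_sqrt; last by rewrite sumr_ge0// => i _; rewrite sqr_ge0.
by rewrite (bigD1 l)//= lerDl sumr_ge0// => i _; rewrite sqr_ge0.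
Qed.

Lemma enorm_gt0 x : x != 0 -> 0 < enorm x.
Proof.
move=> x0; have /existsNP[l xl] : ~ forall l, x ord0 l = 0.
  by move=> xl; move/eqP: x0; apply; apply/rowP => l; rewrite xl mxE.
apply: lt_le_trans (enorm_coord x l); rewrite normr_gt0; exact/eqP.
Qed.

Lemma enorm_le_sum x : enorm x <= \sum_l `|x ord0 l|.
Proof.
have S0 : 0 <= \sum_l `|x ord0 l| by exact: sumr_ge0.
rewrite /enorm -[leRHS]ger0_norm// -sqrtr_sqr ler_sqrt ?sqr_ge0//.
rewrite expr2 mulr_suml ler_sum// => i _.
rewrite -real_normK ?num_real// expr2 ler_wpM2l//.
by rewrite (bigD1 i)//= lerDl sumr_ge0.
Qed.

Lemma sum_coord_le_enorm x : \sum_l `|x ord0 l| <= n%:R * enorm x.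
Proof.
apply: le_trans (_ : \sum_(l < n) enorm x <= _).
  by apply: ler_sum => l _; exact: enorm_coord.
by rewrite sumr_const card_ord mulr_natl.
Qed.

End euclidean_norm.

Section variation_test.
Context {R : realType} {n : nat}.
Local Notation E := 'rV[R]_n.
Local Notation mu := (@lebesgue_rV R n).
Variable m : nat.
Implicit Types (x : E) (u : E -> R) (j : nat).
Local Notation idx j := {ffun 'I_n -> 'I_(side m j)}.

Definition flux_field j (s : idx j.+1 -> R) (k : R) x : E :=
  \row_i (k * refine_flux s i x).

Lemma C1_flux_field j (s : idx j.+1 -> R) k i :
  C1 (fun x => flux_field s k x ord0 i).
Proof.
have -> : (fun x => flux_field s k x ord0 i) = fun x => k * refine_flux s i x.
  by apply/funext => x; rewrite mxE.
by apply: C1_scale; exact: C1_refine_flux.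
Qed.

Lemma divergence_flux_field j (s : idx j.+1 -> R) k x :
  divergence (flux_field s k) x = k * \sum_q s q * refine_kernel q x.
Proof.
rewrite divergenceE; last exact: C1_flux_field.
rewrite -sum_partial_refine_flux mulr_sumr; apply: eq_bigr => i _.
rewrite -partialZ; last exact: C1_refine_flux.
by congr (partial _ i x); apply/funext => y; rewrite mxE.
Qed.

Lemma C1c_flux_field j (s : idx j.+1 -> R) k : C1c (flux_field s k).
Proof.
split; first exact/C1_continuously_differentiable/C1_flux_field.
exists [set x : E | forall l, `[- m%:R, m%:R + 3]%classic (x ord0 l)].
  exact: (rV_compact (fun l => @segment_compact R _ _)).
by move=> x xK; apply/rowP => i; rewrite !mxE refine_flux_support ?mulr0.
Qed.

Lemma variation_test u j (s : idx j.+1 -> R) (B : R) :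
  mu.-integrable setT (EFin \o u) -> (bv_variation u <= B%:E)%E ->
  (forall q, `|s q| <= 1) ->
  (\int[mu]_x (u x * \sum_q s q * refine_kernel q x))%R <=
    n.+1%:R * 4 ^+ n * B / 2 ^+ j.
Proof.
(* The n components are at most 2^-j * 4^n in absolute value, so k brings the norm of the field down
   to n / n.+1; the successor keeps k positive when n = 0. *)
move=> iu uB s1; pose k : R := 2 ^+ j / (n.+1%:R * 4 ^+ n).
have p0 : 0 < 2 ^+ j :> R by rewrite exprn_gt0.
have c0 : 0 < n.+1%:R * 4 ^+ n :> R by rewrite mulr_gt0 ?exprn_gt0.
have k0 : 0 < k by rewrite divr_gt0.
have -> : n.+1%:R * 4 ^+ n * B / 2 ^+ j = k^-1 * B by rewrite /k invf_div mulrAC.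
rewrite ler_pdivlMl// -lee_fin.
apply: le_trans uB; apply: ereal_sup_ubound => /=.
exists (flux_field s k).
  split; first exact: C1c_flux_field.
  move=> x; apply: le_trans (enorm_le_sum _) _.
  apply: (@le_trans _ _ (\sum_(i < n) k * ((2 ^+ j)^-1 * 4 ^+ n))).
    apply: ler_sum => i _; rewrite mxE normrM gtr0_norm// (ler_wpM2l (ltW k0))//.
    exact: refine_flux_le.
  rewrite sumr_const card_ord -[_ *+ n]mulr_natr /k.
  have -> : 2 ^+ j / (n.+1%:R * 4 ^+ n) * ((2 ^+ j)^-1 * 4 ^+ n) * n%:R =
      n%:R / n.+1%:R :> R.
    by field; rewrite addrC natr1 !expf_neq0// pnatr_eq0.
  by rewrite ler_pdivrMr// mul1r ler_nat.
have mS : measurable_fun setT (fun x => \sum_q s q * refine_kernel q x).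
  apply: measurable_sum => q; apply: measurable_funM => //.
  exact: measurable_refine_kernel.
have iS := integrable_mul_bounded iu mS (fun x => sum_refine_kernel_le x s1).
rewrite -RintegralZl// /Rintegral fineK.
  apply: eq_integral => x _; rewrite divergence_flux_field.
  by rewrite mulrCA.
apply: integrable_fin_num => //.
exact: eq_integrable (integrableZl measurableT k iS).
Qed.

End variation_test.

(** * Jacobians with coordinate functions *)

Section coordinate_jacobian.
Context {R : realType} {n : nat}.
Local Notation E := 'rV[R]_n.+1.
Implicit Types (x y : E) (f : E -> R) (i : 'I_n.+1) (alpha B : R).

(** A coordinate is a product whose other factors are 1, so [C1_prod_coord] applies. *)
Lemma C1_coord (k : 'I_n.+1) : C1 (fun x : E => x ord0 k) /\
  forall i x, partial (fun x : E => x ord0 k) i x = (i == k)%:R.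
Proof.
pose h (l : 'I_n.+1) : R -> R := if l == k then id else cst 1.
pose dh (l : 'I_n.+1) : R -> R := cst (l == k)%:R.
have hdh l (t : R) : is_derive t 1 (h l) (dh l t).
  rewrite /h /dh /=; case: (l == k); first exact: is_derive_id.
  exact: is_derive_cst.
have coordE : (fun x : E => x ord0 k) = fun x => \prod_l h l (x ord0 l).
  apply/funext => x; rewrite (bigD1 k)//= big1 ?mulr1; first by rewrite /h eqxx.
  by move=> l /negbTE lk; rewrite /h lk.
rewrite coordE; split=> [|i x].
  by apply: (C1_prod_coord hdh) => l t; exact: cst_continuous.
rewrite /partial; have [_ ->] := is_derive_prod_coord (hdh i (x ord0 i)).
rewrite /dh /=; case: eqP => [->|_]; last by rewrite mul0r.
by rewrite big1 ?mulr1// => l /negbTE lk; rewrite /h lk.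
Qed.

(** All coordinates except i, with coordinate 0 put in place i: being a transposition, this order
    makes the Jacobian matrix triangular after one exchange of rows. *)
Definition coord_maps i (k : 'I_n) x : R := x ord0 (tperm ord0 i (lift ord0 k)).

Lemma detD_coord f i x : C1 f ->
  detD f (coord_maps i) x = (-1) ^+ tperm ord0 i * partial f i x.
Proof.
move=> cf; set t := tperm ord0 i.
have compE b : (fun x => tuple_map f (coord_maps i) x ord0 b) =
    if b == ord0 then f else (fun x : E => x ord0 (t b)).
  apply/funext => y; rewrite mxE; case: unliftP => [k ->|->]; last by rewrite eqxx.
  by rewrite (_ : (lift ord0 k == ord0) = false)//.
have cF b : C1 (fun x => tuple_map f (coord_maps i) x ord0 b).
  by rewrite compE; case: eqP => // _; case: (C1_coord (t b)).
rewrite /detD.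
(* Exchanging the rows 0 and i makes the Jacobian matrix lower triangular, with
   diagonal entries partial f i x, 1, ..., 1. *)
set A := 'J _ x.
have -> : \det A = (-1) ^+ t * \det (row_perm t A).
  by rewrite row_permE det_mulmx det_perm mulrA -signr_addb addbb mul1r.
congr (_ * _).
have AE a b : A a b = if b == ord0 then partial f a x else (a == t b)%:R.
  rewrite /A jacobianE// compE; case: eqP => // _.
  by case: (C1_coord (t b)) => _ ->.
rewrite det_trig; last first.
  apply/is_trig_mxP => a b ab; rewrite mxE AE.
  have -> : (b == ord0) = false by apply/negbTE; rewrite -lt0n (leq_ltn_trans _ ab).
  by rewrite (inj_eq perm_inj) -(inj_eq val_inj)/= (ltn_eqF ab).
rewrite (bigD1 ord0)//= big1 ?mulr1; first by rewrite mxE AE eqxx tpermL.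
by move=> a /negbTE a0; rewrite mxE AE a0 eqxx.
Qed.

Lemma Lip_alpha_le alpha (g : E -> R) B :
  (forall x y, x != y -> `|g x - g y| <= B * enorm (x - y) `^ alpha) ->
  (Lip_alpha alpha g <= B%:E)%E.
Proof.
move=> gB; apply: ge_ereal_sup => _ [[x y] /= xy <-]; rewrite lee_fin.
rewrite ler_pdivrMr; first exact: gB.
by rewrite powR_gt0// enorm_gt0// subr_eq0.
Qed.

Lemma Lip_alpha_ge0 alpha (g : E -> R) : (0 <= Lip_alpha alpha g)%E.
Proof.
apply: le_ereal_sup_tmp.
exists (`|g (const_mx 1) - g 0| / enorm (const_mx 1 - 0 : E) `^ alpha)%:E.
  exists (const_mx 1, 0) => //=; apply/eqP => /matrixP/(_ ord0 ord0)/eqP.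
  by rewrite !mxE oner_eq0.
by rewrite lee_fin divr_ge0// powR_ge0.
Qed.

Lemma Lip_coord_le1 i k : (Lip (coord_maps i k) <= 1)%E.
Proof.
apply: Lip_alpha_le => x y _; rewrite powRr1 ?sqrtr_ge0// mul1r /coord_maps.
apply: le_trans (enorm_coord (x - y) (tperm ord0 i (lift ord0 k))).
by rewrite !mxE.
Qed.

Lemma prod_Lip_coord_le1 i : (\prod_(k < n) Lip (coord_maps i k) <= 1)%E.
Proof.
suff /andP[_] : (0 <= \prod_(k < n) Lip (coord_maps i k) <= 1)%E by [].
elim/big_rec: _ => [|k y _ /andP[y0 y1]]; first by rewrite lee01 lexx.
rewrite mule_ge0 ?Lip_alpha_ge0//= -[leRHS]mule1.
by rewrite lee_pmul ?Lip_alpha_ge0 ?Lip_coord_le1.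
Qed.

End coordinate_jacobian.

(** * The estimate from the fractional variation *)

Section fractional_test.
Context {R : realType} {n : nat}.
Local Notation E := 'rV[R]_n.+1.
Local Notation mu := (@lebesgue_rV R n.+1).
Variables (m : nat) (alpha : R).
Hypothesis alpha01 : 0 < alpha < 1.
Implicit Types (x y : E) (u : E -> R) (j : nat).
Local Notation idx j := {ffun 'I_n.+1 -> 'I_(side m j)}.

(** The factor 2 serves the oscillation of a component, and n.+1 the comparison of the sum of the
    coordinates with [enorm]. Having one constant for both estimates, it comes out unchanged from
    the interpolation in [refine_flux_holder]. *)
Definition lip_const : R := 2 * n.+1%:R * 4 ^+ n.+1.

Lemma refine_flux_enorm j (s : idx j.+1 -> R) i x y : (forall q, `|s q| <= 1) ->
  `|refine_flux s i x - refine_flux s i y| <= lip_const * enorm (x - y).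
Proof.
move=> s1; apply: le_trans (refine_flux_lip i x y s1) _.
have -> : \sum_l `|x ord0 l - y ord0 l| = \sum_l `|(x - y) ord0 l|.
  by apply: eq_bigr => l _; rewrite !mxE.
apply: (@le_trans _ _ (4 ^+ n.+1 * (n.+1%:R * enorm (x - y)))).
  by rewrite ler_wpM2l ?exprn_ge0// sum_coord_le_enorm.
rewrite /lip_const [4 ^+ _ * _]mulrC -!mulrA [_ * 4 ^+ _]mulrC.
by rewrite ler_peMl ?mulr_ge0 ?exprn_ge0 ?sqrtr_ge0// ler1n.
Qed.

(** Interpolation: in d = d^(1 - alpha) * d^alpha the first factor is bounded by the supremum
    estimate, which carries 2^-j, and the second by the Lipschitz estimate. *)
Lemma refine_flux_holder j (s : idx j.+1 -> R) i x y : (forall q, `|s q| <= 1) ->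
  `|refine_flux s i x - refine_flux s i y| <=
    lip_const * 2 `^ (- j%:R * (1 - alpha)) * enorm (x - y) `^ alpha.
Proof.
move=> s1; set d := `|_|; have /andP[a0 a1] := alpha01.
have L0 : 0 <= lip_const by rewrite !mulr_ge0 ?exprn_ge0.
have e0 : 0 <= enorm (x - y) by exact: sqrtr_ge0.
have d1 : d <= lip_const * 2 `^ (- j%:R).
  apply: le_trans (ler_normB _ _) _.
  apply: (@le_trans _ _ (2 * ((2 ^+ j)^-1 * 4 ^+ n.+1))).
    by rewrite mulr_natl mulr2n lerD// refine_flux_le.
  rewrite powRN powR_mulrn// /lip_const -!mulrA ler_pM2l//.
  rewrite [_^-1 * _]mulrC ler_peMl ?mulr_ge0 ?invr_ge0 ?exprn_ge0// ler1n//.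
have d2 : d <= lip_const * enorm (x - y) by exact: refine_flux_enorm.
have [d0|d0] := eqVneq d 0.
  by rewrite d0 !mulr_ge0 ?powR_ge0.
have dE : d = d `^ (1 - alpha) * d `^ alpha.
  by rewrite -powRD ?subrK ?powRr1 ?normr_ge0// d0 implybT.
rewrite dE.
have lE : lip_const = lip_const `^ (1 - alpha) * lip_const `^ alpha.
  rewrite -powRD ?subrK ?powRr1// oner_eq0//.
rewrite {1}lE -mulrA mulrACA.
have -> : lip_const `^ (1 - alpha) * 2 `^ (- j%:R * (1 - alpha)) =
    (lip_const * 2 `^ (- j%:R)) `^ (1 - alpha).
  by rewrite powRM ?powR_ge0// -powRrM.
rewrite -powRM//; apply: ler_pM; rewrite ?powR_ge0//.
- apply: ge0_ler_powR; rewrite ?nnegrE ?normr_ge0//; first by rewrite subr_ge0 ltW.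
  by rewrite mulr_ge0 ?powR_ge0.
- apply: ge0_ler_powR; rewrite ?nnegrE ?normr_ge0//; first exact: ltW.
  by rewrite mulr_ge0.
Qed.

Lemma measurable_partial_factor j (i l q : nat) : measurable_fun setT (fun t : R =>
  mixed_factor i l (fine_bspline q (scaled m j t)) (coarse_bspline q (scaled m j t))
    (fine_bspline q (scaled m j t) - coarse_bspline q (scaled m j t))).
Proof.
have mfine : measurable_fun setT (fun t : R => fine_bspline q (scaled m j t)).
  apply: continuous_measurable_fun.
  exact: (@continuous_scaled _ _ j bspline 2 (- q%:R) continuous_bspline).
have mcoarse : measurable_fun setT (fun t : R => coarse_bspline q (scaled m j t)).
  apply: measurable_funM => //; apply: continuous_measurable_fun.
  under eq_fun do rewrite -[scaled _ _ _]mul1r.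
  exact: (@continuous_scaled _ _ j bspline 1 (- (q./2)%:R) continuous_bspline).
rewrite /mixed_factor; case: ltnP => // _; case: eqP => // _.
exact: measurable_funB.
Qed.

Lemma mixed_factor_le2 (i l q : nat) (t : R) :
  `|mixed_factor i l (fine_bspline q t) (coarse_bspline q t)
      (fine_bspline q t - coarse_bspline q t)| <= 2.
Proof.
have f0 : 0 <= fine_bspline q t by exact: bspline_ge0.
have f1 : fine_bspline q t <= 1 by exact: bspline_le1.
have c0 : 0 <= coarse_bspline q t by rewrite divr_ge0// bspline_ge0.
have c1 : coarse_bspline q t <= 1.
  by rewrite ler_pdivrMr// mul1r (le_trans (bspline_le1 _))// ler1n.
rewrite /mixed_factor ler_norml; case: ltnP => _; last case: eqP => _;
  apply/andP; split; lra.
Qed.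

(** By [detD_coord] each term of the divergence is a Jacobian determinant up to sign; n.+1 counts
    these terms. *)
Lemma fractional_test u (C : R) :
  mu.-integrable setT (EFin \o u) -> bv_variation_alpha_bound alpha u C%:E ->
  dual_bound m alpha u (n.+1%:R * (C * lip_const)).
Proof.
move=> iu [C0 uC] j s s1; have /andP[a0 a1] := alpha01.
set D := 2 `^ _; have L0 : 0 <= lip_const by rewrite !mulr_ge0 ?exprn_ge0.
have mp i : measurable_fun setT (partial (refine_flux s i) i).
  have -> : partial (refine_flux s i) i = fun x : E => \sum_(q : idx j.+1) s q *
      \prod_(l < n.+1) mixed_factor i l
        (fine_bspline (q l) (scaled m j (x ord0 l)))
        (coarse_bspline (q l) (scaled m j (x ord0 l)))
        (fine_bspline (q l) (scaled m j (x ord0 l)) -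
         coarse_bspline (q l) (scaled m j (x ord0 l))).
    by apply/funext => x; exact: partial_refine_flux.
  apply: measurable_sum => q; apply: measurable_funM => //.
  exact: (measurable_prod_coord (fun l => measurable_partial_factor j i l (q l))).
have ip i : mu.-integrable setT (fun x => (u x * partial (refine_flux s i) i x)%:E).
  (* This crude bound grows with the number of cubes, but it only serves integrability. *)
  apply: (integrable_mul_bounded iu (mp i) (B := \sum_(q : idx j.+1) 2 ^+ n.+1)) => x.
  rewrite partial_refine_flux; apply: le_trans (ler_norm_sum _ _ _) _.
  apply: ler_sum => q _; rewrite normrM -[leRHS]mul1r ler_pM// normr_prod.
  rewrite -[n.+1 in leRHS]card_ord -prodr_const; apply: ler_prod => l _.
  by rewrite normr_ge0 mixed_factor_le2.
under eq_Rintegral do rewrite -sum_partial_refine_flux mulr_sumr.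
rewrite Rintegral_sum//.
have -> : n.+1%:R * (C * lip_const) * D = \sum_(i < n.+1) C * (lip_const * D).
  by rewrite sumr_const card_ord -[RHS]mulr_natl !mulrA.
apply: ler_sum => i _; apply: le_trans (ler_norm _) _; rewrite -lee_fin.
have LipF : (Lip (refine_flux s i) <= lip_const%:E)%E.
  apply: Lip_alpha_le => x y _; rewrite powRr1 ?sqrtr_ge0//.
  exact: refine_flux_enorm.
have HolF : (Lip_alpha alpha (refine_flux s i) <= (lip_const * D)%:E)%E.
  by apply: Lip_alpha_le => x y _; exact: refine_flux_holder.
have := uC (refine_flux s i) (coord_maps i) (le_lt_trans LipF (ltry _))
  (fun k => le_lt_trans (Lip_coord_le1 i k) (ltry _)).
move=> /le_trans => h; rewrite EFinM.
apply: le_trans (_ : _ <= C%:E * (Lip_alpha alpha (refine_flux s i) *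
   \prod_(k < n) Lip (coord_maps i k)))%E _; last first.
  rewrite lee_wpmul2l// -[leRHS]mule1 lee_pmul ?Lip_alpha_ge0//.
    by apply: prode_ge0 => k _; exact: Lip_alpha_ge0.
  exact: prod_Lip_coord_le1.
apply: le_trans (h _ (lexx _)).
have iE : (\int[mu]_x (u x * detD (refine_flux s i) (coord_maps i) x)%:E =
    ((-1) ^+ tperm ord0 i * \int[mu]_x (u x * partial (refine_flux s i) i x))%R%:E)%E.
  have ifin := integrable_fin_num measurableT
    (integrableZl measurableT ((-1) ^+ tperm ord0 i) (ip i)).
  rewrite -RintegralZl//; last exact: ip.
  apply: (etrans _ (esym (fineK ifin))); apply: eq_integral => x _.
  by rewrite detD_coord; [rewrite mulrCA EFinM|exact: C1_refine_flux].
by rewrite iE abse_EFin normrM normrX normrN1 expr1n mul1r.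
Qed.

End fractional_test.

(** * Compactness *)

Section extraction.
Context {R : realType}.

Lemma extract_subsequence (Q : nat -> nat -> Prop) :
  (forall k N, exists2 i, (N <= i)%N & Q k i) ->
  exists2 s : nat -> nat, {homo s : i j / (i < j)%N} & forall k, Q k (s k).
Proof.
move=> QN; have /choice[f fP] : forall kN : nat * nat, exists i,
    (kN.2 <= i)%N /\ Q kN.1 i.
  by move=> [k N]; have [i ? ?] := QN k N; exists i.
pose s := fix s k := if k is k'.+1 then f (k, (s k').+1) else f (0%N, 0%N).
exists s => [|[|k]]; [|by have [] := fP (0%N, 0%N)|by have [] := fP (k.+1, (s k).+1)].
by apply: homo_ltn => [? ? ?|k]; [exact: ltn_trans|have [] := fP (k.+1, (s k).+1)].
Qed.

(** By Tychonoff's theorem the rows a k have a cluster point x in the product of the segments. Step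
    k of the extraction picks a row whose first k entries are within 1 / (k + 1) of those of x. *)
Lemma bounded_diagonal_extraction (a : nat -> nat -> R) (B : nat -> R) :
  (forall k i, `|a k i| <= B i) ->
  exists s : nat -> nat, {homo s : i j / (i < j)%N} /\
    forall i, cvgn (fun k => a (s k) i).
Proof.
move=> aB.
have := @tychonoff nat (fun=> R) (fun i => `[- B i, B i]%classic)
  (fun i => @segment_compact R _ _).
move=> /(_ (a @ \oo) _)[].
  by exists 0%N => // k _ i /=; rewrite in_itv/= -ler_norml.
move=> x [_ clx].
have [s s_homo sP] : exists2 s : nat -> nat, {homo s : i j / (i < j)%N} &
    forall k, forall i, (i < k)%N -> `|x i - a (s k) i| < k.+1%:R^-1.
  apply: (extract_subsequence (Q := fun k N =>
    forall i, (i < k)%N -> `|x i - a N i| < k.+1%:R^-1)) => k N.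
  (* U constrains finitely many coordinates, so it is a neighbourhood of x in the product topology
     and meets every tail of the sequence. *)
  pose U : set (nat -> R) := [set y | forall i, (i < k)%N -> `|x i - y i| < k.+1%:R^-1].
  have [] := clx [set a i | i in [set i | (N <= i)%N]] U _ _.
  - by exists N => // i /= Ni; exists i.
  - pose PT := prod_topology (fun _ : nat => R).
    have projx (i : 'I_k) : @nbhs PT PT x [set y : PT | `|x i - y i| < k.+1%:R^-1].
      have cx : (fun y : PT => y i) @ @nbhs PT PT x --> (x i : R).
        exact: (@proj_continuous nat (fun=> R) i x).
      move/cvgrPdist_lt: cx => /(_ k.+1%:R^-1); rewrite invr_gt0 ltr0n => /(_ isT).
      exact.
    have nearU : @nbhs PT PT x
        [set y : PT | forall i : 'I_k, `|x i - y i| < k.+1%:R^-1].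
      exact: (@filter_forall PT _ _ (@nbhs PT PT x) _ projx).
    apply: (@filterS PT (@nbhs PT PT x) _ _ _ _ nearU) => y xy i ik.
    exact: (xy (Ordinal ik)).
  - by move=> _ [[i /= Ni <-] Ui]; exists i.
exists s; split => // i; apply/cvg_ex; exists (x i).
apply/cvgrPdist_lt => e e0; near=> k.
apply: lt_trans (sP k i _) _.
  by near: k; exact: nbhs_infty_gt.
near: k; exact: near_infty_natSinv_lt (PosNum e0).
Unshelve. all: by end_near. Qed.

End extraction.

Lemma gap_gt0 (R : realType) (n : nat) (alpha p : R) : 0 < alpha -> 1 <= p ->
  p < n.+1%:R / (n%:R + alpha) -> 0 < gap n.+1 alpha p.
Proof.
move=> a0 p1; have p0 : 0 < p by rewrite (lt_le_trans ltr01).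
have d0 : 0 < n%:R + alpha by rewrite ltr_wpDl.
rewrite ltr_pdivlMr// mulrC -ltr_pdivlMr// => h.
have n1 : n.+1%:R = n%:R + 1 :> R by rewrite natr1.
by rewrite /gap mulrBr mulr1; lra.
Qed.

Section Lp_facts.
Context {R : realType} {n : nat}.
Local Notation E := 'rV[R]_n.
Local Notation mu := (@lebesgue_rV R n).
Implicit Types (x : E) (u v : E -> R) (p : R) (K : set E).

Lemma Lp_funP p u : reflect (measurable_fun setT u /\ (Lp_norm p u < +oo)%E)
  (u \in Lfun mu p%:E).
Proof.
apply: (iffP andP); first by move=> [/[!inE] mu_ fu].
by move=> [mu_ fu]; split; rewrite inE.
Qed.

Lemma Lfun_integrableP u :
  u \in Lfun mu 1%E <-> mu.-integrable setT (EFin \o u).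
Proof. exact: Lfun1_integrable. Qed.

Lemma bounded_cube K : compact K -> exists m, K `<=` cube m.
Proof.
move=> /compact_bounded[B [_ KB]].
exists (Num.truncn (`|B| + 1)).+1 => x Kx l.
have xB : `|x| <= `|B| + 1 by apply: KB => //; rewrite (le_lt_trans (ler_norm _))// ltrDl.
have /andP[_ Blt] := truncn_itv (addr_ge0 (normr_ge0 B) ler01).
have : `|x ord0 l| <= `|x|.
  rewrite /Num.norm/= mx_normrE.
  by apply: (le_trans _ (le_bigmax _ _ (ord0, l))).
move=> xl; have := le_lt_trans (le_trans xl xB) Blt.
by rewrite ltr_norml => /andP[-> /ltW ->].
Qed.

Lemma supported_in_cube K m u : K `<=` cube m -> supported_in K u ->
  {ae mu, forall x, u x * \1_(cube m) x = u x}.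
Proof.
move=> Km; apply: filterS => x xK; rewrite indicE.
have [xm|xm] := boolP (x \in cube m); first by rewrite mulr1.
rewrite mulr0 xK// => /Km xm'; move/negP: xm; apply.
by rewrite inE.
Qed.

Lemma Lp_norm_ae_le p u v : 1 <= p -> measurable_fun setT u -> measurable_fun setT v ->
  {ae mu, forall x, u x = v x} -> (Lp_norm p v <= Lp_norm p u)%E.
Proof.
move=> p1 mu_ mv uv; apply: (@ae_cvg_Lnorm_le _ _ _ mu p (fun=> u)) => //.
by apply: filterS uv => x ->; exact: cvg_cst.
Qed.

Lemma measurable_mul_cube m u : measurable_fun setT u ->
  measurable_fun setT (fun x => u x * \1_(cube m) x).
Proof.
move=> mu_; apply: measurable_funM => //.
by apply: measurable_indic; exact: measurable_cube.
Qed.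

End Lp_facts.

Section fractional_variation.
Context {R : realType} {n : nat}.
Local Notation E := 'rV[R]_n.+1.
Local Notation mu := (@lebesgue_rV R n.+1).
Variables (alpha : R).
Hypothesis alpha01 : 0 < alpha < 1.
Implicit Types (x : E) (u v : E -> R) (p M : R) (K : set E).

Lemma bv_variation_alpha_ge0 u : (0 <= bv_variation_alpha alpha u)%E.
Proof. by apply: le_ereal_inf_tmp => C []. Qed.

(** The strict inequality provides an admissible constant below M, since [bv_variation_alpha] is an
    infimum. This is why 1 is added to the variation where the lemma is applied. *)
Lemma bv_variation_alpha_dual m u M : mu.-integrable setT (EFin \o u) ->
  (bv_variation_alpha alpha u < M%:E)%E ->
  dual_bound m alpha u (n.+1%:R * (M * lip_const (R := R) (n := n))).
Proof.
move=> iu /ereal_inf_lt[C uC CM]; have [C0 _] := uC.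
have Cfin : C \is a fin_num by rewrite ge0_fin_numE// (lt_trans CM (ltry _)).
rewrite -(fineK Cfin) in uC CM.
move=> j s s1; apply: le_trans (fractional_test alpha01 iu uC s1) _.
rewrite ler_wpM2r ?powR_ge0// ler_wpM2l// ler_wpM2r//.
  by rewrite !mulr_ge0 ?exprn_ge0.
by rewrite ltW// -lte_fin.
Qed.

Lemma BV_alpha_c_Lfun_c p u : 1 <= p -> 0 < gap n.+1 alpha p ->
  BV_alpha_c alpha u -> Lfun_c p u.
Proof.
move=> p1 g0 [[uL1 [K cK uK]] Vu]; have /andP[a0 a1] := alpha01.
split; last by exists K.
have [m Km] := bounded_cube cK.
have /Lp_funP[mu_ L1u] := uL1.
have iu : mu.-integrable setT (EFin \o u) by exact/Lfun_integrableP.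
have Vfin : bv_variation_alpha alpha u \is a fin_num.
  by rewrite ge0_fin_numE// bv_variation_alpha_ge0.
pose M := fine (bv_variation_alpha alpha u) + 1.
have M0 : 0 <= M by rewrite addr_ge0// fine_ge0// bv_variation_alpha_ge0.
have uM : dual_bound m alpha u (n.+1%:R * (M * lip_const (R := R) (n := n))).
  by apply: bv_variation_alpha_dual => //; rewrite -(fineK Vfin) lte_fin ltrDl.
apply/Lp_funP; split => //.
apply: le_lt_trans (Lp_norm_ae_le p1 (measurable_mul_cube m mu_) mu_
  (supported_in_cube Km uK)) _.
apply: le_lt_trans (embedding_norm a1 _ iu uM p1 g0) _.
  by rewrite !mulr_ge0 ?exprn_ge0.
by rewrite lte_add_pinfty// ltry.
Qed.

Lemma coef_le m j u (q : {ffun 'I_n.+1 -> 'I_(side m j)}) M :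
  mu.-integrable setT (EFin \o u) -> (Lp_norm 1 u <= M%:E)%E ->
  `|coef u q| <= 2 ^+ (j * n.+1) * M.
Proof.
move=> iu uM; rewrite /coef normrM ger0_norm ?exprn_ge0//.
rewrite ler_wpM2l ?exprn_ge0// -lee_fin; apply: le_trans uM.
by have := Rintegral_mul_le iu (measurable_tensor_bspline q) (tensor_bspline_le1 q);
  rewrite mul1e.
Qed.

End fractional_variation.

Section small_limits.
Context {R : realType}.

Lemma cvg_finsum (I : finType) (f : I -> nat -> R) (l : I -> R) :
  (forall i, f i k @[k --> \oo] --> l i) ->
  (\sum_i f i k) @[k --> \oo] --> \sum_i l i.
Proof.
move=> fl; elim: (index_enum _) => [|i s IH].
  under eq_fun do rewrite big_nil.
  by rewrite big_nil; exact: cvg_cst.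
under eq_fun do rewrite big_cons.
by rewrite big_cons; exact: cvgD.
Qed.

Lemma cvge0_eps (f : nat -> \bar R) : (forall k, 0 <= f k)%E ->
  (forall e : R, 0 < e -> \forall k \near \oo, (f k <= e%:E)%E) ->
  f k @[k --> \oo] --> 0%E.
Proof.
move=> f0 fe; apply/fine_cvgP; split.
  apply: filterS (fe 1 ltr01) => k fk1.
  by rewrite ge0_fin_numE// (le_lt_trans fk1)// ltry.
apply/cvgrPdist_le => e e0; apply: filterS (fe e e0) => k fke.
rewrite sub0r normrN ger0_norm ?fine_ge0//= -lee_fin fineK//.
by rewrite ge0_fin_numE// (le_lt_trans fke)// ltry.
Qed.

End small_limits.

Section compactness.
Context {R : realType} {n : nat}.
Local Notation E := 'rV[R]_n.+1.
Local Notation mu := (@lebesgue_rV R n.+1).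
Variables (alpha p : R).
Hypotheses (alpha01 : 0 < alpha < 1) (p1 : 1 <= p) (g0 : 0 < gap n.+1 alpha p).
Implicit Types (x : E) (u v : E -> R) (M : R) (K : set E).

Lemma Lp_norm_step_fin m j (c : {ffun 'I_n.+1 -> 'I_(side m j)} -> R) :
  (Lp_norm p (step c) < +oo)%E.
Proof. exact: le_lt_trans (Lnorm_step c p1) (ltry _). Qed.

Lemma stepB m j (c c' : {ffun 'I_n.+1 -> 'I_(side m j)} -> R) :
  (fun x : E => step c x - step c' x) = step (fun q => c q - c' q).
Proof.
apply/funext => x; rewrite /step -sumrB; apply: eq_bigr => q _.
by rewrite mulrBl.
Qed.

Lemma compact_embedding K (u_ : nat -> E -> R) M : compact K ->
  (forall k, BV_alpha_c alpha (u_ k)) -> (forall k, supported_in K (u_ k)) ->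
  (forall k, Lp_norm 1 (u_ k) + bv_variation_alpha alpha (u_ k) <= M%:E)%E ->
  exists (s : nat -> nat) (v : E -> R),
    [/\ {homo s : i j / (i < j)%N}, v \in Lfun mu p%:E &
        Lp_norm p (u_ (s k) \- v) @[k --> \oo] --> 0%E].
Proof.
move=> cK uBV uK uM; have /andP[a0 a1] := alpha01.
have [m Km] := bounded_cube cK.
have mu_ k : measurable_fun setT (u_ k) by case: (uBV k) => -[/Lp_funP[]].
have iu k : mu.-integrable setT (EFin \o u_ k).
  by apply/Lfun_integrableP; case: (uBV k) => -[].
have uM1 k : (Lp_norm 1 (u_ k) <= M%:E)%E.
  by apply: le_trans (uM k); rewrite leeDl// bv_variation_alpha_ge0.
have uMV k : (bv_variation_alpha alpha (u_ k) < (M + 1)%:E)%E.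
  apply: (@le_lt_trans _ _ M%:E); last by rewrite lte_fin ltrDl.
  by apply: le_trans (uM k); rewrite leeDr// Lnorm_ge0.
have M0 : 0 <= M by rewrite -lee_fin; apply: le_trans (uM1 0%N); exact: Lnorm_ge0.
pose M' : R := n.+1%:R * ((M + 1) * lip_const (R := R) (n := n)).
have M'0 : 0 <= M' by rewrite !mulr_ge0 ?addr_ge0 ?exprn_ge0.
have uD k : dual_bound m alpha (u_ k) M' by exact: bv_variation_alpha_dual.
have cD k := dual_bound_coef_decay (iu k) (uD k).
(* Pairs of a level and a multi-index are countable: [pickle] numbers all the coefficients, and
   numbers that code no pair receive the value 0. *)
pose I := {j : nat & {ffun 'I_n.+1 -> 'I_(side m j)}}.
pose a k i := if unpickle i is Some jq then
  @coef _ n.+1 m (tag (jq : I)) (u_ k) (tagged jq) else 0.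
pose B i := if unpickle i is Some jq then 2 ^+ (tag (jq : I) * n.+1) * M else 0.
have aB k i : `|a k i| <= B i.
  rewrite /a /B; case: (unpickle i) => [jq|]; last by rewrite normr0.
  exact: coef_le.
have [s [s_homo cvg_a]] := bounded_diagonal_extraction aB.
have cvg_c j (q : {ffun 'I_n.+1 -> 'I_(side m j)}) :
    cvgn (fun k => coef (u_ (s k)) q).
  have := cvg_a (pickle (Tagged (fun j => {ffun 'I_n.+1 -> 'I_(side m j)}) q)).
  by rewrite /a pickleK.
pose c j (q : {ffun 'I_n.+1 -> 'I_(side m j)}) : R := limn (fun k => coef (u_ (s k)) q).
(* At each level the inequality involves finitely many coefficients, so it passes to their
   limits. *)
have cc : coef_decay alpha c M'.
  move=> j.
  have cvg_sum : \sum_(q : {ffun 'I_n.+1 -> 'I_(side m j.+1)})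
      `|coef (u_ (s k)) q - coef (u_ (s k)) (parent q)| @[k --> \oo] -->
      \sum_q `|c j.+1 q - c j (parent q)|.
    by apply: cvg_finsum => q; apply: cvg_norm; apply: cvgB; exact: cvg_c.
  rewrite -(cvg_lim (@Rhausdorff R) cvg_sum); apply: limr_le.
    by apply/cvg_ex; eexists; exact: cvg_sum.
  by apply: nearW => k; exact: cD.
have [v [mv iv _ tail]] := step_limit a1 M'0 cc.
exists s, v; split => //.
  apply/Lp_funP; split => //.
  apply: le_lt_trans (Lnorm_le_distD _ p1 mv (measurable_step (c 0%N))) _.
  rewrite lte_add_pinfty ?Lp_norm_step_fin//.
  exact: le_lt_trans (tail p 0%N p1 g0) (ltry _).
apply: cvge0_eps => [k|e e0]; first exact: Lnorm_ge0.
have e3 : 0 < e / 3 by rewrite divr_gt0.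
(* First a level J at which both approximation errors are at most e / 3, uniformly in k; then k
   large enough for the finitely many coefficients of level J. *)
pose A := step_const n.+1 alpha p * M'.
have [J AJ] : exists J, A * decay_rate n.+1 alpha p ^+ J <= e / 3.
  have cvgA : A * decay_rate n.+1 alpha p ^+ J @[J --> \oo] --> A * 0.
    apply: cvgM; first exact: cvg_cst.
    by apply: cvg_expr; rewrite ger0_norm ?powR_ge0// decay_rate_lt1.
  move/cvgrPdist_le : cvgA => /(_ _ e3)[J _ /(_ J (leqnn J))].
  by rewrite mulr0 sub0r normrN => h; exists J; exact: le_trans (ler_norm _) h.
have cvgJ : 2 `^ (- (J * n.+1)%:R / p) * \sum_q `|coef (u_ (s k)) q - c J q|
    @[k --> \oo] --> 2 `^ (- (J * n.+1)%:R / p) * \sum_q `|c J q - c J q|.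
  apply: cvgM; first exact: cvg_cst.
  apply: cvg_finsum => q; apply: cvg_norm; apply: cvgB; first exact: cvg_c.
  exact: cvg_cst.
near=> k.
have mid : (Lp_norm p (fun x : E =>
    step (@coef _ _ m J (u_ (s k))) x - step (c J) x)%R <= (e / 3)%:E)%E.
  rewrite stepB; apply: le_trans (Lnorm_step _ p1) _; rewrite lee_fin.
  near: k; move/cvgrPdist_le : cvgJ => /(_ _ e3); apply: filterS => k.
  rewrite [X in X - _](_ : _ = 0); last first.
    by rewrite big1 ?mulr0// => q _; rewrite subrr normr0.
  by rewrite sub0r normrN; apply: le_trans; exact: ler_norm.
have mst := @measurable_step R n.+1 m J.
have mw := measurable_mul_cube m (mu_ (s k)).
apply: (@le_trans _ _ (Lp_norm p (fun x => u_ (s k) x * \1_(cube m) x - v x)%R)).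
  apply: Lp_norm_ae_le => //; [exact: measurable_funB..|].
  by apply: filterS (supported_in_cube Km (uK (s k))) => x /= ->.
apply: le_trans (Lnorm_triangle _ p1 mw (mst (coef (u_ (s k)))) mv) _.
have -> : e = e / 3 + (e / 3 + e / 3) by field.
rewrite EFinD; apply: leeD.
  by apply: le_trans (embedding J a1 M'0 (iu _) (uD _) p1 g0) _; rewrite lee_fin.
apply: le_trans (Lnorm_triangle _ p1 (mst (coef (u_ (s k)))) (mst (c J)) mv) _.
rewrite EFinD; apply: leeD => //.
rewrite /Lp_norm Lnorm_distC.
by apply: le_trans (tail p J p1 g0) _; rewrite lee_fin.
Unshelve. all: by end_near. Qed.

End compactness.

(** * Sums of functions of bounded variation *)

Section geometric_sums.
Context {R : realType}.
Implicit Types (x y sigma alpha : R).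

Lemma sum_expr_gt1_le (x : R) m : 1 < x ->
  \sum_(0 <= k < m) x ^+ k <= x ^+ m / (x - 1).
Proof.
move=> x1; rewrite ler_pdivlMr ?subr_gt0// mulr_suml.
rewrite (eq_bigr (fun k => x ^+ k.+1 - x ^+ k)); last first.
  by move=> k _; rewrite exprS; ring.
by rewrite telescope_sumr// expr0 gerBl.
Qed.

Lemma powR_nat_mul (s t : R) k : s `^ (k%:R * t) = (s `^ t) ^+ k.
Proof. by rewrite mulrC powRrM powR_mulrn// powR_ge0. Qed.

(** The first term bounds the growing geometric sum before the split, of ratio sigma^alpha; the
    second bounds the decaying sum after it, of ratio sigma^(alpha - 1). *)
Definition split_const sigma alpha : R :=
  sigma `^ alpha / (sigma `^ alpha - 1) + (1 - sigma `^ (alpha - 1))^-1.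

Lemma powR_gt1 sigma alpha : 1 < sigma -> 0 < alpha -> 1 < sigma `^ alpha.
Proof.
move=> s1 a0; apply: (@le_lt_trans _ _ (1 `^ alpha)); first by rewrite powR1.
by apply: gt0_ltr_powR; rewrite ?nnegrE// ltW// (lt_trans ltr01).
Qed.

Lemma powR_lt1 sigma alpha : 1 < sigma -> alpha < 0 -> sigma `^ alpha < 1.
Proof.
move=> s1 a0; rewrite -[alpha]opprK powRN invf_lt1 ?powR_gt0 ?(lt_trans ltr01)//.
by rewrite powR_gt1// oppr_gt0.
Qed.

(* The sum is split at the largest k with sigma ^+ k <= r. *)
Lemma sum_min_powers sigma alpha (r : R) m : 1 < sigma -> 0 < alpha < 1 -> 1 <= r ->
  \sum_(0 <= k < m) Num.min (sigma `^ (k%:R * (alpha - 1)))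
                            (sigma `^ (k%:R * alpha) / r) <=
  split_const sigma alpha * r `^ (alpha - 1).
Proof.
move=> s1 /andP[a0 a1] r1; have s0 : 0 < sigma by rewrite (lt_trans ltr01).
have r0 : 0 < r by rewrite (lt_le_trans ltr01).
set x := sigma `^ alpha; set y := sigma `^ (alpha - 1).
have x1 : 1 < x by exact: powR_gt1.
have y1 : y < 1 by apply: powR_lt1 => //; rewrite subr_lt0.
have y0 : 0 <= y by exact: powR_ge0.
have [K KP] : exists K, r < sigma ^+ K.+1.
  have cvg0 : sigma^-1 ^+ k @[k --> \oo] --> 0.
    by apply: cvg_expr; rewrite ger0_norm ?invr_ge0 ?ltW// invf_lt1.
  have rV0 : 0 < r^-1 by rewrite invr_gt0.
  move/cvgrPdist_lt : cvg0 => /(_ _ rV0)[K _ /(_ K.+1 (leqnSn K))].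
  rewrite sub0r normrN exprVn normfV ger0_norm ?exprn_ge0 ?ltW// => h.
  by exists K; rewrite -ltf_pV2// posrE// exprn_gt0.
have [{KP}K Kr Kmin] := ex_minnP (ex_intro (fun K => r < sigma ^+ K.+1) K KP).
have {Kmin}rK : sigma ^+ K <= r.
  case: K Kr Kmin => [|K] _ Kmin; first by rewrite expr0.
  by rewrite leNgt; apply/negP => /Kmin; rewrite ltnn.
(* The minimum is bounded by its second entry for k <= K and by its first entry beyond. *)
apply: (@le_trans _ _ (\sum_(0 <= k < K.+1) x ^+ k / r + \sum_(K.+1 <= k < m) y ^+ k)).
  have [Km|mK] := leqP K.+1 m.
    rewrite (big_cat_nat (n := K.+1))//=; apply: lerD; apply: ler_sum => k _.
      by rewrite ge_min; apply/orP; right; rewrite powR_nat_mul.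
    by rewrite ge_min; apply/orP; left; rewrite powR_nat_mul.
  rewrite [X in _ <= _ + X]big_geq ?(ltnW mK)// addr0.
  rewrite [leRHS](big_cat_nat (n := m))//=; last exact: ltnW.
  rewrite -[leLHS]addr0; apply: lerD.
    by apply: ler_sum => k _; rewrite ge_min; apply/orP; right; rewrite powR_nat_mul.
  by apply: sumr_ge0 => k _; rewrite divr_ge0 ?exprn_ge0 ?powR_ge0// ltW.
rewrite /split_const -/x -/y mulrDl; apply: lerD.
  rewrite -mulr_suml; apply: (@le_trans _ _ (x ^+ K.+1 / (x - 1) / r)).
    by rewrite ler_wpM2r ?invr_ge0 ?(ltW r0)// sum_expr_gt1_le.
  have xK : x ^+ K <= r `^ alpha.
    rewrite /x -powR_nat_mul powRrM powR_mulrn ?(ltW s0)//.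
    by apply: ge0_ler_powR; rewrite ?nnegrE ?exprn_ge0 ?(ltW s0) ?(ltW r0) ?(ltW a0).
  have -> : r `^ (alpha - 1) = r `^ alpha / r.
    by rewrite -(mulr_powRB1 (ltW r0) a0) mulrAC mulfV ?mul1r// gt_eqF.
  have -> : x ^+ K.+1 / (x - 1) / r = x / (x - 1) * (x ^+ K / r) by rewrite exprS; ring.
  rewrite ler_wpM2l ?ler_wpM2r ?invr_ge0 ?(ltW r0)//.
  by rewrite divr_ge0 ?subr_ge0 ?(ltW x1)// powR_ge0.
apply: le_trans (sum_expr_le K.+1 m (_ : 0 <= y < 1)) _; first by rewrite y0.
rewrite mulrC ler_wpM2l ?invr_ge0 ?subr_ge0 ?(ltW y1)//.
rewrite /y -powR_nat_mul powRrM powR_mulrn ?(ltW s0)//.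
(* The exponent alpha - 1 is negative, so that r < sigma^(K + 1) gives the inequality wanted for the
   powers. *)
rewrite -opprB !powRN lef_pV2 ?posrE ?powR_gt0 ?exprn_gt0//.
by apply: ge0_ler_powR; rewrite ?nnegrE ?exprn_ge0 ?subr_ge0 ?(ltW r0) ?(ltW s0)
  ?(ltW a1) ?(ltW Kr).
Qed.

End geometric_sums.

Section summation.
Context {R : realType} {n : nat}.
Local Notation E := 'rV[R]_n.
Local Notation mu := (@lebesgue_rV R n).
Implicit Types (x : E) (u v : E -> R) (p V y alpha sigma : R).

Section geometric_L1.
Variables (u_ : nat -> E -> R) (V y : R).
Hypotheses (V0 : 0 <= V) (y01 : 0 <= y < 1).
Hypothesis mu_ : forall k, measurable_fun setT (u_ k).
Hypothesis uV : forall k, (Lp_norm 1 (u_ k) <= (V * y ^+ k)%:E)%E.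

Local Notation partial_sum m := (fun x => \sum_(0 <= k < m) u_ k x).

Lemma measurable_partial_sum m : measurable_fun setT (partial_sum m).
Proof. by apply: measurable_sum => k; exact: mu_. Qed.

Lemma Lnorm_partial_sum_tail J m : (J <= m)%N ->
  (Lp_norm 1 (fun x => partial_sum m x - partial_sum J x)%R <=
    (V * (y ^+ J / (1 - y)))%:E)%E.
Proof.
move=> Jm; apply: le_trans (Lnorm_telescope_le _ (lexx 1) Jm measurable_partial_sum) _.
apply: (@le_trans _ _ (\sum_(J <= k < m) (V * y ^+ k)%:E)%E).
  apply: lee_sum => k _; rewrite (_ : (fun x => _) = u_ k); first exact: uV.
  by apply/funext => x; rewrite big_nat_recr//= addrAC subrr add0r.
by rewrite sumEFin lee_fin -mulr_sumr ler_wpM2l// sum_expr_le.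
Qed.

Lemma Lnorm_partial_sum m :
  (Lp_norm 1 (partial_sum m) <= (V / (1 - y))%:E)%E.
Proof.
have := Lnorm_partial_sum_tail (leq0n m).
rewrite expr0 mul1r; congr (_ <= _)%E; apply: eq_Lnorm => x /=.
by rewrite [X in _ - X]big_geq// subr0.
Qed.

Lemma geometric_is_sum : exists u, is_sum u_ u.
Proof.
have /andP[y0 y1] := y01.
have [|u mu' cvg_u] := @summable_Lnorm1_ae_cvg _ _ _ mu (fun m => partial_sum m)
    measurable_partial_sum.
  apply: (@le_lt_trans _ _ (V / (1 - y))%:E); last exact: ltry.
  apply: lime_le; first by apply: is_cvg_nneseries => j _ _; exact: Lnorm_ge0.
  apply: nearW => m.
  apply: (@le_trans _ _ (\sum_(0 <= k < m) (V * y ^+ k)%:E)%E).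
    apply: lee_sum => k _; rewrite (_ : (fun x => _) = u_ k); first exact: uV.
    by apply/funext => x; rewrite big_nat_recr//= addrAC subrr add0r.
  rewrite sumEFin lee_fin -mulr_sumr ler_wpM2l//.
  by have := sum_expr_le 0 m y01; rewrite expr0 mul1r.
exists u; split => //.
  apply/Lp_funP; split => //.
  apply: le_lt_trans (ae_cvg_Lnorm_le (lexx 1) measurable_partial_sum mu' cvg_u
    Lnorm_partial_sum) _.
  exact: ltry.
have tail J : (Lp_norm 1 (fun x => partial_sum J x - u x)%R <=
    (V * (y ^+ J / (1 - y)))%:E)%E.
  apply: (ae_cvg_Lnorm_le (f_ := fun k x => partial_sum J x - partial_sum (J + k)%N x)
    (lexx 1)) => //.
  - by move=> k; apply: measurable_funB; exact: measurable_partial_sum.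
  - by apply: measurable_funB => //; exact: measurable_partial_sum.
  - apply: filterS cvg_u => x ux; apply: cvgB; first exact: cvg_cst.
    have := ux; rewrite -(cvg_shiftn J (fun k => partial_sum k x)) /=.
    by under eq_fun do rewrite addnC.
  - move=> k; rewrite Lnorm_distC.
    by apply: Lnorm_partial_sum_tail; exact: leq_addr.
apply: (@squeeze_cvge _ _ _ _ (cst 0%E) _ (fun J => (V * (y ^+ J / (1 - y)))%:E)).
- by apply: nearW => J; rewrite Lnorm_ge0 tail.
- exact: cvg_cst.
- apply: cvg_EFin; first exact: nearW.
  rewrite -[X in _ --> X](mulr0 V) -[X in V * X](mul0r (1 - y)^-1).
  apply: cvgM; first exact: cvg_cst.
  apply: cvgM; last exact: cvg_cst.
  by apply: cvg_expr; rewrite ger0_norm.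
Qed.

Lemma is_sum_Lnorm u : is_sum u_ u -> (Lp_norm 1 u <= (V / (1 - y))%:E)%E.
Proof.
move=> [/Lp_funP[mu' _] _ cvg_u].
exact: (ae_cvg_Lnorm_le (lexx 1) measurable_partial_sum mu' cvg_u Lnorm_partial_sum).
Qed.

End geometric_L1.

(** Against a bounded function, the L^1 convergence contained in [is_sum] allows integration term by
    term. *)
Lemma is_sum_pairing (u_ : nat -> E -> R) u (g : E -> R) (B : R) :
  (forall k, mu.-integrable setT (EFin \o u_ k)) -> is_sum u_ u ->
  measurable_fun setT g -> (forall x, `|g x| <= B) ->
  (\sum_(0 <= k < m) (\int[mu]_x (u_ k x * g x))%R) @[m --> \oo] -->
  (\int[mu]_x (u x * g x))%R.
Proof.
move=> iu_ [uL1 lim_u _] mg gB; have B0 : 0 <= B := le_trans (normr_ge0 _) (gB 0).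
have iu : mu.-integrable setT (EFin \o u) by exact/Lfun_integrableP.
pose f m x := \sum_(0 <= k < m) u_ k x.
have if_ m : mu.-integrable setT (EFin \o f m).
  rewrite (_ : _ \o _ = fun x => (\sum_(0 <= k < m) (u_ k x)%:E)%E).
    by apply: integrable_sum => // k _; exact: iu_.
  by apply/funext => x /=; rewrite sumEFin.
have sumE m : \sum_(0 <= k < m) (\int[mu]_x (u_ k x * g x))%R =
    (\int[mu]_x (f m x * g x))%R.
  elim: m => [|m IH].
    rewrite big_geq//; under eq_Rintegral do rewrite /f big_geq// mul0r.
    by rewrite /Rintegral integral0.
  rewrite big_nat_recr//= IH -RintegralD//; [|exact: integrable_mul_bounded..].
  by apply: eq_Rintegral => x _; rewrite /f big_nat_recr//= mulrDl.
rewrite (_ : (fun m => _) = fun m => (\int[mu]_x (f m x * g x))%R); last first.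
  by apply/funext => m; rewrite sumE.
have /fine_cvgP[fin_lim lim0] := lim_u.
have lim0B : B * fine (Lp_norm 1 (fun x => f m x - u x)%R) @[m --> \oo] --> B * 0.
  by apply: cvgM; [exact: cvg_cst|exact: lim0].
apply/cvgrPdist_le => e e0; near=> m.
have finm : Lp_norm 1 (fun x => f m x - u x)%R \is a fin_num by near: m.
have idiff : mu.-integrable setT (EFin \o (fun x => f m x - u x)).
  exact: (integrableB _ (if_ m) iu).
rewrite distrC -RintegralB//; [|exact: integrable_mul_bounded..].
under eq_Rintegral do rewrite -mulrBl.
apply: (@le_trans _ _ (B * fine (Lp_norm 1 (fun x => f m x - u x)%R))).
  by rewrite -lee_fin EFinM fineK//; exact: Rintegral_mul_le.
apply: le_trans (ler_norm _) _.
near: m; move/cvgrPdist_le : lim0B => /(_ e e0); apply: filterS => m.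
by rewrite mulr0 sub0r normrN.
Unshelve. all: by end_near. Qed.

Lemma is_sum_dual_bound (m : nat) alpha sigma V (u_ : nat -> E -> R) u :
  0 < alpha < 1 -> 1 < sigma -> 0 <= V -> (forall k, BV (u_ k)) ->
  (forall k, Lp_norm 1 (u_ k) <= (V * sigma `^ (k%:R * (alpha - 1)))%:E)%E ->
  (forall k, bv_variation (u_ k) <= (V * sigma `^ (k%:R * alpha))%:E)%E ->
  is_sum u_ u ->
  dual_bound m alpha u (2 * (n.+1%:R * 4 ^+ n) * split_const sigma alpha * V).
Proof.
move=> alpha01 s1 V0 uBV uL1 uV su j s s_le1.
have iu k : mu.-integrable setT (EFin \o u_ k).
  by apply/Lfun_integrableP; case: (uBV k).
pose g x := \sum_q s q * refine_kernel (m := m) (j := j) q x.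
have mg : measurable_fun setT g.
  by apply: measurable_sum => q; apply: measurable_funM => //;
    exact: measurable_refine_kernel.
have g2 x : `|g x| <= 2 by exact: sum_refine_kernel_le.
have lim := is_sum_pairing iu su mg g2.
rewrite -(cvg_lim (@Rhausdorff R) lim); apply: limr_le.
  by apply/cvg_ex; eexists; exact: lim.
apply: nearW => k; set A := n.+1%:R * 4 ^+ n.
have A1 : 1 <= A :> R.
  by rewrite -[leLHS]mul1r ler_pM// ?exprn_ege1 ?ler1n.
have p1 : 1 <= 2 ^+ j :> R by rewrite exprn_ege1// ler1n.
have A0 : 0 <= A := le_trans ler01 A1.
have AV0 : 0 <= 2 * A * V by rewrite !mulr_ge0.
(* The constant 2 * A * V dominates both 2 * V, from |g| <= 2 and the L^1 norm, and A * V, from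
   [variation_test]. *)
apply: (@le_trans _ _ (\sum_(0 <= i < k) 2 * A * V *
    Num.min (sigma `^ (i%:R * (alpha - 1))) (sigma `^ (i%:R * alpha) / 2 ^+ j))).
  apply: ler_sum => i _; rewrite (minr_pMr _ _ AV0) le_min; apply/andP; split.
    apply: le_trans (ler_norm _) _; rewrite -lee_fin.
    apply: le_trans (Rintegral_mul_le (iu i) mg g2) _.
    apply: (@le_trans _ _ (2%:E * (V * sigma `^ (i%:R * (alpha - 1)))%:E)%E).
      by rewrite lee_wpmul2l.
    rewrite -EFinM lee_fin; set t := sigma `^ _.
    have -> : 2 * A * V * t = A * (2 * (V * t)) by ring.
    by rewrite ler_peMl// !mulr_ge0 ?powR_ge0.
  apply: le_trans (variation_test (iu i) (uV i) s_le1) _.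
  rewrite -/A; have -> : 2 * A * V * (sigma `^ (i%:R * alpha) / 2 ^+ j) =
    2 * (A * (V * sigma `^ (i%:R * alpha)) / 2 ^+ j) by ring.
  rewrite ler_peMl ?ler1n// divr_ge0 ?exprn_ge0// !mulr_ge0 ?powR_ge0//.
rewrite -mulr_sumr.
set D := 2 `^ _; have -> : 2 * A * split_const sigma alpha * V * D =
  2 * A * V * (split_const sigma alpha * D) by ring.
(* The two bounds balance where sigma^k = 2^j, hence r = 2^j in [sum_min_powers]. *)
rewrite ler_wpM2l//; have -> : D = (2 ^+ j) `^ (alpha - 1).
  by rewrite /D -powR_mulrn// -powRrM; congr (_ `^ _); ring.
exact: sum_min_powers.
Qed.

End summation.

Lemma cvg_indic_cube (R : realType) (n : nat) (x : 'rV[R]_n) :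
  \1_(cube m) x @[m --> \oo] --> (1 : R).
Proof.
apply: cvg_near_cst; near=> m; rewrite indicE mem_set// => l.
have : \sum_i `|x ord0 i| < m%:R by near: m; exact: nbhs_infty_gtr.
move=> xm; have : `|x ord0 l| < m%:R.
  by apply: le_lt_trans xm; rewrite (bigD1 l)//= lerDl sumr_ge0.
by rewrite ltr_norml => /andP[-> /ltW].
Unshelve. all: by end_near. Qed.

(** The support of u may be unbounded. On the cube of half-side m, [embedding_norm] gives a bound
    independent of m, and Fatou's lemma lets m tend to infinity. *)
Lemma is_sum_Lp (R : realType) (n : nat) (alpha p sigma V : R)
    (u_ : nat -> 'rV[R]_n -> R) (u : 'rV[R]_n -> R) :
  0 < alpha < 1 -> 1 <= p -> 0 < gap n alpha p -> 1 < sigma -> 0 <= V ->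
  (forall k, BV (u_ k)) ->
  (forall k, Lp_norm 1 (u_ k) <= (V * sigma `^ (k%:R * (alpha - 1)))%:E)%E ->
  (forall k, bv_variation (u_ k) <= (V * sigma `^ (k%:R * alpha))%:E)%E ->
  is_sum u_ u ->
  (Lp_norm p u <= ((step_const n alpha p *
      (2 * (n.+1%:R * 4 ^+ n) * split_const sigma alpha) +
    (1 - sigma `^ (alpha - 1))^-1) * V)%:E)%E.
Proof.
move=> alpha01 p1 g0 s1 V0 uBV uL1 uV su; have /andP[a0 a1] := alpha01.
have y01 : 0 <= sigma `^ (alpha - 1) < 1.
  by rewrite powR_ge0 powR_lt1// subr_lt0.
have mu_ k : measurable_fun setT (u_ k) by case: (uBV k) => /Lp_funP[].
have uL1' k : (Lp_norm 1 (u_ k) <= (V * (sigma `^ (alpha - 1)) ^+ k)%:E)%E.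
  by rewrite -powR_nat_mul.
have L1u := is_sum_Lnorm V0 y01 mu_ uL1' su.
have [uL _ _] := su; have /Lp_funP[mu' _] := uL.
have iu : (lebesgue_rV n).-integrable setT (EFin \o u) by exact/Lfun_integrableP.
have split0 : 0 <= split_const sigma alpha.
  rewrite addr_ge0// ?invr_ge0 ?subr_ge0 ?(ltW (powR_lt1 _ _)) ?subr_lt0//.
  by rewrite divr_ge0 ?powR_ge0// subr_ge0 ltW// powR_gt1.
apply: (@ae_cvg_Lnorm_le _ _ _ (lebesgue_rV n) p (fun m x => u x * \1_(cube m) x)) => //.
- by move=> m; exact: measurable_mul_cube.
- apply: aeW => x; rewrite -[X in _ --> X]mulr1.
  by apply: cvgM; [exact: cvg_cst|exact: cvg_indic_cube].
move=> m; have uD := is_sum_dual_bound (m := m) alpha01 s1 V0 uBV uL1 uV su.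
apply: le_trans (embedding_norm a1 _ iu uD p1 g0) _.
  by rewrite !mulr_ge0 ?exprn_ge0.
rewrite [X in (_ <= X%:E)%E]mulrDl EFinD; apply: leeD; first by rewrite lee_fin mulrA.
by rewrite [X in (_ <= X%:E)%E]mulrC.
Qed.

Theorem proposition3p5 (R : realType) (n : nat) (alpha p : R)
    (alpha01 : 0 < alpha < 1)
    (p_range : 1 <= p < n.+1%:R / (n%:R + alpha)) :
  [/\ forall sigma : R, 1 < sigma -> exists C : R,
        forall (V : R) (u_ : nat -> 'rV[R]_n.+1 -> R), 0 <= V ->
          (forall k, BV (u_ k)) ->
          (forall k, Lp_norm 1 (u_ k) <=
             (V * sigma `^ (k%:R * (alpha - 1)))%:E)%E ->
          (forall k, bv_variation (u_ k) <=
             (V * sigma `^ (k%:R * alpha))%:E)%E ->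
          (exists u, is_sum u_ u) /\
          (forall u, is_sum u_ u ->
             u \in Lfun (lebesgue_rV n.+1) p%:E /\
             (Lp_norm p u <= (C * V)%:E)%E),
      forall u : 'rV[R]_n.+1 -> R, BV_alpha_c alpha u -> Lfun_c p u &
      forall (K : set 'rV[R]_n.+1) (u_ : nat -> 'rV[R]_n.+1 -> R),
        compact K ->
        (forall k, BV_alpha_c alpha (u_ k)) ->
        (forall k, supported_in K (u_ k)) ->
        (exists M : R, forall k,
           Lp_norm 1 (u_ k) + bv_variation_alpha alpha (u_ k) <= M%:E)%E ->
        exists (s : nat -> nat) (v : 'rV[R]_n.+1 -> R),
          [/\ {homo s : i j / (i < j)%N},
              v \in Lfun (lebesgue_rV n.+1) p%:E &
              Lp_norm p (u_ (s k) \- v) @[k --> \oo] --> 0%E]].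
Proof.
have /andP[a0 a1] := alpha01; have /andP[p1 p_lt] := p_range.
have g0 := gap_gt0 a0 p1 p_lt.
split.
(* The constant is left to unification: it is that of [is_sum_Lp], which involves neither V nor the
   sequence. *)
- move=> sigma s1; eexists => V u_ V0 uBV uL1 uV; split.
    have y01 : 0 <= sigma `^ (alpha - 1) < 1.
      by rewrite powR_ge0 powR_lt1// subr_lt0.
    apply: (geometric_is_sum V0 y01) => k; last by rewrite -powR_nat_mul.
    by case: (uBV k) => /Lp_funP[].
  move=> u su; have uLp := is_sum_Lp alpha01 p1 g0 s1 V0 uBV uL1 uV su.
  split; last exact: uLp.
  apply/Lp_funP; split; last exact: le_lt_trans uLp (ltry _).
  by case: su => /Lp_funP[].
- by move=> u; exact: BV_alpha_c_Lfun_c.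
- move=> K u_ cK uBV uK [M uM].
  exact: (compact_embedding alpha01 p1 g0 cK uBV uK uM).
Qed.
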